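(* Let $n\ge4$, $k\ge1$ and $1\le s\le n$ be integers, and let $u=(u_{ij})$ be the fundamental corepresentation of $A_s(n)$, with Haar state $\int$. Then $$\int (u_{11}+\cdots+u_{ss})^k=\mathrm{Tr}\left(G_{kn}^{-1}G_{ks}\right).$$
   Context: A magic unitary is a square matrix over a C*-algebra whose entries are projections such that the entries of each row and of each column are mutually orthogonal and sum to $1$. $A_s(n)$ is the universal C*-algebra generated by $n^2$ elements $u_{ij}$ subject to the relations making $u=(u_{ij})$ a magic unitary; it is a compact quantum group with comultiplication $\Delta(u_{ij})=\sum_k u_{ik}\otimes u_{kj}$, and $u$ is its fundamental corepresentation. The Haar state $\int$ is the unique state $h$ with $(h\otimes \mathrm{id})\Delta=(\mathrm{id}\otimes h)\Delta=h(\cdot)1$. $NC(k)$ is the set of non-crossing partitions of $\{1,\ldots,k\}$, $|p|$ the number of blocks of $p$, and $p\vee q$ the join of $p$ and $q$ in the lattice of partitions. For a positive integer $m$, $G_{km}$ is the $NC(k)\times NC(k)$ matrix with entries $G_{km}(p,q)=m^{|p\vee q|}$. *)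

(* Defs.v *)
From HB Require Import structures.
From mathcomp Require Import all_boot all_order all_algebra.
From mathcomp Require Import complex.
From mathcomp Require Import reals.

Set Implicit Arguments.
Unset Strict Implicit.
Unset Printing Implicit Defensive.

Import Order.TTheory GRing.Theory Num.Theory.
Local Open Scope ring_scope.
Local Open Scope complex_scope.

Import ComplexField.Normc.

(* Unital complex C*-algebras. The norm is a real-valued operation on an
   algebra rather than a NormedModule structure: no structure can inherit from
   both SemiNormedZmodule and PzSemiRing without being below NumDomain. *)
HB.mixin Record isCStarAlgebra (R : realType) A of GRing.Algebra R[i] A := {
  star : A -> A ;
  starK : involutive star ;
  starD : {morph star : a b / a + b} ;
  starZ : forall (c : R[i]) (a : A), star (c *: a) = Num.conj c *: star a ;
  starM : forall a b : A, star (a * b) = star b * star a ;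
  cnorm : A -> R ;
  cnorm_eq0 : forall a : A, cnorm a = 0 -> a = 0 ;
  ler_cnormD : forall a b : A, cnorm (a + b) <= cnorm a + cnorm b ;
  cnormZ : forall (c : R[i]) (a : A), cnorm (c *: a) = normc c * cnorm a ;
  ler_cnormM : forall a b : A, cnorm (a * b) <= cnorm a * cnorm b ;
  cnorm_starM : forall a : A, cnorm (star a * a) = cnorm a ^+ 2 ;
  cnorm_complete : forall x : nat -> A,
    (forall e : R, 0 < e -> exists N, forall m n : nat,
       (N <= m)%N -> (N <= n)%N -> cnorm (x m - x n) < e) ->
    exists l : A, forall e : R, 0 < e -> exists N, forall n : nat,
      (N <= n)%N -> cnorm (x n - l) < e
}.

#[short(type="cstarAlgType")]
HB.structure Definition CStarAlgebra (R : realType) :=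
  {A of isCStarAlgebra R A & GRing.Algebra R[i] A}.

Section CStar.
Variable R : realType.
Implicit Types A B T : cstarAlgType R.

Definition star_preserving A B (f : A -> B) := {morph f : a / star a}.

Definition projection A (p : A) := star p = p /\ p * p = p.

Definition magic_unitary A (n : nat) (u : 'M[A]_n) : Prop :=
  [/\ forall i j, projection (u i j),
      forall i j k, j != k -> u i j * u i k = 0,
      forall i j k, i != j -> u i k * u j k = 0,
      forall i, \sum_j u i j = 1
    & forall j, \sum_i u i j = 1].

(* (A, u) is the universal C*-algebra A_s(n), up to unique isomorphism. *)
Definition quantum_permutation_algebra A (n : nat) (u : 'M[A]_n) : Prop :=
  magic_unitary u /\
  forall B (v : 'M[B]_n), magic_unitary v ->
    exists f : {lrmorphism A -> B},
      [/\ star_preserving f, forall i j, f (u i j) = v i j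
        & forall g : {lrmorphism A -> B}, star_preserving g ->
            (forall i j, g (u i j) = v i j) -> g =1 f].

Definition lin_indep A (m : nat) (a : 'I_m -> A) : Prop :=
  forall c : 'I_m -> R[i], \sum_i c i *: a i = 0 -> forall i, c i = 0.

(* T is the completion of the algebraic tensor product of A and B for some
   C*-norm, and t a b is the elementary tensor of a and b. The condition on
   linearly independent families says that the linear map induced by t on the
   algebraic tensor product is injective. *)
Record cstar_tensor A B T (t : A -> B -> T) : Prop := CStarTensor {
  tensor_linl : forall b, linear (t^~ b) ;
  tensor_linr : forall a, linear (t a) ;
  tensor1 : t 1 1 = 1 ;
  tensorM : forall a a' b b', t a b * t a' b' = t (a * a') (b * b') ;
  tensor_star : forall a b, star (t a b) = t (star a) (star b) ;
  tensor_inj : forall m (a : 'I_m -> A) (b : 'I_m -> B), lin_indep a ->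
    \sum_i t (a i) (b i) = 0 -> forall i, b i = 0 ;
  tensor_dense : forall (x : T) (e : R), 0 < e ->
    exists m (a : 'I_m -> A) (b : 'I_m -> B),
      cnorm (x - \sum_i t (a i) (b i)) < e
}.

(* The tensor product of compact quantum groups is the minimal one: the
   completion for the least C*-norm. *)
Definition min_cstar_tensor A B T (t : A -> B -> T) : Prop :=
  cstar_tensor t /\
  forall T' (t' : A -> B -> T'), cstar_tensor t' ->
    forall m (a : 'I_m -> A) (b : 'I_m -> B),
      cnorm (\sum_i t (a i) (b i)) <= cnorm (\sum_i t' (a i) (b i)).

Definition comultiplication A T (n : nat) (u : 'M[A]_n) (t : A -> A -> T)
    (Delta : {lrmorphism A -> T}) : Prop :=
  star_preserving Delta /\
  forall i j, Delta (u i j) = \sum_k t (u i k) (u k j).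

Definition bounded_map A B (L : A -> B) : Prop :=
  exists M : R, forall a, cnorm (L a) <= M * cnorm a.

(* In R[i], 0 <= z means that z is real and nonnegative. *)
Definition state A (h : {scalar A}) : Prop :=
  (forall a, 0 <= h (star a * a)) /\ h 1 = 1.

(* L = h (x) id and L = id (x) h, extended by continuity from the algebraic
   tensor product. *)
Definition slice_left A B T (t : A -> B -> T) (h : {scalar A})
    (L : {linear T -> B}) : Prop :=
  bounded_map L /\ forall a b, L (t a b) = h a *: b.

Definition slice_right A B T (t : A -> B -> T) (h : {scalar B})
    (L : {linear T -> A}) : Prop :=
  bounded_map L /\ forall a b, L (t a b) = h b *: a.

Definition haar_state A T (t : A -> A -> T) (Delta : A -> T)
    (h : {scalar A}) : Prop :=
  [/\ state h,
      exists2 L : {linear T -> A},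
        slice_left t h L & forall a, L (Delta a) = h a *: 1
    & exists2 L : {linear T -> A},
        slice_right t h L & forall a, L (Delta a) = h a *: 1].

End CStar.

Section Partitions.
Variable k : nat.
Implicit Types p q r : {set {set 'I_k}}.

Definition noncrossing p : bool :=
  [forall B in p, forall C in p, forall a in B, forall b in C,
     forall c in B, forall d in C, [&& a < b, b < c & c < d]%N ==> (B == C)].

Definition NC : {set {set {set 'I_k}}} :=
  [set p | partition p [set: 'I_k] & noncrossing p].

Definition same_block p q : rel 'I_k :=
  [rel x y | (pblock p x == pblock p y) || (pblock q x == pblock q y)].

(* The join in the lattice of all partitions ordered by refinement; it may be
   crossing even when p and q are not. *)
Definition pjoin p q : {set {set 'I_k}} :=
  equivalence_partition (connect (same_block p q)) [set: 'I_k].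

Definition finer p q : bool := [forall B in p, exists C in q, B \subset C].

Lemma same_block_eqv p q :
  {in [set: 'I_k] & &, equivalence_rel (connect (same_block p q))}.
Proof.
have sym : connect_sym (same_block p q).
  apply: sym_connect_sym => x y.
  by rewrite /same_block /= (eq_sym (pblock p x)) (eq_sym (pblock q x)).
move=> x y z _ _ _; split; first exact: connect0.
move=> xy; apply/idP/idP => [|yz]; last exact: connect_trans xy yz.
by apply: connect_trans; rewrite sym.
Qed.

Lemma pjoin_partition p q : partition (pjoin p q) [set: 'I_k].
Proof. exact: equivalence_partitionP (@same_block_eqv p q). Qed.

Lemma pjoin_ub p q :
  partition p [set: 'I_k] -> partition q [set: 'I_k] ->
  finer p (pjoin p q) && finer q (pjoin p q).
Proof.
have gen r : partition r [set: 'I_k] ->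
    (forall x y, pblock r x = pblock r y -> same_block p q x y) ->
    finer r (pjoin p q).
  move=> /and3P[cov tI n0] sub; apply/'forall_implyP => B Br.
  have /set0Pn[x xB] : B != set0 by apply: contraNneq n0 => <-.
  apply/'exists_andP.
  exists (pblock (pjoin p q) x).
  split.
    by rewrite pblock_mem // (cover_partition (pjoin_partition p q)) inE.
  apply/fintype.subsetP => y yB.
  rewrite (pblock_equivalence_partition (@same_block_eqv p q)) ?inE //.
  by apply: connect1; apply: sub; rewrite !(def_pblock tI Br).
move=> pp pq; apply/andP; split; apply: gen => // x y E;
  by rewrite /same_block /= E eqxx ?orbT.
Qed.

Lemma pjoin_lub p q r :
  partition p [set: 'I_k] -> partition q [set: 'I_k] ->
  partition r [set: 'I_k] -> finer p r -> finer q r -> finer (pjoin p q) r.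
Proof.
move=> pp pq pr pfr qfr.
have gen s : partition s [set: 'I_k] -> finer s r ->
    forall x y, pblock s x = pblock s y -> pblock r x = pblock r y.
  move=> ps /'forall_implyP sr x y E.
  have xs z : z \in pblock s z by rewrite mem_pblock (cover_partition ps) inE.
  have /sr/'exists_andP[C [Cr /fintype.subsetP sC]] : pblock s x \in s.
    by rewrite pblock_mem // (cover_partition ps) inE.
  have tI := partition_trivIset pr.
  rewrite (def_pblock tI Cr (sC _ (xs x))) (def_pblock tI Cr) //.
  by apply: sC; rewrite E.
have con x y : connect (same_block p q) x y -> pblock r x = pblock r y.
  move=> /connectP[s]; elim: s x => [x _ -> //|z s IHs x /= /andP[xz zs] yE].
  by case/orP: xz => /eqP E; rewrite ?(gen p pp pfr _ _ E)
    ?(gen q pq qfr _ _ E); exact: IHs.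
apply/'forall_implyP => B /imsetP[x _ ->]; apply/'exists_andP.
exists (pblock r x); split.
  by rewrite pblock_mem // (cover_partition pr) inE.
apply/fintype.subsetP => y; rewrite inE => /andP[_ /con ->].
by rewrite mem_pblock (cover_partition pr) inE.
Qed.

End Partitions.

Definition gram (F : nzRingType) (k m : nat) : 'M[F]_#|NC k| :=
  \matrix_(a, b) (m ^ #|pjoin (enum_val a) (enum_val b)|)%:R.

(* Main.v *)
(* Noncrossing partitions of [k] points, read as functions on words of length [k]
   in [n] letters, are linearly independent when [n >= 4]: the Temperley-Lieb
   generators with loop values alternating between [n] and [1] act on linear
   relations, by induction they kill every relation, so the Jones-Wenzl projection
   fixes it; but that projection kills every noncrossing partition.
   So the Gram matrix is invertible and yields the projection [P_k] onto their
   span. These functions are fixed by [u^(x k)], hence [H P_k = P_k] for the matrix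
   [H] of the values of the Haar state on the words [u_{i1 j1} ... u_{ik jk}].

   For the equality [H = P_k], the functional on the free *-algebra that sends
   such a word to [P_k(i, j)] is positive, because the realignment of the
   projection onto a *-algebra of matrices is positive. Its GNS representation is
   a C*-algebra with a magic unitary, in which a relation between words implies
   the same relation between the [P_k(i, j)]. Pushing the invariance
   [sum_K h(u_IK) u_KJ = h(u_IJ) 1] there gives [H P_k = H].

   Finally [int (u_11 + ... + u_ss)^k] is the sum of [P_k(i, i)] over the words [i]
   in the first [s] letters, and the sums of products of two partition functions
   over these words are the entries of [G_ks]. *)

Require Import Defs.
From HB Require Import structures.
From mathcomp Require Import classical_sets.
From mathcomp Require Import all_boot all_order all_algebra.
From mathcomp Require Import finmap monalg.
From mathcomp Require Import boolp.
From mathcomp Require Import complex.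
From mathcomp Require Import reals.
From mathcomp Require Import ring lra zify.

Set Implicit Arguments.
Unset Strict Implicit.
Unset Printing Implicit Defensive.

Import Order.TTheory GRing.Theory Num.Theory.
Local Open Scope ring_scope.
Local Open Scope complex_scope.

Import ComplexField.Normc.

(** * Completion of an algebra with a C*-seminorm *)

(** Invariance of [h] is a relation inside [A], and the relations of [A] are controlled only through
    its universal property among C*-algebras. To read the same relation on the explicit numbers
    P_k(i, j), a morphism from [A] must reach an algebra in which these numbers are visible, and the
    universal property yields one only towards a C*-algebra with a magic unitary. Hence the
    positivity on the free *-algebra, the seminorm and the completion, although the final formula is
    finite-dimensional.

    Positivity is the delicate point, because the form mixes words of all lengths. Matrices indexed
    by the words of bounded length put all these lengths into one finite-dimensional *-algebra of
    planar matrices. A vector in the range of the realigned kernel, read as a matrix, commutes with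
    the transposes of this algebra, and that turns the quadratic form into a sum of squares.

    The bound n >= 4 keeps the Jones-Wenzl coefficients a_0 = n, a_{j+1} = d_{j+1} - 1/a_j away from
    zero: they are alternately at least n/2 and at least 1/2. *)

Record cstar_seminorm (R : realType) (F : algType R[i]) := CStarSeminorm {
  sn_star : F -> F ;
  sn_starK : involutive sn_star ;
  sn_starD : {morph sn_star : a b / a + b} ;
  sn_starZ : forall (c : R[i]) (a : F),
    sn_star (c *: a) = Num.conj c *: sn_star a ;
  sn_starM : forall a b : F, sn_star (a * b) = sn_star b * sn_star a ;
  sn : F -> R ;
  sn_ge0 : forall a, 0 <= sn a ;
  sn1 : sn 1 = 1 ;
  snD : forall a b : F, sn (a + b) <= sn a + sn b ;
  snZ : forall (c : R[i]) (a : F), sn (c *: a) = normc c * sn a ;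
  snM : forall a b : F, sn (a * b) <= sn a * sn b ;
  sn_starMl : forall a : F, sn (sn_star a * a) = sn a ^+ 2
}.

Section Completion.
Variables (R : realType) (F : algType R[i]) (S : cstar_seminorm F).
Local Notation N := (sn S).
Local Notation st := (sn_star S).

Lemma normcN1 : normc (-1 : R[i]) = 1.
Proof. by rewrite normcN normc1. Qed.

Lemma normc_ge0 (c : R[i]) : 0 <= normc c.
Proof. by case: c => a b; rewrite sqrtr_ge0. Qed.

Lemma sn0 : N 0 = 0.
Proof. by rewrite -(scale0r 0) snZ normc0 mul0r. Qed.

Lemma snN a : N (- a) = N a.
Proof. by rewrite -scaleN1r snZ normcN1 mul1r. Qed.

Lemma snB a b : N (a - b) = N (b - a).
Proof. by rewrite -snN opprB. Qed.

Lemma sn_star_le a : N (st a) = N a.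
Proof.
have le b : N b <= N (st b).
  have := snM S (st b) b; rewrite sn_starMl expr2.
  have := sn_ge0 S b; rewrite le0r => /orP[/eqP -> _|b0].
    exact: sn_ge0.
  by rewrite ler_pM2r.
by apply/eqP; rewrite eq_le le -{2}(sn_starK S a) le.
Qed.

Lemma sn_starN a : st (- a) = - st a.
Proof. by rewrite -scaleN1r sn_starZ rmorphN rmorph1 scaleN1r. Qed.

Definition eventually_lt (x : nat -> F) (e : R) :=
  exists N0, forall n, (N0 <= n)%N -> N (x n) < e.

Definition cauchy (x : nat -> F) := forall e, 0 < e ->
  exists N0, forall m n, (N0 <= m)%N -> (N0 <= n)%N -> N (x m - x n) < e.

Definition null (x : nat -> F) := forall e, 0 < e -> eventually_lt x e.

Lemma evlt2 x y d e : eventually_lt x d -> eventually_lt y e ->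
  exists N0, forall n, (N0 <= n)%N -> N (x n) < d /\ N (y n) < e.
Proof.
move=> [M xM] [M' yM]; exists (maxn M M') => n; rewrite geq_max => /andP[a b].
by split; [exact: xM|exact: yM].
Qed.

Lemma nullD x y : null x -> null y -> null (fun n => x n + y n).
Proof.
move=> x0 y0 e e0; have e2 : 0 < e / 2 by lra.
have [M h] := evlt2 (x0 _ e2) (y0 _ e2); exists M => n /h[a b].
by apply: le_lt_trans (snD _ _ _) _; lra.
Qed.

Lemma nullN x : null x -> null (fun n => - x n).
Proof. by move=> x0 e /x0[M h]; exists M => n /h; rewrite snN. Qed.

Lemma null_cst a : null (fun=> a) <-> N a = 0.
Proof.
split=> [h|a0 e e0]; last by exists 0%N => n _; rewrite a0.
have := sn_ge0 S a; rewrite le0r => /orP[/eqP //|a0].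
by have [M /(_ M (leqnn _))] := h _ a0; rewrite ltxx.
Qed.

Lemma cauchy_cst a : cauchy (fun=> a).
Proof. by move=> e e0; exists 0%N => m n _ _; rewrite subrr sn0. Qed.

Lemma cauchyD x y : cauchy x -> cauchy y -> cauchy (fun n => x n + y n).
Proof.
move=> cx cy e e0; have e2 : 0 < e / 2 by lra.
have [[M xM] [M' yM]] := (cx _ e2, cy _ e2); exists (maxn M M') => m n.
rewrite !geq_max => /andP[a b] /andP[c d].
have -> : x m + y m - (x n + y n) = (x m - x n) + (y m - y n).
  by rewrite opprD addrACA.
by apply: le_lt_trans (snD _ _ _) _; have := xM _ _ a c; have := yM _ _ b d; lra.
Qed.

Lemma cauchyZ c x : cauchy x -> cauchy (fun n => c *: x n).
Proof.
move=> cx e e0; have c0 : 0 < normc c + 1 by have := normc_ge0 c; lra.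
have [M xM] := cx (e / (normc c + 1)) (divr_gt0 e0 c0).
exists M => m n a b; rewrite -scalerBr snZ.
have := xM _ _ a b; rewrite ltr_pdivlMr // => h; apply: le_lt_trans h.
by rewrite mulrC ler_wpM2l ?sn_ge0 //; lra.
Qed.

Lemma cauchyN x : cauchy x -> cauchy (fun n => - x n).
Proof.
move=> cx e /cx[M h]; exists M => m n a b.
by rewrite -opprD snN h.
Qed.

Lemma cauchy_star x : cauchy x -> cauchy (fun n => st (x n)).
Proof.
move=> cx e /cx[M h]; exists M => m n a b.
have -> : st (x m) - st (x n) = st (x m - x n).
  by rewrite sn_starD sn_starN.
by rewrite sn_star_le h.
Qed.

Lemma cauchy_bounded x : cauchy x ->
  exists C, 0 < C /\ exists N0, forall n, (N0 <= n)%N -> N (x n) < C.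
Proof.
move=> cx; have [M h] := cx 1 ltr01.
exists (N (x M) + 1); split; first by have := sn_ge0 S (x M); lra.
exists M => n Mn; have -> : x n = (x n - x M) + x M by rewrite subrK.
by apply: le_lt_trans (snD _ _ _) _; have := h _ _ Mn (leqnn M); lra.
Qed.

Lemma nullMl x y : cauchy x -> null y -> null (fun n => x n * y n).
Proof.
move=> /cauchy_bounded[C [C0 xC]] y0 e e0.
have [M h] := evlt2 xC (y0 _ (divr_gt0 e0 C0)); exists M => n /h[a b].
apply: le_lt_trans (snM _ _ _) _; move: b; rewrite ltr_pdivlMr // => b.
by apply: le_lt_trans b; rewrite mulrC ler_wpM2l ?sn_ge0 // ltW.
Qed.

Lemma nullMr x y : null x -> cauchy y -> null (fun n => x n * y n).
Proof.
move=> x0 /cauchy_bounded[C [C0 yC]] e e0.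
have [M h] := evlt2 yC (x0 _ (divr_gt0 e0 C0)); exists M => n /h[a b].
apply: le_lt_trans (snM _ _ _) _; move: b; rewrite ltr_pdivlMr // => b.
by apply: le_lt_trans b; rewrite ler_wpM2l ?sn_ge0 // ltW.
Qed.

Lemma cauchyM x y : cauchy x -> cauchy y -> cauchy (fun n => x n * y n).
Proof.
move=> cx cy.
have [C [C0 [N1 xC]]] := cauchy_bounded cx.
have [D [D0 [N2 yD]]] := cauchy_bounded cy.
move=> e e0.
have e1 : 0 < e / 2 / D by rewrite !divr_gt0 //; lra.
have e2 : 0 < e / 2 / C by rewrite !divr_gt0 //; lra.
have [[M xM] [M' yM]] := (cx _ e1, cy _ e2).
exists (maxn (maxn M M') (maxn N1 N2)) => m n.
rewrite !geq_max => /andP[/andP[a b] /andP[c d]] /andP[/andP[a' b'] /andP[c' d']].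
have -> : x m * y m - x n * y n = (x m - x n) * y m + x n * (y m - y n).
  by rewrite mulrBl mulrBr addrA subrK.
apply: le_lt_trans (snD _ _ _) _.
have h1 : N ((x m - x n) * y m) < e / 2.
  apply: le_lt_trans (snM _ _ _) _.
  have := xM _ _ a a'; rewrite ltr_pdivlMr // => h; apply: le_lt_trans h.
  by rewrite ler_wpM2l ?sn_ge0 // ltW // yD.
have h2 : N (x n * (y m - y n)) < e / 2.
  apply: le_lt_trans (snM _ _ _) _.
  have := yM _ _ b b'; rewrite ltr_pdivlMr // => h; apply: le_lt_trans h.
  by rewrite mulrC ler_wpM2l ?sn_ge0 // ltW // xC.
lra.
Qed.

(* The value of the norm at the class of a Cauchy sequence [x]: the limit of
   [N (x n)], written as an infimum to avoid any limit theory. *)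
Definition lim_sn (x : nat -> F) : R :=
  inf [set e | exists N0, forall n, (N0 <= n)%N -> N (x n) <= e].

Lemma lim_sn_set_lb x :
  has_lbound [set e | exists N0, forall n, (N0 <= n)%N -> N (x n) <= e].
Proof.
by exists 0 => e [M /(_ M (leqnn M))]; apply: le_trans; exact: sn_ge0.
Qed.

Lemma lim_sn_le x e N0 :
  (forall n, (N0 <= n)%N -> N (x n) <= e) -> lim_sn x <= e.
Proof. by move=> h; apply: ge_inf (lim_sn_set_lb x) _ _; exists N0. Qed.

Lemma lim_sn_ge0 x : 0 <= lim_sn x.
Proof.
rewrite /lim_sn; set E := (X in inf X).
(* An unbounded sequence has no eventual upper bound at all; the infimum of the empty set is then 0
   by convention. *)
have [E0|/set0P/negP/negPn/eqP ->] := pselect (E !=set0)%classic; last first.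
  by rewrite inf0.
by apply: lb_le_inf => // e [M /(_ M (leqnn M))]; apply: le_trans; exact: sn_ge0.
Qed.

Lemma lim_sn_lt x e : cauchy x -> lim_sn x < e -> eventually_lt x e.
Proof.
move=> /cauchy_bounded[C [C0 [M xC]]] /inf_lt[|d [M' h] de].
  by exists C, M => n /xC /ltW.
by exists M' => n /h /le_lt_trans; apply.
Qed.

Lemma lim_sn_null x : cauchy x -> lim_sn x = 0 -> null x.
Proof. by move=> cx x0 e e0; apply: lim_sn_lt => //; rewrite x0. Qed.

Lemma lim_snD x y : cauchy x -> cauchy y ->
  lim_sn (fun n => x n + y n) <= lim_sn x + lim_sn y.
Proof.
move=> cx cy; apply/ler_addgt0Pr => e e0.
have hx : lim_sn x < lim_sn x + e / 2 by lra.
have hy : lim_sn y < lim_sn y + e / 2 by lra.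
have [M h] := evlt2 (lim_sn_lt cx hx) (lim_sn_lt cy hy).
apply: (@lim_sn_le _ _ M) => n /h[a b].
by apply: le_trans (snD _ _ _) _; lra.
Qed.

Lemma null_lim_sn x : null x -> lim_sn x = 0.
Proof.
move=> x0; apply/eqP; rewrite eq_le lim_sn_ge0 andbT; apply/ler_addgt0Pr => e e0.
by have [M h] := x0 e e0; apply: (@lim_sn_le _ _ M) => n /h/ltW; rewrite add0r.
Qed.

Lemma eq_lim_sn x y : cauchy x -> cauchy y -> null (fun n => x n - y n) ->
  lim_sn x = lim_sn y.
Proof.
have le u v : cauchy u -> cauchy v -> null (fun n => u n - v n) ->
    lim_sn u <= lim_sn v.
  move=> cu cv uv.
  have -> : u = fun n => (u n - v n) + v n by apply/funext => n; rewrite subrK.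
  apply: le_trans (lim_snD (cauchyD cu (cauchyN cv)) cv) _.
  by rewrite (null_lim_sn uv) add0r.
move=> cx cy xy; apply/eqP; rewrite eq_le !le //.
move=> e /xy[M h]; exists M => n /h; by rewrite snB.
Qed.

Lemma lim_snZ c x : cauchy x -> lim_sn (fun n => c *: x n) = normc c * lim_sn x.
Proof.
have le d y : cauchy y -> lim_sn (fun n => d *: y n) <= normc d * lim_sn y.
  move=> cy; apply/ler_addgt0Pr => e e0.
  have d0 : 0 < normc d + 1 by have := normc_ge0 d; lra.
  have [|M h] := @lim_sn_lt y (lim_sn y + e / (normc d + 1)) cy.
    by rewrite ltrDl divr_gt0.
  apply: (@lim_sn_le _ _ M) => n /h/ltW yn; rewrite snZ.
  apply: (@le_trans _ _ (normc d * (lim_sn y + e / (normc d + 1)))).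
    by rewrite ler_wpM2l // normc_ge0.
  rewrite mulrDr lerD2l mulrCA ler_piMr // ?ltW //.
  by rewrite ltr_pdivrMr // mul1r; lra.
move=> cx; apply/eqP; rewrite eq_le le //=.
have [->|c0] := eqVneq c 0; first by rewrite normc0 mul0r lim_sn_ge0.
have nc0 : 0 < normc c.
  rewrite lt_def normc_ge0 andbT; apply: contraNneq c0 => /eq0_normc ->.
  by [].
have := le c^-1 _ (cauchyZ c cx).
have -> : (fun n => c^-1 *: (c *: x n)) = x.
  by apply/funext => n; rewrite scalerA mulVf // scale1r.
by rewrite normcV ler_pdivlMl.
Qed.

Lemma lim_snM x y : cauchy x -> cauchy y ->
  lim_sn (fun n => x n * y n) <= lim_sn x * lim_sn y.
Proof.
move=> cx cy.
have key e : 0 < e ->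
    lim_sn (fun n => x n * y n) <= (lim_sn x + e) * (lim_sn y + e).
  move=> e0.
  have hx : lim_sn x < lim_sn x + e by lra.
  have hy : lim_sn y < lim_sn y + e by lra.
  have [M h] := evlt2 (lim_sn_lt cx hx) (lim_sn_lt cy hy).
  apply: (@lim_sn_le _ _ M) => n /h[a b].
  by apply: le_trans (snM _ _ _) _; rewrite ler_pM ?sn_ge0 ?ltW.
apply/ler_addgt0Pr => d d0.
have [x0 y0] := (lim_sn_ge0 x, lim_sn_ge0 y).
have s0 : 0 < lim_sn x + lim_sn y + 1 by lra.
(* Since e <= 1, the excess e (lim x + lim y) + e^2 of the product in [key] is at most e (lim x +
   lim y + 1) <= d. *)
pose e := Num.min 1 (d / (lim_sn x + lim_sn y + 1)).
have e0 : 0 < e by rewrite /e lt_min ltr01 divr_gt0.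
have e1 : e <= 1 by rewrite /e ge_min lexx.
have : e <= d / (lim_sn x + lim_sn y + 1) by rewrite /e ge_min lexx orbT.
rewrite ler_pdivlMr // => ed.
apply: le_trans (key e e0) _.
have : e * e <= e by rewrite ler_piMr // ltW.
by nra.
Qed.

Lemma lim_sn_star x : lim_sn (fun n => st (x n)) = lim_sn x.
Proof.
rewrite /lim_sn; congr inf; apply/seteqP.
by split=> e [M h]; exists M => n /h; rewrite sn_star_le.
Qed.

Lemma lim_sn_starM x : cauchy x ->
  lim_sn (fun n => st (x n) * x n) = lim_sn x ^+ 2.
Proof.
move=> cx; apply/eqP; rewrite eq_le; apply/andP; split.
  by apply: le_trans (lim_snM (cauchy_star cx) cx) _; rewrite lim_sn_star.
have z0 := lim_sn_ge0 (fun n => st (x n) * x n).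
(* The comparison is made between square roots: N(x n)^2 = N(x n* x n) is eventually below (s +
   e)^2, which bounds N(x n) itself. *)
rewrite -[leRHS]sqr_sqrtr // ler_sqr ?nnegrE ?lim_sn_ge0 ?sqrtr_ge0 //.
apply/ler_addgt0Pr => e e0.
have s0 := sqrtr_ge0 (lim_sn (fun n => st (x n) * x n)).
set s := Num.sqrt _ in s0 *.
have [|M h] := @lim_sn_lt _ ((s + e) ^+ 2) (cauchyM (cauchy_star cx) cx).
  by rewrite -[ltLHS]sqr_sqrtr // ltr_sqr ?nnegrE -/s ?s0; lra.
apply: (@lim_sn_le _ _ M) => n /h/ltW; rewrite sn_starMl ler_sqr ?nnegrE ?sn_ge0 //.
lra.
Qed.

End Completion.

Module CStarCompletion.
Section Quotient.
Local Open Scope quotient_scope.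
Variables (R : realType) (F : algType R[i]) (S : cstar_seminorm F).

Definition cseq := {x : nat -> F | `[< cauchy S x >]}.
HB.instance Definition _ := Choice.on cseq.

Lemma cseqP (x : cseq) : cauchy S (val x).
Proof. by apply/asboolP; exact: (valP x). Qed.

Definition mk (x : nat -> F) (cx : cauchy S x) : cseq :=
  exist _ x (asboolT cx).

Definition ceq (x y : cseq) := `[< null S (fun n => val x n - val y n) >].

Lemma ceq_refl : reflexive ceq.
Proof.
move=> x; apply/asboolP; have /null_cst := sn0 S.
by congr (null S); apply/funext => n; rewrite subrr.
Qed.

Lemma ceq_sym : symmetric ceq.
Proof.
move=> x y; apply/asboolP/asboolP => /nullN;
  by congr (null S); apply/funext => n; rewrite opprB.
Qed.

Lemma ceq_trans : transitive ceq.
Proof.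
move=> y x z /asboolP xy /asboolP yz; apply/asboolP.
by move: (nullD xy yz); congr (null S); apply/funext => n; rewrite addrA subrK.
Qed.

Canonical ceq_equiv := EquivRel ceq ceq_refl ceq_sym ceq_trans.
Canonical ceq_encModRel := defaultEncModRel ceq.

Definition compl := {eq_quot ceq}.
HB.instance Definition _ : EqQuotient cseq ceq compl := EqQuotient.on compl.
HB.instance Definition _ := Choice.on compl.

Lemma eq_pi x y : (\pi_compl x = \pi_compl y) <->
  null S (fun n => val x n - val y n).
Proof.
split; first by move=> /eqP; rewrite piE => /asboolP.
by move=> h; apply/eqP; rewrite piE; apply/asboolP.
Qed.

Lemma pi_ext (x y : cseq) : val x =1 val y -> \pi_compl x = \pi_compl y.
Proof. by move=> h; congr (\pi_compl _); apply: val_inj; exact: funext. Qed.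

Lemma null_repr x : null S (fun n => val (repr (\pi_compl x)) n - val x n).
Proof. by apply/eq_pi; rewrite reprK. Qed.

Definition cst a : compl := \pi_compl (mk (cauchy_cst S a)).
Definition add (x y : compl) : compl :=
  \pi_compl (mk (cauchyD (cseqP (repr x)) (cseqP (repr y)))).
Definition opp (x : compl) : compl := \pi_compl (mk (cauchyN (cseqP (repr x)))).
Definition mul (x y : compl) : compl :=
  \pi_compl (mk (cauchyM (cseqP (repr x)) (cseqP (repr y)))).
Definition scale c (x : compl) : compl :=
  \pi_compl (mk (cauchyZ c (cseqP (repr x)))).
Definition star (x : compl) : compl := \pi_compl (mk (cauchy_star (cseqP (repr x)))).
Definition norm (x : compl) : R := lim_sn S (val (repr x)).

Lemma add_pi x y : add (\pi_compl x) (\pi_compl y) = \pi_compl (mk (cauchyD (cseqP x) (cseqP y))).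
Proof.
apply/eq_pi; move: (nullD (null_repr x) (null_repr y)).
by congr (null S); apply/funext => n /=; rewrite opprD addrACA.
Qed.

Lemma opp_pi x : opp (\pi_compl x) = \pi_compl (mk (cauchyN (cseqP x))).
Proof.
apply/eq_pi; move: (nullN (null_repr x)).
by congr (null S); apply/funext => n /=; rewrite opprD.
Qed.

Lemma mul_pi x y : mul (\pi_compl x) (\pi_compl y) = \pi_compl (mk (cauchyM (cseqP x) (cseqP y))).
Proof.
apply/eq_pi; move: (nullD (nullMr (null_repr x) (cseqP (repr (\pi_compl y))))
  (nullMl (cseqP x) (null_repr y))).
by congr (null S); apply/funext => n /=; rewrite mulrBl mulrBr addrA subrK.
Qed.

Lemma scale_pi c x : scale c (\pi_compl x) = \pi_compl (mk (cauchyZ c (cseqP x))).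
Proof.
(* Scaling is multiplication by the constant sequence [c%:A], so the product estimate applies. *)
apply/eq_pi; move: (nullMl (cauchy_cst S c%:A) (null_repr x)).
by congr (null S); apply/funext => n /=; rewrite -scalerBr mulr_algl.
Qed.

Lemma star_pi x : star (\pi_compl x) = \pi_compl (mk (cauchy_star (cseqP x))).
Proof.
apply/eq_pi => e /(null_repr x)[M h]; exists M => n /h /=.
by rewrite -sn_starN -sn_starD sn_star_le.
Qed.

Lemma norm_pi x : norm (\pi_compl x) = lim_sn S (val x).
Proof. exact: eq_lim_sn (cseqP _) (cseqP _) (null_repr x). Qed.

Let piP (P : compl -> Prop) : (forall x, P (\pi_compl x)) -> forall x, P x.
Proof. by move=> h x; rewrite -(reprK x). Qed.

Lemma addA : associative add.
Proof.
elim/piP=> x; elim/piP=> y; elim/piP=> z; rewrite !add_pi.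
by apply: pi_ext => n /=; rewrite addrA.
Qed.

Lemma addC : commutative add.
Proof.
by elim/piP=> x; elim/piP=> y; rewrite !add_pi; apply: pi_ext => n; exact: addrC.
Qed.

Lemma add0 : left_id (cst 0) add.
Proof. by elim/piP=> x; rewrite add_pi; apply: pi_ext => n; exact: add0r. Qed.

Lemma addN : left_inverse (cst 0) opp add.
Proof.
by elim/piP=> x; rewrite opp_pi add_pi; apply: pi_ext => n; exact: addNr.
Qed.

HB.instance Definition _ := GRing.isZmodule.Build compl addA addC add0 addN.

Lemma piD x y : \pi_compl x + \pi_compl y =
  \pi_compl (mk (cauchyD (cseqP x) (cseqP y))).
Proof. exact: add_pi. Qed.

Lemma piB x y : \pi_compl x - \pi_compl y =
  \pi_compl (mk (cauchyD (cseqP x) (cauchyN (cseqP y)))).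
Proof.
by rewrite (opp_pi y : - \pi_compl y = _) piD; exact: pi_ext.
Qed.

Lemma mulA : associative mul.
Proof.
elim/piP=> x; elim/piP=> y; elim/piP=> z; rewrite !mul_pi.
by apply: pi_ext => n /=; rewrite mulrA.
Qed.

Lemma mul1 : left_id (cst 1) mul.
Proof. by elim/piP=> x; rewrite mul_pi; apply: pi_ext => n; exact: mul1r. Qed.

Lemma mulr1' : right_id (cst 1) mul.
Proof. by elim/piP=> x; rewrite mul_pi; apply: pi_ext => n; exact: mulr1. Qed.

Lemma mulDl : left_distributive mul add.
Proof.
elim/piP=> x; elim/piP=> y; elim/piP=> z; rewrite !(mul_pi, add_pi).
by apply: pi_ext => n /=; rewrite mulrDl.
Qed.

Lemma mulDr : right_distributive mul add.
Proof.
elim/piP=> x; elim/piP=> y; elim/piP=> z; rewrite !(mul_pi, add_pi).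
by apply: pi_ext => n /=; rewrite mulrDr.
Qed.

Lemma one_neq0 : cst 1 != 0.
Proof.
apply/eqP => /eq_pi /= /(_ 1 ltr01)[M /(_ M (leqnn M))].
by rewrite subr0 sn1 ltxx.
Qed.

HB.instance Definition _ := GRing.Zmodule_isNzRing.Build compl
  mulA mul1 mulr1' mulDl mulDr one_neq0.

Lemma piM x y : \pi_compl x * \pi_compl y =
  \pi_compl (mk (cauchyM (cseqP x) (cseqP y))).
Proof. exact: mul_pi. Qed.

Lemma scaleA a b v : scale a (scale b v) = scale (a * b) v.
Proof.
by elim/piP: v => x; rewrite !scale_pi; apply: pi_ext => n /=; rewrite scalerA.
Qed.

Lemma scale1 : left_id 1 scale.
Proof.
by elim/piP=> x; rewrite scale_pi; apply: pi_ext => n /=; rewrite scale1r.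
Qed.

Lemma scaleDr : right_distributive scale +%R.
Proof.
move=> c; elim/piP=> x; elim/piP=> y; rewrite !(scale_pi, piD).
by apply: pi_ext => n /=; rewrite scalerDr.
Qed.

Lemma scaleDl v : {morph scale^~ v : a b / a + b}.
Proof.
elim/piP: v => x a b; rewrite !(scale_pi, piD).
by apply: pi_ext => n /=; rewrite scalerDl.
Qed.

HB.instance Definition _ := GRing.Zmodule_isLmodule.Build R[i] compl
  scaleA scale1 scaleDr scaleDl.

Lemma piZ c x : c *: \pi_compl x = \pi_compl (mk (cauchyZ c (cseqP x))).
Proof. exact: scale_pi. Qed.

Lemma scaleAl c (x y : compl) : c *: (x * y) = (c *: x) * y.
Proof.
elim/piP: x => x; elim/piP: y => y; rewrite !(piM, piZ).
by apply: pi_ext => n /=; rewrite scalerAl.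
Qed.

HB.instance Definition _ := GRing.Lmodule_isLalgebra.Build R[i] compl scaleAl.

Lemma scaleAr c (x y : compl) : c *: (x * y) = x * (c *: y).
Proof.
elim/piP: x => x; elim/piP: y => y; rewrite !(piM, piZ).
by apply: pi_ext => n /=; rewrite scalerAr.
Qed.

HB.instance Definition _ := GRing.Lalgebra_isAlgebra.Build R[i] compl scaleAr.

Lemma starK : involutive star.
Proof.
by elim/piP=> x; rewrite !star_pi; apply: pi_ext => n /=; rewrite sn_starK.
Qed.

Lemma starD : {morph star : a b / a + b}.
Proof.
elim/piP=> x; elim/piP=> y; rewrite !(star_pi, piD).
by apply: pi_ext => n /=; rewrite sn_starD.
Qed.

Lemma starZ (c : R[i]) a : star (c *: a) = Num.conj c *: star a.
Proof.
elim/piP: a => x; rewrite piZ !star_pi piZ.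
by apply: pi_ext => n /=; rewrite sn_starZ.
Qed.

Lemma starM (a b : compl) : star (a * b) = star b * star a.
Proof.
elim/piP: a => x; elim/piP: b => y.
rewrite !(piM, star_pi).
by apply: pi_ext => n /=; rewrite sn_starM.
Qed.

Lemma norm_eq0 a : norm a = 0 -> a = 0.
Proof.
elim/piP: a => x; rewrite norm_pi => /(lim_sn_null (cseqP x)) x0.
by apply/eq_pi; move: x0; congr (null S); apply/funext => n /=; rewrite subr0.
Qed.

Lemma normD (a b : compl) : norm (a + b) <= norm a + norm b.
Proof.
elim/piP: a => x; elim/piP: b => y; rewrite piD !norm_pi.
exact: lim_snD (cseqP _) (cseqP _).
Qed.

Lemma normZ (c : R[i]) a : norm (c *: a) = normc c * norm a.
Proof.
elim/piP: a => x; rewrite piZ !norm_pi.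
exact: lim_snZ (cseqP _).
Qed.

Lemma normM (a b : compl) : norm (a * b) <= norm a * norm b.
Proof.
elim/piP: a => x; elim/piP: b => y; rewrite piM !norm_pi.
exact: lim_snM (cseqP _) (cseqP _).
Qed.

Lemma norm_starM (a : compl) : norm (star a * a) = norm a ^+ 2.
Proof.
elim/piP: a => x; rewrite star_pi piM !norm_pi.
exact: lim_sn_starM (cseqP _).
Qed.

Lemma cstB a b : cst (a - b) = cst a - cst b.
Proof.
by rewrite piB; exact: pi_ext.
Qed.

Lemma norm_cst a : norm (cst a) = sn S a.
Proof.
rewrite norm_pi /=; apply/eqP; rewrite eq_le; apply/andP; split.
  by apply: (@lim_sn_le _ _ _ _ _ 0) => n _.
apply: lb_le_inf; first by exists (sn S a), 0%N => n _.
by move=> e [M /(_ M (leqnn M))].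
Qed.

Lemma cst_dense (x : compl) e : 0 < e -> exists a, norm (x - cst a) < e.
Proof.
elim/piP: x => x e0; have e2 : 0 < e / 2 by lra.
have [M h] := cseqP x e2; exists (val x M).
rewrite piB norm_pi /=.
apply: (@le_lt_trans _ _ (e / 2)); last by lra.
by apply: (@lim_sn_le _ _ _ _ _ M) => n Mn; apply/ltW/h.
Qed.

(** Diagonal argument: replace each x_m by a constant class within 1/(m+1) of it. These constants
    form a Cauchy sequence of the original algebra, and its class is the limit. *)
Lemma complete (x : nat -> compl) :
  (forall e : R, 0 < e -> exists N, forall m n : nat,
     (N <= m)%N -> (N <= n)%N -> norm (x m - x n) < e) ->
  exists l : compl, forall e : R, 0 < e -> exists N, forall n : nat,
    (N <= n)%N -> norm (x n - l) < e.
Proof.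
move=> cx.
have /boolp.choice[a ax] m : exists b, norm (x m - cst b) < m.+1%:R^-1.
  by apply: cst_dense; rewrite invr_gt0 ltr0n.
have small (e : R) : 0 < e -> exists N0, forall m, (N0 <= m)%N ->
    norm (x m - cst (a m)) < e.
  move=> e0; exists (Num.trunc e^-1) => m em.
  apply: lt_trans (ax m) _; rewrite invf_plt ?posrE //.
  have := truncnS_gt e^-1; move=> h; apply: lt_le_trans h _.
  by rewrite ler_nat.
have tri y u v : norm (u - v) <= norm (u - y) + norm (y - v).
  by rewrite (_ : u - v = (u - y) + (y - v)) ?normD // addrA subrK.
have sym u v : norm (u - v) = norm (v - u).
  by rewrite -opprB -scaleN1r normZ normcN1 mul1r.
have ca : cauchy S a.
  move=> e e0; have e3 : 0 < e / 3%:R by rewrite divr_gt0.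
  have [[M1 h1] [M2 h2]] := (cx _ e3, small _ e3).
  exists (maxn M1 M2) => m n; rewrite !geq_max => /andP[p q] /andP[p' q'].
  rewrite -norm_cst cstB; apply: le_lt_trans (tri (x m) _ _) _.
  have t2 := tri (x n) (x m) (cst (a n)).
  have := h1 _ _ p p'; have := h2 _ q; have := h2 _ q'.
  rewrite (sym (cst (a m))); move: t2.
  move: (norm _) (norm _) (norm _) (norm _) => b c d f; lra.
exists (\pi_compl (mk ca)) => e e0; have e3 : 0 < e / 3%:R by rewrite divr_gt0.
have [[M1 h1] [M2 h2]] := (small _ e3, ca _ e3).
exists (maxn M1 M2) => m; rewrite geq_max => /andP[p q].
apply: le_lt_trans (tri (cst (a m)) _ _) _.
have : norm (cst (a m) - \pi_compl (mk ca)) <= e / 3%:R.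
  rewrite piB norm_pi /=.
  by apply: (@lim_sn_le _ _ _ _ _ M2) => n Mn; apply/ltW/h2.
have := h1 _ p; move: (norm _) (norm _) => b c; lra.
Qed.

HB.instance Definition _ := isCStarAlgebra.Build R compl
  starK starD starZ starM norm_eq0 normD normZ normM norm_starM complete.

Lemma cst_zmod_morphism : zmod_morphism cst.
Proof. exact: cstB. Qed.

Lemma cst_monoid_morphism : monoid_morphism cst.
Proof.
by split=> // a b; rewrite piM; exact: pi_ext.
Qed.

Lemma cst_scalable : scalable cst.
Proof.
by move=> c a; rewrite piZ; exact: pi_ext.
Qed.

HB.instance Definition _ := GRing.isZmodMorphism.Build F compl cst
  cst_zmod_morphism.
HB.instance Definition _ := GRing.isMonoidMorphism.Build F compl cst
  cst_monoid_morphism.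
HB.instance Definition _ := GRing.isScalable.Build R[i] F compl *:%R cst
  cst_scalable.

End Quotient.

Lemma completion (R : realType) (F : algType R[i]) (S : cstar_seminorm F) :
  exists (B : cstarAlgType R) (f : {lrmorphism F -> B}),
    (forall a, f (sn_star S a) = Defs.star (f a)) /\
    (forall a, cnorm (f a) = sn S a).
Proof.
exists (compl S), (@cst R F S : {lrmorphism _ -> _}).
split=> a; last exact: norm_cst.
by rewrite /Defs.star /= star_pi; apply: pi_ext.
Qed.

End CStarCompletion.

(** * The GNS seminorm *)

Section GNS.
Variables (R : realType) (F : algType R[i]).
Variable st : F -> F.
Hypothesis stK : involutive st.
Hypothesis stD : {morph st : a b / a + b}.
Hypothesis stZ : forall (c : R[i]) (a : F), st (c *: a) = Num.conj c *: st a.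
Hypothesis stM : forall a b : F, st (a * b) = st b * st a.
Variable phi : {scalar F}.
Hypothesis phi_ge0 : forall a, 0 <= phi (st a * a).
Hypothesis phi1 : phi 1 = 1.
Hypothesis phi_bounded : forall a, exists M : R, forall b,
  phi (st (a * b) * (a * b)) <= M%:C * phi (st b * b).

Local Notation Re := complex.Re.
Local Notation Im := complex.Im.
Local Notation ip a b := (phi (st a * b)).
Let q a : R := Re (ip a a).

Let ipE a : ip a a = (q a)%:C.
Proof.
have := phi_ge0 a; rewrite /q; case: (phi _) => x y; rewrite lecE /=.
by move=> /andP[/eqP -> _].
Qed.

Let q_ge0 a : 0 <= q a.
Proof. by have := phi_ge0 a; rewrite ipE lecR. Qed.

Let conjE (c : R[i]) : Num.conj c = (Re c -i* Im c)%C.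
Proof. by case: c. Qed.

Let ip_expand a b c :
  ip (a + c *: b) (a + c *: b) =
  ip a a + Num.conj c * c * ip b b + (c * ip a b + Num.conj c * ip b a).
Proof.
rewrite stD stZ mulrDl !mulrDr.
rewrite -![(_ *: st b) * _]scalerAl -![_ * (_ *: b)]scalerAr.
by rewrite !linearD /= !linearZ /=; ring.
Qed.

(** Compatibility of [phi] with the involution is not assumed: it follows from positivity, since the
    form is real at a + c b, and the values c = 1 and c = i determine the symmetry. *)
Let ip_herm a b : ip b a = Num.conj (ip a b).
Proof.
have im c : Im (c * ip a b + Num.conj c * ip b a) = 0.
  have := ip_expand a b c; rewrite !ipE.
  move: (q _) (q _) (q _) (c * _ + _) => x y z [u v].
  rewrite conjE; case: c => c d /= /eqP; rewrite eq_complex /= => /andP[_ /eqP].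
  by lra.
have := im 1; have := im 'i; rewrite conjE rmorph1 !mul1r conjE.
case: (ip a b) (ip b a) => x y [z t] /= h1 h2.
by apply/eqP; rewrite eq_complex /=; apply/andP; split; apply/eqP; lra.
Qed.

Let CS a b : Re (ip a b) ^+ 2 + Im (ip a b) ^+ 2 <= q a * q b.
Proof.
set X := _ + _.
have X0 : 0 <= X by rewrite addr_ge0 ?sqr_ge0.
(* The phase of c is chosen to align b with a, which leaves a real quadratic polynomial in t. *)
have key t : 0 <= q a + t ^+ 2 * X * q b - 2 * t * X.
  pose c : R[i] := (- t)%:C * Num.conj (ip a b).
  have := q_ge0 (a + c *: b); rewrite -lecR -ipE ip_expand !ipE.
  rewrite (_ : (_ + _)%R = (q a + t ^+ 2 * X * q b - 2 * t * X)%:C) ?lecR //.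
  rewrite /c (ip_herm a b) /X; move: (q a) (q b) => u v.
  rewrite !conjE; case: (ip a b) => x y /=.
  apply/eqP; rewrite eq_complex /=; apply/andP; split; apply/eqP; ring.
(* If q b = 0 and X > 0, the value t = (q a + 1) / X makes [key] read q a >= 2 (q a + 1), which is
   absurd. Otherwise t = 1 / q b is the minimum of the quadratic. *)
have := q_ge0 b; rewrite le0r => /orP[/eqP b0|b0].
  rewrite b0 mulr0; have := X0; rewrite le0r => /orP[/eqP -> //|Xp].
  have := key ((q a + 1) / X); rewrite b0 mulr0 addr0.
  have -> : 2 * ((q a + 1) / X) * X = 2 * (q a + 1).
    by field; rewrite gt_eqF.
  by have := q_ge0 a; lra.
have := key (q b)^-1.
have -> : q a + (q b)^-1 ^+ 2 * X * q b - 2 * (q b)^-1 * X = q a - X / q b.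
  by field; rewrite gt_eqF.
by rewrite subr_ge0 ler_pdivrMr.
Qed.

Let nrm a := Num.sqrt (q a).

Let nrm_ge0 a : 0 <= nrm a. Proof. exact: sqrtr_ge0. Qed.

Let sqr_nrm a : nrm a ^+ 2 = q a. Proof. by rewrite sqr_sqrtr. Qed.

Let CS_Re a b : Re (ip a b) <= nrm a * nrm b.
Proof.
rewrite /nrm -sqrtrM //; apply: le_trans (ler_norm _) _.
rewrite -sqrtr_sqr ler_wsqrtr //; apply: le_trans (CS a b).
by rewrite lerDl sqr_ge0.
Qed.

Let nrmD a b : nrm (a + b) <= nrm a + nrm b.
Proof.
rewrite -ler_sqr ?nnegrE ?addr_ge0 // sqr_nrm.
have := ip_expand a b 1; rewrite scale1r !ipE => /eqP.
have := CS_Re a b; rewrite rmorph1 !mul1r (ip_herm a b) conjE.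
rewrite sqrrD !sqr_nrm; move: (nrm a * nrm b) (q _) (q _) (q _) => n u v w.
case: (ip a b) => x y /= xn; rewrite eq_complex /= => /andP[/eqP -> _].
by lra.
Qed.

Let nrmZ c a : nrm (c *: a) = normc c * nrm a.
Proof.
have -> : nrm (c *: a) = Num.sqrt ((Re c ^+ 2 + Im c ^+ 2) * q a).
  congr Num.sqrt; apply: complexI; rewrite -ipE stZ -scalerAl -scalerAr.
  rewrite !linearZ /= ipE conjE; case: c => x y /=.
  by apply/eqP; rewrite eq_complex /=; apply/andP; split; apply/eqP; ring.
by rewrite sqrtrM ?addr_ge0 ?sqr_ge0 //; case: c.
Qed.

Let bnd a (M : R) := 0 <= M /\ forall b, nrm (a * b) <= M * nrm b.

Let bnd_ex a : exists M, bnd a M.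
Proof.
have [M h] := phi_bounded a; exists (Num.sqrt `|M|); split=> [|b].
  exact: sqrtr_ge0.
rewrite /nrm -sqrtrM ?normr_ge0 // ler_wsqrtr //.
have := h b; rewrite !ipE -rmorphM lecR => /le_trans; apply.
by rewrite ler_wpM2r // ler_norm.
Qed.

(* The norm of left multiplication by [a] on the pre-Hilbert space of [phi]; the
   Hilbert space itself is not needed. *)
Let opn a := inf [set M | bnd a M]%classic.

Let opn_le a M : bnd a M -> opn a <= M.
Proof. by move=> h; apply: ge_inf => //; exists 0 => x []. Qed.

Let opn_lb a (x : R) : (forall M, bnd a M -> x <= M) -> x <= opn a.
Proof.
by move=> h; apply: lb_le_inf => [|M /h //]; have [M] := bnd_ex a; exists M.
Qed.

Let opn_ge0 a : 0 <= opn a. Proof. by apply: opn_lb => M []. Qed.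

Let opnP a b : nrm (a * b) <= opn a * nrm b.
Proof.
have := nrm_ge0 b; rewrite le0r => /orP[/eqP b0|b0].
  by have [M [_ /(_ b)]] := bnd_ex a; rewrite b0 !mulr0.
by rewrite -ler_pdivrMr //; apply: opn_lb => M [_ h]; rewrite ler_pdivrMr.
Qed.

Let opn1 : opn 1 = 1.
Proof.
apply/eqP; rewrite eq_le opn_le /=; last by split=> [//|b]; rewrite !mul1r.
apply: opn_lb => M [_ /(_ 1)]; rewrite mulr1.
suff -> : nrm 1 = 1 by rewrite mulr1.
have st1 : st 1 = 1 by rewrite -[st 1]mul1r -{1}[1]stK -stM mul1r stK.
by rewrite /nrm /q st1 mulr1 phi1 sqrtr1.
Qed.

Let opnD a b : opn (a + b) <= opn a + opn b.
Proof.
apply: opn_le; split=> [|c]; first exact: addr_ge0.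
by rewrite mulrDl; apply: le_trans (nrmD _ _) _; rewrite mulrDl lerD.
Qed.

Let opnZ_le c a : opn (c *: a) <= normc c * opn a.
Proof.
apply: opn_le; split=> [|b]; first by rewrite mulr_ge0 // normc_ge0.
by rewrite -scalerAl nrmZ -mulrA ler_wpM2l // normc_ge0.
Qed.

Let opnZ c a : opn (c *: a) = normc c * opn a.
Proof.
apply/eqP; rewrite eq_le opnZ_le /=.
have [->|c0] := eqVneq c 0; first by rewrite normc0 mul0r.
have nc0 : 0 < normc c.
  by rewrite lt_def normc_ge0 andbT; apply: contraNneq c0 => /eq0_normc ->.
have := opnZ_le c^-1 (c *: a).
by rewrite scalerA mulVf // scale1r normcV ler_pdivlMl.
Qed.

Let opnM a b : opn (a * b) <= opn a * opn b.
Proof.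
apply: opn_le; split=> [|c]; first exact: mulr_ge0.
rewrite -mulrA; apply: le_trans (opnP _ _) _.
by rewrite -mulrA ler_wpM2l.
Qed.

(** The square of the length of ab is the inner product of b with a* a b, to which Cauchy-Schwarz
    applies. *)
Let opn_starM_ge a : opn a ^+ 2 <= opn (st a * a).
Proof.
rewrite -[leRHS]sqr_sqrtr // ler_sqr ?nnegrE ?sqrtr_ge0 //.
apply: opn_le; split=> [|b]; first exact: sqrtr_ge0.
rewrite -ler_sqr ?nnegrE ?mulr_ge0 ?sqrtr_ge0 // exprMn !sqr_nrm sqr_sqrtr //.
apply: (@le_trans _ _ (Re (ip b (st a * a * b)))).
  by rewrite /q stM !mulrA.
apply: le_trans (CS_Re _ _) _; rewrite -sqr_nrm expr2 mulrA mulrC ler_wpM2r //.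
Qed.

Let opn_starM a : opn (st a * a) = opn a ^+ 2.
Proof.
have le b : opn b <= opn (st b).
  have := le_trans (opn_starM_ge b) (opnM (st b) b); rewrite expr2.
  have := opn_ge0 b; rewrite le0r => /orP[/eqP -> _|b0]; first exact: opn_ge0.
  by rewrite ler_pM2r.
apply/eqP; rewrite eq_le opn_starM_ge andbT.
apply: le_trans (opnM _ _) _; rewrite expr2 ler_wpM2r //.
by rewrite -{2}(stK a) le.
Qed.

(** Positivity alone does not bound left multiplication on a *-algebra without a norm, whence
    [phi_bounded]. The first implication makes [phi] well defined modulo null elements; the second
    is the means of imposing relations in the completion. *)
Lemma gns_seminorm : exists S : cstar_seminorm F,
  [/\ sn_star S = st, forall a, sn S a = 0 -> phi a = 0
    & forall a, (forall b, phi (st (a * b) * (a * b)) = 0) -> sn S a = 0].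
Proof.
exists (CStarSeminorm stK stD stZ stM opn_ge0 opn1 opnD opnZ opnM opn_starM).
split=> //= a.
  move=> a0; have := opnP a 1; rewrite a0 mul0r mulr1 => na.
  have qa : q a = 0.
    by rewrite -sqr_nrm; apply/eqP; rewrite sqrf_eq0 eq_le na nrm_ge0.
  have := CS 1 a.
  have -> : st 1 = 1 by rewrite -[st 1]mul1r -{1}[1]stK -stM mul1r stK.
  rewrite mul1r qa mulr0; case: (phi a) => x y /= h; apply/eqP.
  rewrite eq_complex /=; move: h (sqr_ge0 x) (sqr_ge0 y) => h x0 y0.
  by apply/andP; split; rewrite -sqrf_eq0; apply/eqP; lra.
move=> h; apply/eqP; rewrite eq_le opn_ge0 andbT; apply: opn_le; split=> // b.
by rewrite /nrm /q h sqrtr0 mul0r.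
Qed.

End GNS.

(** * Noncrossing partitions *)

Section Blocks.
Variable k : nat.
Implicit Types (p q : {set {set 'I_k}}) (e : rel 'I_k).

(** From here on partitions are built by [classes_of] and compared by [same_inj] through this
    relation, so that identities between them become boolean identities about pairs of points. *)
Definition same p : rel 'I_k := [rel i j | pblock p i == pblock p j].

Definition classes_of e := equivalence_partition e [set: 'I_k].

Lemma same_refl p i : same p i i. Proof. exact: eqxx. Qed.

Lemma same_sym p i j : same p i j = same p j i.
Proof. by rewrite /same /= eq_sym. Qed.

Lemma same_l p i j l : same p i j -> same p i l = same p j l.
Proof. by move=> /eqP ij; rewrite /same /= ij. Qed.

Lemma classes_of_partition e : equivalence_rel e ->
  partition (classes_of e) [set: 'I_k].
Proof. by move=> ee; apply: equivalence_partitionP => x y z _ _ _; exact: ee. Qed.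

Lemma same_classes_of e : equivalence_rel e -> same (classes_of e) =2 e.
Proof.
move=> ee i j; have pe := classes_of_partition ee.
rewrite /same /= eq_pblock ?(partition_trivIset pe) ?(cover_partition pe) ?inE //.
by rewrite pblock_equivalence_partition ?inE // => x y z _ _ _; exact: ee.
Qed.

Lemma same_inj p q : partition p [set: 'I_k] -> partition q [set: 'I_k] ->
  same p =2 same q -> p = q.
Proof.
move=> pp qq pq; rewrite -(preim_partition_pblock pp) -(preim_partition_pblock qq).
rewrite /preim_partition /equivalence_partition.
apply: eq_imset => x; apply/setP => y; rewrite !inE /=.
exact: pq.
Qed.

Definition noncrossing_rel e := forall a b c d : 'I_k,
  (a < b)%N -> (b < c)%N -> (c < d)%N -> e a c -> e b d -> e a b.

Lemma noncrossingP p : partition p [set: 'I_k] ->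
  reflect (noncrossing_rel (same p)) (noncrossing p).
Proof.
move=> pp; have tI := partition_trivIset pp.
have cov x : x \in cover p by rewrite (cover_partition pp) inE.
apply: (iffP idP) => [h a b c d ab bc cd ac bd|h].
  have /'forall_implyP/(_ _ (pblock_mem (cov a))) := h.
  move=> /'forall_implyP/(_ _ (pblock_mem (cov b))).
  move=> /'forall_implyP/(_ a); rewrite mem_pblock => /(_ (cov a)).
  move=> /'forall_implyP/(_ b); rewrite mem_pblock => /(_ (cov b)).
  move=> /'forall_implyP/(_ c); rewrite -eq_pblock // => /(_ ac).
  move=> /'forall_implyP/(_ d); rewrite -eq_pblock // => /(_ bd).
  by rewrite ab bc cd.
apply/'forall_implyP => B Bp; apply/'forall_implyP => C Cp.
apply/'forall_implyP => a aB; apply/'forall_implyP => b bC.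
apply/'forall_implyP => c cB; apply/'forall_implyP => d dC.
apply/implyP => /and3P[ab bc cd].
have blk x D : D \in p -> x \in D -> pblock p x = D by exact: def_pblock.
have := h a b c d ab bc cd; rewrite /same /= (blk a B) // (blk c B) //.
by rewrite (blk b C) // (blk d C) // !eqxx => /(_ isT isT).
Qed.

Lemma in_NC p : reflect (partition p [set: 'I_k] /\ noncrossing_rel (same p))
  (p \in NC k).
Proof.
rewrite inE; apply: (iffP andP) => -[pp /(noncrossingP pp) h] //.
Qed.

Lemma classes_of_NC e : equivalence_rel e -> noncrossing_rel e ->
  classes_of e \in NC k.
Proof.
move=> ee ne; apply/in_NC; split; first exact: classes_of_partition.
by move=> a b c d; rewrite !same_classes_of //; exact: ne.
Qed.

Lemma NC_partition p : p \in NC k -> partition p [set: 'I_k].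
Proof. by move=> /in_NC[]. Qed.

Lemma NC_noncrossing p : p \in NC k -> noncrossing_rel (same p).
Proof. by move=> /in_NC[]. Qed.

(** [isolate] and [join] are the traces on partitions of two operators on functions of words:
    summing over the letter at r ([compatible_isolate]) and multiplying by the Kronecker delta of
    two letters ([compatible_join]). For neighbouring points they are the Temperley-Lieb
    generators. *)
Definition isolate_rel p (r : 'I_k) : rel 'I_k :=
  [rel i j | (i == j) || [&& i != r, j != r & same p i j]].
Definition isolate p r := classes_of (isolate_rel p r).

Definition join_rel p (r s : 'I_k) : rel 'I_k :=
  [rel i j | same p i j ||
     (same p i r || same p i s) && (same p j r || same p j s)].
Definition join p r s := classes_of (join_rel p r s).

Lemma isolate_equivalence p r : equivalence_rel (isolate_rel p r).
Proof.
move=> x y z; split; rewrite /isolate_rel /= ?eqxx //.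
case: (eqVneq x y) => [-> //|xy] /= /and3P[xr yr xy'].
rewrite (same_l z xy') xr yr /=.
case: (eqVneq x z) => [xz|xz]; case: (eqVneq y z) => [yz|yz] //=.
- by rewrite -xz xr same_sym xy'.
- by rewrite -yz yr same_refl.
Qed.

Lemma join_equivalence p r s : equivalence_rel (join_rel p r s).
Proof.
move=> x y z; split; first by rewrite /join_rel /= same_refl.
rewrite /join_rel /=.
case/orP=> [xy|/andP[]]; first by rewrite !(same_l _ xy).
have key u v : same p u r || same p u s -> same p v r || same p v s ->
    join_rel p r s u z -> join_rel p r s v z.
  move=> hu hv; rewrite /join_rel /= hu hv /=; case/orP => [uz|->]; last by rewrite orbT.
  by rewrite -!(same_l _ uz) hu orbT.
move=> hx hy; apply/idP/idP; exact: key.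
Qed.

Lemma same_isolate p r : same (isolate p r) =2 isolate_rel p r.
Proof. exact/same_classes_of/isolate_equivalence. Qed.

Lemma same_join p r s : same (join p r s) =2 join_rel p r s.
Proof. exact/same_classes_of/join_equivalence. Qed.

Lemma isolate_partition p r : partition (isolate p r) [set: 'I_k].
Proof. exact/classes_of_partition/isolate_equivalence. Qed.

Lemma join_partition p r s : partition (join p r s) [set: 'I_k].
Proof. exact/classes_of_partition/join_equivalence. Qed.

Lemma isolate_NC p r : p \in NC k -> isolate p r \in NC k.
Proof.
move=> pN; apply: classes_of_NC (isolate_equivalence p r) _.
move=> a b c d ab bc cd /orP[/eqP ac|/and3P[ar cr ac]]; first by subst; lia.
case/orP=> [/eqP bd|/and3P[br dr bd]]; first by subst; lia.
by rewrite /isolate_rel /= ar br (NC_noncrossing pN ab bc cd ac bd) orbT.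
Qed.

(* Consecutive points lie on the same side of any other point, so a chord
   crossing the merged block already crosses one of its two halves. *)
Lemma join_NC p (r s : 'I_k) : s = r.+1 :> nat -> p \in NC k ->
  join p r s \in NC k.
Proof.
move=> rs pN; apply: classes_of_NC (join_equivalence p r s) _.
have nc := NC_noncrossing pN.
pose U x := same p x r || same p x s.
have U_l x y : same p x y -> U x = U y by move=> xy; rewrite /U !(same_l _ xy).
have jE x y : join_rel p r s x y = same p x y || U x && U y by [].
have Ur : U r by rewrite /U same_refl.
have Us : U s by rewrite /U same_refl orbT.
have cross a b d : same p b d -> U a -> (a < b)%N || (d < a)%N -> (b < d)%N ->
    (b < r)%N && (s < d)%N -> U b.
  move=> bd ua out bd' /andP[br sd].
  case/orP: ua => ua; case/orP: out => out.
  - have ab : same p a b by apply: (nc a b r d) => //; lia.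
    by rewrite -(U_l _ _ ab) /U ua.
  - have -> // : U b = U r; apply/U_l/(nc b r d a) => //; try lia.
    by rewrite same_sym.
  - have ab : same p a b by apply: (nc a b s d) => //; lia.
    by rewrite -(U_l _ _ ab) /U ua orbT.
  - have -> // : U b = U s; apply/U_l/(nc b s d a) => //; try lia.
    by rewrite same_sym.
have cross_in c b d : same p b d -> U c -> (b < c)%N && (c < d)%N ->
    (s < b)%N || (d < r)%N -> U b.
  move=> bd uc /andP[bc cd]; case/orP: (uc) => cr /orP[out|out].
  - have <- // : U r = U b; apply/U_l/(nc r b c d) => //; try lia.
    by rewrite same_sym.
  - by have -> // : U b = U c; apply/U_l/(nc b c d r) => //; lia.
  - have <- // : U s = U b; apply/U_l/(nc s b c d) => //; try lia.
    by rewrite same_sym.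
  - by have -> // : U b = U c; apply/U_l/(nc b c d s) => //; lia.
have chord (a b c d : 'I_k) : (a < b)%N -> (b < c)%N -> (c < d)%N -> same p b d ->
    U a -> U c -> U b.
  move=> ab bc cd bd ua uc.
  have [->|br] := eqVneq b r; first by [].
  have [->|bs] := eqVneq b s; first by [].
  have [dr|dr] := eqVneq d r; first by rewrite (U_l _ _ bd) dr.
  have [ds|ds] := eqVneq d s; first by rewrite (U_l _ _ bd) ds.
  have [i1|i1] := boolP ((b < r)%N && (s < d)%N).
    by apply: (cross a b d bd ua _ _ i1); rewrite ?ab //; lia.
  apply: (cross_in c b d) => //; first by rewrite bc.
  by move: br bs dr ds i1; rewrite -!val_eqE /=; lia.
move=> a b c d ab bc cd; rewrite !jE.
case/orP=> [ac|/andP[ua uc]]; case/orP=> [bd|/andP[ub ud]].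
- by rewrite (nc a b c d).
- apply/orP; right; rewrite ub andbT.
  have : U c; last by rewrite (U_l _ _ ac).
  rewrite -(U_l _ _ ac).
  have [->|ar] := eqVneq a r; first by [].
  have [->|as'] := eqVneq a s; first by [].
  have [cr|cr] := eqVneq c r; first by rewrite (U_l _ _ ac) cr.
  have [cs|cs] := eqVneq c s; first by rewrite (U_l _ _ ac) cs.
  have [i1|i1] := boolP ((a < r)%N && (s < c)%N).
    by apply: (cross d a c ac ud _ _ i1); rewrite ?cd ?orbT //; lia.
  apply: (cross_in b a c) => //; first by rewrite ab.
  by move: ar as' cr cs i1; rewrite -!val_eqE /=; lia.
- by rewrite ua (chord a b c d) ?orbT.
- by rewrite ua ub orbT.
Qed.

End Blocks.

#[global] Opaque same isolate join.

(** * Words compatible with a partition; noncrossing partitions built point by point *)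

Section Compatible.
Variable X : finType.
Implicit Types w : nat -> X.

(** Words are total functions of which only the first k values matter ([eq_compatible]); letters can
    then be inserted, doubled or removed by composing with index maps, without casts between
    lengths. *)
Definition compatible k (p : {set {set 'I_k}}) w : bool :=
  [forall i : 'I_k, forall j : 'I_k, same p i j ==> (w i == w j)].

Lemma compatibleP k (p : {set {set 'I_k}}) w :
  reflect (forall i j : 'I_k, same p i j -> w i = w j) (compatible p w).
Proof.
apply: (iffP forallP) => [h i j ij|h i].
  by have /forallP/(_ j)/implyP/(_ ij)/eqP := h i.
by apply/forallP => j; apply/implyP => /h ->.
Qed.

Lemma eq_compatible k (p : {set {set 'I_k}}) w w' :
  (forall i, (i < k)%N -> w i = w' i) -> compatible p w = compatible p w'.
Proof.
move=> h; apply: eq_forallb => i; apply: eq_forallb => j.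
by rewrite !h ?ltn_ord.
Qed.

Definition update w r x : nat -> X := fun i => if i == r then x else w i.

Lemma compatible_join k (p : {set {set 'I_k}}) r s w :
  compatible (join p r s) w = compatible p w && (w r == w s).
Proof.
apply/compatibleP/andP => [h|[/compatibleP h /eqP rs] i j].
  split; last first.
    by apply/eqP/h; rewrite same_join /join_rel /= !same_refl !orbT.
  by apply/compatibleP => i j ij; apply: h; rewrite same_join /join_rel /= ij.
rewrite same_join /join_rel /= => /orP[/h //|/andP[]].
by case/orP => /h ->; case/orP => /h ->.
Qed.

Definition singleton k (p : {set {set 'I_k}}) r :=
  [forall j, same p r j ==> (j == r)].

Lemma singletonP k (p : {set {set 'I_k}}) r :
  reflect (forall j, same p r j -> j = r) (singleton p r).
Proof.
by apply: (iffP forallP) => h j; [move=> rj; exact/eqP/(implyP (h j))|apply/implyP => /h ->].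
Qed.

Lemma singleton_isolate k (p : {set {set 'I_k}}) r : singleton (isolate p r) r.
Proof.
apply/singletonP => j; rewrite same_isolate /isolate_rel /= eqxx /= orbF.
by move=> /eqP ->.
Qed.

(** This is where the loop value comes from: the letter at a singleton is free, whereas any other
    member of the block of r forces it. *)
Lemma compatible_isolate k (p : {set {set 'I_k}}) (r : 'I_k) w :
  (\sum_(x : X) compatible p (update w r x))%N =
  ((if singleton p r then #|X| else 1) * compatible (isolate p r) w)%N.
Proof.
have upd x (i : 'I_k) : update w r x i = if i == r then x else w i by [].
have others x : compatible p (update w r x) -> compatible (isolate p r) w.
  move=> /compatibleP h; apply/compatibleP => i j; rewrite same_isolate.
  case/orP=> [/eqP -> //|/and3P[/negPf ir /negPf jr ij]].
  by have := h _ _ ij; rewrite !upd ir jr.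
have [sr|/singletonP nsr] := ifPn.
  rewrite -sum_nat_const; apply: eq_bigr => x _; congr nat_of_bool.
  apply/idP/idP => [/others //|/compatibleP h].
  apply/compatibleP => i j ij; rewrite !upd.
  move/singletonP: sr => sr.
  have [ir|ir] := eqVneq i r; first by rewrite ir in ij; rewrite (sr _ ij) eqxx.
  have [jr|jr] := eqVneq j r.
    by rewrite jr same_sym in ij; rewrite (sr _ ij) eqxx in ir.
  by apply: h; rewrite same_isolate /isolate_rel /= ir jr ij orbT.
have [j rj jr] : exists2 j, same p r j & j != r.
  have [j /andP[a b]|h] := pickP (fun j => same p r j && (j != r)); first by exists j.
  case: nsr => j rj; apply/eqP/negPn; by have := h j; rewrite rj /= => ->.
rewrite mul1n (bigD1 (w j)) //= big1 ?addn0 => [|x xj]; last first.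
  apply/eqP; rewrite eqb0; apply: contra xj => /compatibleP/(_ _ _ rj).
  by rewrite !upd eqxx (negPf jr) => ->.
congr nat_of_bool; apply/idP/idP => [/others //|/compatibleP h].
apply/compatibleP => a b ab; rewrite !upd.
have iso x y : x != r -> y != r -> same p x y -> w x = w y.
  by move=> xr yr xy; apply: h; rewrite same_isolate /isolate_rel /= xr yr xy orbT.
have [ar|ar] := eqVneq a r; have [br|br] := eqVneq b r => //.
- by apply: iso => //; rewrite -(same_l _ rj) -ar.
- by apply: iso => //; rewrite (same_l _ ab) br.
- exact: iso.
Qed.

Lemma insert_NC k (p : {set {set 'I_k}}) (r : nat) : p \in NC k -> (r <= k)%N ->
  exists2 p', p' \in NC k.+1 &
    forall w, compatible p' w = compatible p (w \o bump r).
Proof.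
move=> pN rk; pose r' : 'I_k.+1 := inord r; have rE : r' = r :> nat by rewrite inordK.
pose e : rel 'I_k.+1 := fun i j =>
  match unlift r' i, unlift r' j with
  | Some i', Some j' => same p i' j'
  | None, None => true
  | _, _ => false
  end.
have ee : equivalence_rel e.
  move=> x y z; rewrite /e.
  case: (unlift r' x) => [x'|]; case: (unlift r' y) => [y'|];
    case: (unlift r' z) => [z'|]; split=> //; rewrite ?same_refl //;
    exact: same_l.
have eL i j : e (lift r' i) (lift r' j) = same p i j by rewrite /e !liftK.
have nc : noncrossing_rel e.
  move=> a b c d.
  case: (unliftP r' a) => [a'|] ->; case: (unliftP r' b) => [b'|] ->;
    case: (unliftP r' c) => [c'|] ->; case: (unliftP r' d) => [d'|] ->;
    rewrite /e ?liftK ?unlift_none //= ?ltnn //;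
    try by lia.
  by rewrite /bump => ab bc cd; apply: (NC_noncrossing pN); lia.
exists (classes_of e); first exact: classes_of_NC ee nc.
move=> w; apply/compatibleP/compatibleP => h i j.
  move=> ij; have := h (lift r' i) (lift r' j); rewrite same_classes_of // eL.
  by move=> /(_ ij); rewrite /= rE.
rewrite same_classes_of //.
case: (unliftP r' i) => [i'|] ->; case: (unliftP r' j) => [j'|] ->;
  rewrite /e ?liftK ?unlift_none //= => /h; by rewrite /= rE.
Qed.

Lemma duplicate_NC k (p : {set {set 'I_k}}) (r : nat) : p \in NC k -> (r < k)%N ->
  exists2 p', p' \in NC k.+1 &
    forall w, compatible p' w =
      (w r == w r.+1) && compatible p (w \o bump r.+1).
Proof.
move=> pN rk; pose s : 'I_k.+1 := inord r.+1.
have sE : s = r.+1 :> nat by rewrite inordK.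
pose r' : 'I_k := Ordinal rk.
(* [col] collapses the new point s onto its left neighbour; the enlarged partition is the pullback
   along this monotone map. *)
pose col (i : 'I_k.+1) : 'I_k := odflt r' (unlift s i).
pose e : rel 'I_k.+1 := fun i j => same p (col i) (col j).
have ee : equivalence_rel e.
  by move=> x y z; split=> [|xy]; [exact: same_refl|exact: same_l].
have cols : col s = r' by rewrite /col unlift_none.
have colL i : col (lift s i) = i by rewrite /col liftK.
have colE i : col i = (if (i <= r)%N then i : nat else i.-1) :> nat.
  case: (unliftP s i) => [i'|] ->; rewrite ?colL ?cols /= ?sE.
    by rewrite /bump; case: ifP; lia.
  by rewrite ltnn.
have nc : noncrossing_rel e.
  move=> a b c d ab bc cd; rewrite /e => ac bd.
  (* [col] is only weakly increasing, so coincidences of images are settled before the noncrossing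
     property of [p] is used. *)
  have [abE|abE] := eqVneq (col a) (col b); first by rewrite abE same_refl.
  have [bcE|bcE] := eqVneq (col b) (col c); first by rewrite bcE.
  have [cdE|cdE] := eqVneq (col c) (col d).
    by rewrite (same_l _ ac) cdE same_sym.
  move: abE bcE cdE; rewrite -!val_eqE /= => abE bcE cdE.
  apply: (NC_noncrossing pN _ _ _ ac bd); 
    by move: abE bcE cdE; rewrite !colE; do 4?case: ifP; lia.
exists (classes_of e); first exact: classes_of_NC ee nc.
move=> w; apply/compatibleP/andP => [h|[/eqP rs /compatibleP h] i j].
  split.
    have := h (lift s r') s; rewrite same_classes_of // /e cols colL same_refl.
    by move=> /(_ isT); rewrite /= sE /bump ltnn => ->.
  apply/compatibleP => i j ij; have := h (lift s i) (lift s j).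
  by rewrite same_classes_of // /e !colL => /(_ ij); rewrite /= sE.
rewrite same_classes_of // /e => /h.
have key (u : 'I_k.+1) : w u = w (bump r.+1 (col u)).
  case: (unliftP s u) => [u'|] ->; first by rewrite colL /= sE.
  by rewrite cols /= sE /bump ltnn.
by rewrite !key.
Qed.

(** Innermost arc argument. Without singletons below m, take i < j in one block. If they are not
    adjacent, i+1 has another point l in its block, and the noncrossing property either puts i+1 in
    the block of i and j or confines l strictly between i+1 and j, up to j itself. In both cases a
    shorter arc appears. *)
Lemma NC_adjacent k (p : {set {set 'I_k}}) m : p \in NC k -> (0 < m <= k)%N ->
  (forall i : 'I_k, (m <= i)%N -> singleton p i) ->
  (exists2 r : 'I_k, (r < m)%N & singleton p r) \/
  (exists r s : 'I_k, [/\ s = r.+1 :> nat, (s < m)%N & same p r s]).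
Proof.
move=> pN /andP[m0 mk] out.
have [[r rm sr]|none] := pselect (exists2 r : 'I_k, (r < m)%N & singleton p r).
  by left; exists r.
have nsing (i : 'I_k) : (i < m)%N -> exists2 j, same p i j & j != i.
  move=> im; have [j /andP[a b]|h] := pickP (fun j => same p i j && (j != i)).
    by exists j.
  case: none; exists i => //; apply/singletonP => j ij; apply/eqP/negPn.
  by have := h j; rewrite ij /= => ->.
have small (i j : 'I_k) : same p i j -> i != j -> (j < m)%N.
  move=> ij inj; rewrite ltnNge; apply/negP => /out/singletonP/(_ i).
  by rewrite same_sym => /(_ ij) E; rewrite E eqxx in inj.
pose gap d := exists i j : 'I_k, [/\ (i < j)%N, same p i j & j - i = d]%N.
have : exists d, gap d.
  have k0 : (0 < k)%N by exact: leq_trans mk.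
  have [j ij ji] := nsing (Ordinal k0) m0.
  exists (j - 0)%N, (Ordinal k0), j; split=> //=.
  by rewrite lt0n; apply: contra ji => /eqP j0; apply/eqP/val_inj.
move=> [d gd]; right.
have [n le_dn] := ubnP d.
elim: n d le_dn gd => // n IH d; rewrite ltnS => dn [i [j [ij sij dE]]].
have jm : (j < m)%N by apply: small sij _; rewrite -val_eqE /=; lia.
have [E|ne] := eqVneq (i.+1 : nat) (j : nat); first by exists i, j; split.
have i1k : (i.+1 < k)%N by apply: leq_ltn_trans (ltn_ord j).
pose i1 := Ordinal i1k.
have [l i1l li1] := nsing i1 (leq_ltn_trans ij jm).
have li1' : l != i.+1 :> nat by rewrite -val_eqE in li1.
have i1j : same p i1 j -> exists r s : 'I_k,
    [/\ s = r.+1 :> nat, (s < m)%N & same p r s].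
  move=> h; apply: (IH (j - i1)%N); first by rewrite /=; lia.
  by exists i1, j; split=> //=; lia.
have i1i : same p i1 i -> exists r s : 'I_k,
    [/\ s = r.+1 :> nat, (s < m)%N & same p r s].
  by move=> h; apply: i1j; rewrite (same_l _ h).
have li1s : same p l i1 by rewrite same_sym.
have ii1 : (i < i1)%N by exact: leqnn.
have i1j' : (i1 < j)%N by rewrite ltn_neqAle ne ij.
have [li|li] := ltnP l i.
  have li_s := NC_noncrossing pN li ii1 i1j' li1s sij.
  by apply: i1i; rewrite same_sym -(same_l _ li_s).
have [lj|lj] := ltnP j l.
  have ii1_s := NC_noncrossing pN ii1 i1j' lj sij i1l.
  by apply: i1i; rewrite same_sym.
have [lE|lne] := eqVneq (l : nat) (i : nat).
  by apply: i1i; rewrite -(val_inj lE : l = i).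
apply: (IH (l - i1)%N); first by rewrite /=; lia.
by exists i1, l; split=> //=; lia.
Qed.

(** Converse of [insert_NC] and [duplicate_NC]: the point to delete is the singleton, or the right
    member of the adjacent pair, found by [NC_adjacent]. *)
Lemma decompose_NC k (p' : {set {set 'I_k.+1}}) : p' \in NC k.+1 ->
  exists2 p, p \in NC k & exists r, 
    ((r <= k)%N /\ forall w, compatible p' w = compatible p (w \o bump r)) \/
    ((r < k)%N /\ forall w, compatible p' w =
        (w r == w r.+1) && compatible p (w \o bump r.+1)).
Proof.
move=> pN.
have restr (r : 'I_k.+1) : exists2 p, p \in NC k &
    forall i j, same p i j = same p' (lift r i) (lift r j).
  pose e : rel 'I_k := fun i j => same p' (lift r i) (lift r j).
  have ee : equivalence_rel e.
    by move=> x y z; split=> [|xy]; [exact: same_refl|exact: same_l].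
  have nc : noncrossing_rel e.
    by move=> a b c d ab bc cd; apply: (NC_noncrossing pN); rewrite /= /bump; lia.
  exists (classes_of e); first exact: classes_of_NC ee nc.
  by move=> i j; rewrite same_classes_of.
have [|i|[r _ /singletonP sr]|[r [s [sr _ rs]]]] := @NC_adjacent _ p' k.+1 pN.
- by rewrite leqnn.
- by have := ltn_ord i; lia.
- have [p pk pE] := restr r; exists p => //; exists r; left.
  split=> [|w]; first by rewrite -ltnS.
  apply/compatibleP/compatibleP => h i j ij.
    by apply: (h (lift r i) (lift r j)); rewrite -pE.
  have [i' iE|iE] := unliftP r i; have [j' jE|jE] := unliftP r j.
  + by rewrite iE jE; apply: (h i' j'); rewrite pE -iE -jE.
  + have : same p' r i by rewrite same_sym -jE.
    by move=> /sr ->; rewrite jE.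
  + have : same p' r j by rewrite -iE.
    by move=> /sr ->; rewrite iE.
  + by rewrite iE jE.
have rk : (r < k)%N by have := ltn_ord s; lia.
have [p pk pE] := restr s; exists p => //; exists r; right.
split=> // w; rewrite -sr.
apply/compatibleP/andP => [h|[/eqP wrs /compatibleP h] i j].
  split; first by apply/eqP/h.
  by apply/compatibleP => i j ij; apply: (h (lift s i) (lift s j)); rewrite -pE.
have rL : r = lift s (Ordinal rk).
  by apply: val_inj; rewrite /= /bump sr ltnn.
have norm (x : 'I_k.+1) : exists2 x', same p' x (lift s x') & w x = w (bump s x').
  have [x' xE|xE] := unliftP s x.
    by exists x'; rewrite -?xE ?same_refl // {1}xE.
  exists (Ordinal rk); first by rewrite -rL xE same_sym.
  by rewrite xE -wrs {1}rL.
move=> ij; have [[i' ii' ->] [j' jj' ->]] := (norm i, norm j).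
by apply: (h i' j'); rewrite pE -(same_l _ ii') same_sym -(same_l _ jj') same_sym.
Qed.

End Compatible.

#[global] Opaque compatible singleton.

(** * Temperley-Lieb relations and linear independence *)

Section TemperleyLiebPartitions.
Variable k : nat.
Implicit Types (p q : {set {set 'I_k}}) (x y z t : 'I_k).

Lemma same_isolateE p r i j :
  same (isolate p r) i j = (i == j) || [&& i != r, j != r & same p i j].
Proof. exact: same_isolate. Qed.

Lemma same_joinE p r s i j : same (join p r s) i j = same p i j ||
  (same p i r || same p i s) && (same p j r || same p j s).
Proof. exact: same_join. Qed.

(** Two letters suffice, because the indicator word of a block detects its members. Identities
    between joins thereby reduce to boolean algebra through [compatible_join]. *)
Lemma compatible_inj p q : partition p [set: 'I_k] -> partition q [set: 'I_k] ->
  (forall w : nat -> bool, compatible p w = compatible q w) -> p = q.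
Proof.
move=> pp qq h; apply: same_inj => // i j.
have sub p1 p2 : (forall w : nat -> bool, compatible p1 w = compatible p2 w) ->
    same p1 i j -> same p2 i j.
  move=> e; pose w m := [exists l : 'I_k, (l == m :> nat) && same p2 i l].
  have wE (l : 'I_k) : w l = same p2 i l.
    apply/existsP/idP => [[l' /andP[/eqP/val_inj -> //]]|il].
    by exists l; rewrite eqxx.
  have /compatibleP c : compatible p1 w.
    by rewrite e; apply/compatibleP => a b ab; rewrite !wE !(same_sym _ i) (same_l _ ab).
  by move=> /c; rewrite !wE same_refl.
by apply/idP/idP; apply: sub.
Qed.

Ltac part := lazymatch goal with
  | |- is_true (partition (isolate _ _) _) => exact: isolate_partition
  | _ => exact: join_partition
  end.

Lemma isolate_isolate p x : isolate (isolate p x) x = isolate p x.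
Proof.
apply: same_inj; [part|part|move=> i j].
rewrite !same_isolateE.
by case: (i == j) (i == x) (j == x) (same p i j) => [] [] [] [].
Qed.

Lemma isolateC p x y : isolate (isolate p x) y = isolate (isolate p y) x.
Proof.
apply: same_inj; [part|part|move=> i j]; rewrite !same_isolateE.
by case: (i == j) (i == x) (j == x) (i == y) (j == y) => [] [] [] [] [].
Qed.

Lemma same_join_l p x y i :
  same (join p x y) i x = same p i x || same p i y.
Proof. by rewrite same_joinE same_refl /= andbT orbA orbb. Qed.

Lemma join_join p x y : join (join p x y) x y = join p x y.
Proof.
apply: compatible_inj; [part|part|move=> w].
by rewrite !compatible_join; case: (compatible p w); rewrite //= andbb.
Qed.

Lemma join_sym p x y : join p x y = join p y x.
Proof.
apply: compatible_inj; [part|part|move=> w].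
by rewrite !compatible_join eq_sym.
Qed.

Lemma join_comm p x y z t : join (join p x y) z t = join (join p z t) x y.
Proof.
apply: compatible_inj; [part|part|move=> w].
rewrite [LHS]compatible_join [RHS]compatible_join !compatible_join.
by case: (compatible p w); rewrite //= andbC.
Qed.

Lemma isolate_join p x y z : z != x -> z != y ->
  isolate (join p x y) z = join (isolate p z) x y.
Proof.
move=> zx zy; apply: same_inj; [part|part|move=> i j].
have iso t u : z != t -> same (isolate p z) u t = (u != z) && same p u t.
  move=> zt; rewrite same_isolateE (eq_sym t) zt /=.
  by have [->|//] := eqVneq u t; rewrite eq_sym zt same_refl.
rewrite same_isolateE !same_joinE !(iso x) // !(iso y) // same_isolateE.
have [->|iz] := eqVneq i z; have [->|jz] := eqVneq j z; rewrite ?andbF ?orbF //=.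
by rewrite orbA.
Qed.

(** Together with [join_isolate_join], the Temperley-Lieb relation e_j e_i e_j = e_j for
    neighbouring generators, at the level of partitions; the scalars are tracked separately by
    [isolate_coef]. *)
Lemma isolate_join_isolate p x y :
  isolate (join (isolate p x) x y) x = isolate p x.
Proof.
apply: same_inj; [part|part|move=> i j].
rewrite same_isolateE; have [->|ij] := eqVneq i j; first by rewrite !same_refl.
have iso_x t : t != x -> same (isolate p x) t x = false.
  by move=> tx; rewrite same_isolateE (negPf tx) eqxx.
have [ix|ix] := eqVneq i x; first by rewrite same_isolateE (negPf ij) ix eqxx.
have [jx|jx] := eqVneq j x.
  by rewrite same_isolateE (negPf ij) jx eqxx /= !andbF.
rewrite /= same_joinE !iso_x //=.
apply/orP/idP => [[//|/andP[iy jy]]|->]; last by left.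
by rewrite (same_l _ iy) same_sym.
Qed.

Lemma join_isolate_join p x y : y != x ->
  join (isolate (join p x y) x) x y = join p x y.
Proof.
move=> yx; set q := join p x y.
have qxy : same q x y by rewrite same_sym /q same_join_l same_refl orbT.
apply: same_inj; [part|part|move=> i j].
have V t : same (isolate q x) t x || same (isolate q x) t y = same q t y.
  rewrite !same_isolateE eqxx /= andbF orbF yx /=.
  have [->|tx] := eqVneq t x; first by rewrite qxy.
  by have [->|//] := eqVneq t y; rewrite same_refl.
rewrite same_joinE !V same_isolateE.
have [->|ij] := eqVneq i j; first by rewrite !same_refl.
apply/orP/idP => [[/and3P[]//|/andP[iy jy]]|qij].
  by rewrite (same_l _ iy) same_sym.
have [ix|ix] := eqVneq i x; first by right; rewrite -(same_l _ qij) ix qxy.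
have [jx|jx] := eqVneq j x; first by right; rewrite (same_l _ qij) jx qxy.
by left; rewrite qij.
Qed.

Lemma singleton_join p x y : y != x -> singleton (join p x y) x = false.
Proof.
move=> yx; apply/negP => /singletonP/(_ y).
rewrite same_sym same_join_l same_refl orbT => /(_ isT)/eqP.
exact/negP.
Qed.

Lemma singleton_joinN p x y z : z != x -> z != y ->
  singleton (join p x y) z = singleton p z.
Proof.
move=> zx zy; apply/singletonP/singletonP => h j.
  by move=> zj; apply: h; rewrite same_joinE zj.
rewrite same_joinE => /orP[/h //|/andP[/orP[]/h e _]]; first by rewrite e eqxx in zx.
by rewrite e eqxx in zy.
Qed.

Lemma isolate_singleton p x : partition p [set: 'I_k] -> singleton p x ->
  isolate p x = p.
Proof.
move=> pp /singletonP sx; apply: same_inj => // [|i j].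
  exact: isolate_partition.
rewrite same_isolateE; apply/orP/idP => [[/eqP ->|/and3P[]//]|ij].
  exact: same_refl.
have [ix|ix] := eqVneq i x; first by left; rewrite ix (sx j) // -ix.
have [jx|jx] := eqVneq j x; last by right; rewrite ij.
by left; rewrite jx (sx i) // same_sym -jx.
Qed.

Lemma singleton_isolateN p x y : x != y -> ~~ same p x y ->
  singleton (isolate p x) y = singleton p y.
Proof.
move=> xy nxy; apply/singletonP/singletonP => h j.
  move=> yj; have [jx|jx] := eqVneq j x.
    by move: nxy; rewrite same_sym -jx yj.
  by apply: h; rewrite same_isolateE yj jx (eq_sym y x) xy orbT.
by rewrite same_isolateE => /orP[/eqP ->//|/and3P[_ _ /h]].
Qed.

(** For distinct points both sides say that the common block is {x, y}. This matches the scalars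
    when two isolations are exchanged. *)
Lemma singleton_isolateC p x y : same p x y ->
  singleton (isolate p x) y = singleton (isolate p y) x.
Proof.
move=> sxy; have [->//|xy] := eqVneq x y.
have half a b : a != b -> same p a b ->
    singleton (isolate p a) b -> singleton (isolate p b) a.
  move=> ab sab /singletonP h; apply/singletonP => j.
  rewrite same_isolateE => /orP[/eqP ->//|/and3P[_ jb aj]].
  apply/eqP/negPn/negP => ja; move: jb; rewrite (h j) ?eqxx //.
  by rewrite same_isolateE (eq_sym b a) ab ja -(same_l _ sab) aj orbT.
by apply/idP/idP; apply: half; rewrite // 1?eq_sym // same_sym.
Qed.

End TemperleyLiebPartitions.

(* The Jones-Wenzl recursion, for generators rescaled so that [e_j^2] is
   alternately [n e_j] and [e_j] and the braid relations carry no scalar. *)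
Section JonesWenzl.
Variables (F : fieldType) (N L : nat) (e : nat -> 'M[F]_N) (d a : nat -> F).
Hypothesis eM : forall j, (j < L)%N -> e j *m e j = d j *: e j.
Hypothesis ebl : forall j, (j.+1 < L)%N -> e j.+1 *m e j *m e j.+1 = e j.+1.
Hypothesis eC : forall i j, (i.+1 < j < L)%N -> e i *m e j = e j *m e i.
Hypothesis a0 : a 0%N = d 0%N.
Hypothesis aS : forall j, a j.+1 = d j.+1 - (a j)^-1.
Hypothesis a_neq0 : forall j, a j != 0.

Fixpoint jones_wenzl m : 'M[F]_N :=
  if m is m'.+1 then jones_wenzl m' -
    (a m')^-1 *: (jones_wenzl m' *m e m' *m jones_wenzl m')
  else 1%:M.
Local Notation f := jones_wenzl.

(** The last clause drives the induction: it is the identity that makes f_{m+1} annihilate e_m. At m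
    = 0 the predecessor is again 0, so f_{-1} is read as 1. *)
Let inv m := [/\ forall j, (m < j < L)%N -> f m *m e j = e j *m f m,
  forall j, (j < m)%N -> e j *m f m = 0 /\ f m *m e j = 0,
  f m *m f m = f m,
  (m < L)%N -> [/\ f m *m f m.-1 = f m, f m.-1 *m f m = f m &
     f m.-1 *m e m = e m *m f m.-1] &
  (m < L)%N -> e m *m f m *m e m = a m *: (f m.-1 *m e m)].

Lemma jones_wenzl_invariant m : (m <= L)%N -> inv m.
Proof.
elim: m => [_|m IH mL].
  split=> //=.
  - by move=> j _; rewrite mul1mx mulmx1.
  - by rewrite mulmx1.
  - by rewrite !mulmx1 mul1mx.
  - by move=> L0; rewrite mulmx1 mul1mx eM // a0.
have [fC fe ff fg efe] := IH (ltnW mL).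
have [fg1 gf1 ge] := fg mL; move: (efe mL) => {fg}efe.
set c := (a m)^-1; set g := f m.-1 in fg1 gf1 ge efe.
have fSE : f m.+1 = f m - c *: (f m *m e m *m f m) by [].
have fSf : f m.+1 *m f m = f m.+1.
  by rewrite fSE mulmxBl -scalemxAl -(mulmxA _ (f m) (f m)) ff.
have ffS : f m *m f m.+1 = f m.+1.
  by rewrite fSE mulmxBr -scalemxAr !mulmxA ff.
have ca : c * a m = 1 by rewrite mulVf.
have fSe : f m.+1 *m e m = 0.
  rewrite fSE mulmxBl -scalemxAl -!mulmxA (mulmxA (e m)) efe.
  by rewrite -scalemxAr scalerA ca scale1r mulmxA fg1 subrr.
have efS : e m *m f m.+1 = 0.
  rewrite fSE mulmxBr -scalemxAr !mulmxA efe -!scalemxAl scalerA ca scale1r.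
  by rewrite ge -mulmxA gf1 subrr.
have fSC j : (m.+1 < j < L)%N -> f m.+1 *m e j = e j *m f m.+1.
  move=> /andP[mj jL]; have fj : f m *m e j = e j *m f m by rewrite fC ?jL 1?ltnW.
  rewrite fSE mulmxBl mulmxBr fj -scalemxAl -scalemxAr; congr (_ - _ *: _).
  rewrite -(mulmxA _ (f m) (e j)) fj mulmxA -(mulmxA (f m) (e m)) eC ?mj ?jL //.
  by rewrite mulmxA fj -!mulmxA.
split=> //.
- move=> j; rewrite ltnS leq_eqVlt => /orP[/eqP -> //|jm].
  have [ef0 fe0] := fe j jm.
  split; first by rewrite -ffS mulmxA ef0 mul0mx.
  by rewrite -fSf -mulmxA fe0 mulmx0.
- by rewrite {2}fSE mulmxBr -scalemxAr !mulmxA fSf fSe mul0mx scaler0 subr0.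
- by move=> m1L /=; split=> //; apply: fC; rewrite ltnSn.
move=> m1L /=.
have fe1 : f m *m e m.+1 = e m.+1 *m f m by apply: fC; rewrite ltnSn.
have efe1 : e m.+1 *m f m *m e m.+1 = d m.+1 *: (f m *m e m.+1).
  by rewrite -fe1 -mulmxA eM // scalemxAr.
(* As e_{m+1} commutes with f_m, the braid relation collapses the correction term. Together with
   [efe1] this leaves the coefficient d_{m+1} - 1/a_m, the origin of the recursion for [a]. *)
have eSe : e m.+1 *m (f m *m e m *m f m) *m e m.+1 = f m *m e m.+1.
  rewrite !mulmxA -fe1 -(mulmxA _ (f m) (e m.+1)) [X in _ *m X = _]fe1.
  by rewrite mulmxA -2!(mulmxA (f m)) ebl // -mulmxA -fe1 mulmxA ff.
by rewrite -/c mulmxBr mulmxBl -scalemxAr -scalemxAl efe1 eSe aS scalerBl.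
Qed.

Lemma mul_jones_wenzl m j : (m <= L)%N -> (j < m)%N ->
  e j *m f m = 0.
Proof. by move=> mL jm; have [_ /(_ j jm)[]] := jones_wenzl_invariant mL. Qed.

Lemma jones_wenzl_fixed (x : 'rV[F]_N) m :
  (forall j, (j < m)%N -> x *m e j = 0) -> x *m f m = x.
Proof.
elim: m => [_|m IH h]; first by rewrite /= mulmx1.
have xf : x *m f m = x by apply: IH => j jm; apply/h/ltnW.
by rewrite /= mulmxBr -scalemxAr !mulmxA xf h // mul0mx scaler0 subr0.
Qed.

End JonesWenzl.

(** * Linear independence of the noncrossing partitions *)

Section LinearIndependence.
Variables (F : realFieldType) (X : finType).
Hypothesis card_X : (4 <= #|X|)%N.

Section FixedSize.
Variable k : nat.
Local Notation N := #|NC k|.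
Local Notation part a := (enum_val a : {set {set 'I_k}}).
Implicit Types (p : {set {set 'I_k}}) (x : 'rV[F]_N) (a b : 'I_N).

Lemma part_NC a : part a \in NC k. Proof. exact: enum_valP. Qed.

Definition relation x := forall w : nat -> X,
  \sum_a x 0 a * (compatible (part a) w)%:R = 0.

(** The filtration for the induction: partitions whose points from m on are singletons amount to
    partitions of the first m points. *)
Definition supported m x := forall a, x 0 a != 0 ->
  forall i : 'I_k, (m <= i)%N -> singleton (part a) i.

(** Partitions are basis row vectors and matrices act on the right, so products compose from left to
    right. A row whose image leaves the noncrossing partitions would be zero, hence the conditions
    [preserves_NC]. *)
Definition opmx (g : {set {set 'I_k}} -> {set {set 'I_k}})
    (c : {set {set 'I_k}} -> F) : 'M[F]_N :=
  \matrix_(a, b) (c (part a) * (part b == g (part a))%:R).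

Definition preserves_NC (g : {set {set 'I_k}} -> {set {set 'I_k}}) :=
  forall p, p \in NC k -> g p \in NC k.

Lemma opmx_sum g c a (G : {set {set 'I_k}} -> F) : preserves_NC g ->
  \sum_b opmx g c a b * G (part b) = c (part a) * G (g (part a)).
Proof.
move=> gN; have gaN : g (part a) \in NC k by apply/gN/part_NC.
rewrite (bigD1 (enum_rank_in gaN (g (part a)))) //= big1 => [|b bE].
  by rewrite mxE enum_rankK_in // eqxx mulr1 addr0.
rewrite mxE (_ : _ == _ = false) ?mulr0 ?mul0r //.
apply: contraNF bE => /eqP E; apply/eqP/enum_val_inj.
by rewrite enum_rankK_in.
Qed.

Lemma mul_opmx g c g' c' : preserves_NC g ->
  opmx g c *m opmx g' c' = opmx (g' \o g) (fun p => c p * c' (g p)).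
Proof.
move=> gN; apply/matrixP => a b; rewrite !mxE.
have := opmx_sum c a (fun p => c' p * (part b == g' p)%:R) gN.
rewrite /= mulrA => <-; apply: eq_bigr => l _.
by rewrite [opmx g' c' l b]mxE.
Qed.

Lemma eq_opmx g c g' c' : (forall p, p \in NC k -> g p = g' p) ->
  (forall p, p \in NC k -> c p = c' p) -> opmx g c = opmx g' c'.
Proof.
by move=> gg cc; apply/matrixP => a b; rewrite !mxE gg ?cc ?part_NC.
Qed.

Lemma scale_opmx g c t : t *: opmx g c = opmx g (fun p => t * c p).
Proof. by apply/matrixP => a b; rewrite !mxE mulrA. Qed.

Lemma supported_opmx m m' g c x : supported m x ->
  (forall p, p \in NC k -> (forall i : 'I_k, (m <= i)%N -> singleton p i) ->
     forall i : 'I_k, (m' <= i)%N -> singleton (g p) i) ->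
  supported m' (x *m opmx g c).
Proof.
move=> xm gm b; rewrite mxE => nz i mi.
have [a /andP[xa /eqP ->]|h] := pickP (fun a => (x 0 a != 0) && (part b == g (part a))).
  by apply: gm => //; [exact: part_NC|exact: xm].
case/eqP: nz; apply: big1 => a _; have := h a; rewrite mxE.
by case: eqP => [->|_] /=; [rewrite mul0r|move=> ->; rewrite mulr0 mulr0].
Qed.

Lemma relation_opmx g c x : preserves_NC g ->
  (forall w : nat -> X, \sum_a x 0 a *
     (c (part a) * (compatible (g (part a)) w)%:R) = 0) ->
  relation (x *m opmx g c).
Proof.
move=> gN h w; rewrite -[RHS](h w); under eq_bigr do rewrite mxE mulr_suml.
rewrite exchange_big; apply: eq_bigr => a _ /=.
rewrite -(opmx_sum c a (fun p => (compatible p w)%:R) gN) mulr_sumr.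
by apply: eq_bigr => b _; rewrite mulrA.
Qed.

Lemma supported0 x : relation x -> supported 0 x -> x = 0.
Proof.
move=> xr xs; apply/rowP => a; rewrite mxE; apply/eqP/negPn/negP => xa.
have only b : x 0 b != 0 -> b = a.
  move=> xb; apply: enum_val_inj; apply: same_inj => [||i j].
  - exact/NC_partition/part_NC.
  - exact/NC_partition/part_NC.
  - have sE c : x 0 c != 0 -> same (part c) i j = (i == j).
      move=> xc; apply/idP/eqP => [|->]; last exact: same_refl.
      by move=> ij; apply/esym/(singletonP _ _ (xs c xc i isT)).
    by rewrite !sE.
have /card_gt0P[x0 _] : (0 < #|X|)%N by apply: leq_trans card_X.
have := xr (fun=> x0); rewrite (bigD1 a) //= big1 ?addr0 => [|b ba].
  have -> : compatible (part a) (fun=> x0) by apply/compatibleP.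
  by rewrite mulr1; apply/eqP.
have [->|/only ba'] := eqVneq (x 0 b) 0; first by rewrite mul0r.
by rewrite ba' eqxx in ba.
Qed.

End FixedSize.

Section Generators.
Variable k' : nat.
Local Notation k := k'.+1.
Local Notation N := #|NC k|.
Local Notation part a := (enum_val a : {set {set 'I_k}}).
Implicit Types (p : {set {set 'I_k}}) (x : 'rV[F]_N) (a b : 'I_N).
Local Notation pt r := (inord r : 'I_k).

Definition isolate_coef p (r : 'I_k) : F :=
  if singleton p r then #|X|%:R else 1.

Definition isolate_mx r := opmx (fun p => isolate p (pt r))
  (fun p => isolate_coef p (pt r)).

Definition join_mx r : 'M[F]_N := opmx (fun p => join p (pt r) (pt r.+1)) (fun=> 1).

(** Fattening each point into two strands turns noncrossing partitions of k points into
    Temperley-Lieb diagrams on 2k strands. The 2k - 1 generators alternately cut a point off and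
    connect two neighbours. *)
Definition gen j := if odd j then join_mx j./2 else isolate_mx j./2.

Let ptE r : (r < k)%N -> pt r = r :> nat. Proof. exact: inordK. Qed.

Let pt_inj r s : (r < k)%N -> (s < k)%N -> r != s -> pt r != pt s.
Proof. by move=> rk sk; rewrite -val_eqE /= !ptE. Qed.

Let isoN r : preserves_NC (fun p => isolate p (pt r)).
Proof. by move=> p; exact: isolate_NC. Qed.

Let joinN r : (r.+1 < k)%N -> preserves_NC (fun p => join p (pt r) (pt r.+1)).
Proof. by move=> rk p; apply: join_NC; rewrite !ptE // ltnW. Qed.

Definition loop j : F := if odd j then 1 else #|X|%:R.

Lemma isolate_mxM r : isolate_mx r *m isolate_mx r = #|X|%:R *: isolate_mx r.
Proof.
rewrite mul_opmx // scale_opmx; apply: eq_opmx => p _ /=.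
  by rewrite isolate_isolate.
by rewrite /isolate_coef singleton_isolate mulrC.
Qed.

Lemma join_mxM r : (r.+1 < k)%N -> join_mx r *m join_mx r = join_mx r.
Proof.
move=> rk; rewrite mul_opmx; last exact: joinN.
by apply: eq_opmx => p _ /=; rewrite ?join_join ?mulr1.
Qed.

Lemma isolate_join_isolate_mx r : (r.+1 < k)%N ->
  isolate_mx r *m join_mx r *m isolate_mx r = isolate_mx r.
Proof.
move=> rk; rewrite mul_opmx // mul_opmx => [|p pN]; last exact/joinN/isoN.
have n : pt r.+1 != pt r by apply: pt_inj; lia.
apply: eq_opmx => p _ /=; first by rewrite isolate_join_isolate.
by rewrite /isolate_coef [X in _ * (if X then _ else _)]singleton_join // !mulr1.
Qed.

Lemma isolateS_join_isolateS_mx r : (r.+1 < k)%N ->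
  isolate_mx r.+1 *m join_mx r *m isolate_mx r.+1 = isolate_mx r.+1.
Proof.
move=> rk; rewrite mul_opmx // mul_opmx => [|p pN]; last exact/joinN/isoN.
have n : pt r != pt r.+1 by apply: pt_inj; lia.
apply: eq_opmx => p _ /=; rewrite join_sym; first by rewrite isolate_join_isolate.
by rewrite /isolate_coef [X in _ * (if X then _ else _)]singleton_join // !mulr1.
Qed.

Lemma join_isolate_join_mx r : (r.+1 < k)%N ->
  join_mx r *m isolate_mx r *m join_mx r = join_mx r.
Proof.
move=> rk; rewrite mul_opmx; last exact: joinN.
rewrite mul_opmx => [|p pN]; last exact/isoN/joinN.
have n : pt r.+1 != pt r by apply: pt_inj; lia.
apply: eq_opmx => p _ /=; first by rewrite join_isolate_join.
by rewrite /isolate_coef singleton_join // !mulr1.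
Qed.

Lemma join_isolateS_join_mx r : (r.+1 < k)%N ->
  join_mx r *m isolate_mx r.+1 *m join_mx r = join_mx r.
Proof.
move=> rk; rewrite mul_opmx; last exact: joinN.
rewrite mul_opmx => [|p pN]; last exact/isoN/joinN.
have n : pt r != pt r.+1 by apply: pt_inj; lia.
apply: eq_opmx => p _ /=.
  by rewrite (join_sym p) (join_sym (isolate _ _)) join_isolate_join.
by rewrite /isolate_coef join_sym singleton_join // !mulr1.
Qed.

Lemma isolate_mxC r s : isolate_mx r *m isolate_mx s = isolate_mx s *m isolate_mx r.
Proof.
have [rs|rs] := eqVneq (pt r) (pt s); first by rewrite /isolate_mx rs.
rewrite !mul_opmx; [|exact: isoN|exact: isoN].
apply: eq_opmx => p _ /=; first exact: isolateC.
rewrite /isolate_coef.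
have [sp|nsp] := boolP (same p (pt r) (pt s)).
  have n1 : singleton p (pt r) = false.
    by apply/negP => /singletonP/(_ _ sp) E; rewrite E eqxx in rs.
  have n2 : singleton p (pt s) = false.
    apply/negP => /singletonP/(_ (pt r)); rewrite same_sym => /(_ sp) E.
    by rewrite E eqxx in rs.
  by rewrite n1 n2 (singleton_isolateC sp).
rewrite singleton_isolateN // singleton_isolateN 1?eq_sym // 1?same_sym //.
exact: mulrC.
Qed.

Lemma join_mxC r s : (r.+1 < k)%N -> (s.+1 < k)%N ->
  join_mx r *m join_mx s = join_mx s *m join_mx r.
Proof.
move=> rk sk; rewrite !mul_opmx; [|exact: joinN|exact: joinN].
by apply: eq_opmx => p _ /=; [exact: join_comm|].
Qed.

Lemma join_isolate_mxC r s : (r.+1 < k)%N -> (s < k)%N -> s != r -> s != r.+1 ->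
  join_mx r *m isolate_mx s = isolate_mx s *m join_mx r.
Proof.
move=> rk sk sr sr1; rewrite !mul_opmx //; last exact: joinN.
have n1 : pt s != pt r by apply: pt_inj => //; lia.
have n2 : pt s != pt r.+1 by apply: pt_inj.
apply: eq_opmx => p _ /=; first by rewrite isolate_join.
by rewrite /isolate_coef singleton_joinN // mulr1 mul1r.
Qed.

Lemma gen_even r : gen r.*2 = isolate_mx r.
Proof. by rewrite /gen odd_double doubleK. Qed.

Lemma gen_odd r : gen r.*2.+1 = join_mx r.
Proof. by rewrite /gen /= odd_double /= uphalf_double. Qed.

Local Notation L := k'.*2.+1.

Let parity j : (exists r, j = r.*2) \/ (exists r, j = r.*2.+1).
Proof.
rewrite -[j]odd_double_half; case: (odd j); [right|left]; exists j./2 => //.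
Qed.

Lemma gen_idem j : (j < L)%N -> gen j *m gen j = loop j *: gen j.
Proof.
rewrite /loop; case: (parity j) => [[r ->]|[r ->]] jL.
  by rewrite gen_even odd_double isolate_mxM.
by rewrite gen_odd /= odd_double /= join_mxM ?scale1r //; lia.
Qed.

Lemma gen_braid j : (j.+1 < L)%N -> gen j *m gen j.+1 *m gen j = gen j.
Proof.
case: (parity j) => [[r ->]|[r ->]] jL.
  by rewrite gen_even gen_odd isolate_join_isolate_mx //; lia.
by rewrite -doubleS gen_even gen_odd join_isolateS_join_mx //; lia.
Qed.

Lemma gen_braidS j : (j.+1 < L)%N -> gen j.+1 *m gen j *m gen j.+1 = gen j.+1.
Proof.
case: (parity j) => [[r ->]|[r ->]] jL.
  by rewrite gen_even gen_odd join_isolate_join_mx //; lia.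
by rewrite -doubleS gen_even gen_odd isolateS_join_isolateS_mx //; lia.
Qed.

Lemma genC i j : (i.+1 < j < L)%N -> gen i *m gen j = gen j *m gen i.
Proof.
case: (parity i) => [[r ->]|[r ->]]; case: (parity j) => [[s ->]|[s ->]] ij;
  rewrite ?gen_even ?gen_odd.
- exact: isolate_mxC.
- by rewrite join_isolate_mxC //; lia.
- by rewrite join_isolate_mxC //; lia.
- by rewrite join_mxC //; lia.
Qed.

Fixpoint jw_coef j : F :=
  if j is j'.+1 then loop j - (jw_coef j')^-1 else loop 0.

(** The two bounds feed each other exactly because n >= 4: 1 - 2/n >= 1/2 at odd indices and n - 2
    >= n/2 at even ones. *)
Lemma jw_coef_ge j : (if odd j then 1 / 2 else #|X|%:R / 2) <= jw_coef j.
Proof.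
have n4 : 4 <= #|X|%:R :> F by rewrite ler_nat.
elim: j => [|j IH] /=; first by rewrite /loop /=; lra.
rewrite /loop /=; case: (odd j) IH => /= h.
  have : (jw_coef j)^-1 <= 2.
    by rewrite -[leRHS]invrK lef_pV2 ?posrE //; lra.
  by lra.
have : (jw_coef j)^-1 <= 1 / 2.
  have -> : 1 / 2 = 2^-1 :> F by rewrite mul1r.
  by rewrite lef_pV2 ?posrE //; lra.
by lra.
Qed.

Lemma jw_coef_neq0 j : jw_coef j != 0.
Proof.
have n4 : 4 <= #|X|%:R :> F by rewrite ler_nat.
by apply: lt0r_neq0; have := jw_coef_ge j; case: odd; lra.
Qed.

Lemma relation_gen j x : (j < L)%N -> relation x -> relation (x *m gen j).
Proof.
move=> jL xr; move: jL; case: (parity j) => [[r ->]|[r ->]] jL.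
  rewrite gen_even; apply: relation_opmx => // w.
  under eq_bigr => a _.
    rewrite (_ : isolate_coef _ _ * _ =
      \sum_(y : X) (compatible (part a) (update w (pt r) y))%:R :> F); last first.
      rewrite -natr_sum compatible_isolate natrM /isolate_coef.
      by case: singleton.
    rewrite mulr_sumr; over.
  by rewrite exchange_big big1 // => y _; exact: xr.
rewrite gen_odd; apply: relation_opmx => [|w]; first by apply: joinN; lia.
under eq_bigr => a _ do rewrite mul1r compatible_join -mulnb natrM mulrA.
by rewrite -mulr_suml xr mul0r.
Qed.

Lemma singleton_isolateW p (r i : 'I_k) : singleton p i -> singleton (isolate p r) i.
Proof.
move=> /singletonP h; apply/singletonP => j; rewrite same_isolateE.
by case/orP=> [/eqP ->//|/and3P[_ _ /h]].
Qed.

Lemma supported_gen m j x : (j <= m.*2)%N -> (m < k)%N -> supported m.+1 x ->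
  supported m.+1 (x *m gen j).
Proof.
move=> jm mk xm; move: jm; case: (parity j) => [[r ->]|[r ->]] jm.
  rewrite gen_even; apply: supported_opmx xm _ => p _ ps i mi.
  exact/singleton_isolateW/ps.
rewrite gen_odd; apply: supported_opmx xm _ => p _ ps i mi.
have ptn (s : nat) : (s <= m)%N -> i != pt s.
  by move=> sm; rewrite -val_eqE /= ptE; lia.
by rewrite singleton_joinN ?ps ?ptn //; lia.
Qed.

(** The generator of index 2m isolates the last point that may lie in a larger block, and so lowers
    the filtration. *)
Lemma supported_gen_top m x : (m < k)%N -> supported m.+1 x ->
  supported m (x *m gen m.*2).
Proof.
move=> mk xm; rewrite gen_even; apply: supported_opmx xm _ => p _ ps i mi.
have [->|im] := eqVneq i (pt m); first exact: singleton_isolate.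
apply/singleton_isolateW/ps; rewrite ltn_neqAle mi andbT.
by move: im; rewrite -val_eqE /= ptE // eq_sym.
Qed.

Lemma join_same p (r s : 'I_k) : p \in NC k -> same p r s -> join p r s = p.
Proof.
move=> pN rs; apply: same_inj => [||i j].
- exact: join_partition.
- exact: NC_partition.
- rewrite same_joinE -!(same_sym p _ i) -!(same_sym p _ j) -!(same_l _ rs).
  apply/orP/idP => [[//|/andP[]]|->]; last by left.
  by rewrite !orbb same_sym => ir jr; rewrite (same_l _ ir).
Qed.

(* By induction [x] is killed by the generators of index at most [2m], so the
   Jones-Wenzl projection fixes [x]. But that projection kills every noncrossing
   partition, since each one is, up to a nonzero scalar, fixed by a generator. *)
Lemma relation_eq0 m x : (m <= k)%N -> relation x -> supported m x -> x = 0.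
Proof.
elim: m x => [|m IH] x mk xr xm; first exact: supported0 xr xm.
(* Descending induction on the index of the generator. The top one lands in the smaller filtration
   step; below it, e_j = e_j e_{j+1} e_j, and y e_j is again a relation, already killed by
   e_{j+1}. *)
have vanish t y : (t <= m.*2)%N -> relation y -> supported m.+1 y ->
    y *m gen (m.*2 - t)%N = 0.
  elim: t y => [|t IHt] y tm yr ys.
    rewrite subn0; apply: IH; first exact: ltnW.
      by apply: relation_gen => //; lia.
    exact: supported_gen_top.
  set j := (m.*2 - t.+1)%N; have jE : (m.*2 - t = j.+1)%N by rewrite /j; lia.
  have jL : (j.+1 < L)%N by rewrite -jE; lia.
  rewrite -gen_braid // !mulmxA -jE IHt ?mul0mx //; first by lia.
    by apply: relation_gen => //; lia.
  by apply: supported_gen => //; lia.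
pose f := jones_wenzl gen jw_coef m.*2.+1.
have xf : x *m f = x.
  apply: jones_wenzl_fixed => j jm.
  have -> : j = (m.*2 - (m.*2 - j))%N by lia.
  by apply: vanish => //; lia.
have gf j : (j < m.*2.+1)%N -> gen j *m f = 0.
  move=> jm; apply: (@mul_jones_wenzl _ _ _ gen loop jw_coef gen_idem gen_braidS genC (erefl _)
    (fun=> erefl _) jw_coef_neq0) => //; lia.
rewrite -xf [x]row_sum_delta mulmx_suml; apply: big1 => a _; rewrite -scalemxAl.
have [->|xa] := eqVneq (x 0 a) 0; first by rewrite scale0r.
suff [c [j [c0 jm cj]]] : exists c j, [/\ c != 0, (j < m.*2.+1)%N &
    delta_mx 0 a *m gen j = c *: (delta_mx 0 a : 'rV[F]_N)].
  have : c *: (delta_mx 0 a *m f : 'rV_N) = 0.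
    by rewrite scalemxAl -cj -mulmxA gf // mulmx0.
  by move/eqP; rewrite scaler_eq0 (negPf c0) /= => /eqP ->; rewrite scaler0.
have fixed g c : g (part a) = part a -> delta_mx 0 a *m opmx g c =
    c (part a) *: (delta_mx 0 a : 'rV[F]_N).
  move=> ga; rewrite -rowE; apply/rowP => b; rewrite !mxE ga eqxx /=.
  by rewrite (inj_eq enum_val_inj).
have [||[r rm sr]|[r [s [sE sm rs]]]] := @NC_adjacent _ (part a) m.+1 (part_NC a).
- by rewrite mk.
- exact: xm.
- have rE : r = pt r by apply: val_inj; rewrite /= ptE.
  exists #|X|%:R, r.*2; split; [|by lia|].
    by rewrite pnatr_eq0; lia.
  rewrite gen_even fixed -?rE; first by rewrite /isolate_coef sr.
  exact: isolate_singleton (NC_partition (part_NC a)) sr.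
- have rE : r = pt r by apply: val_inj; rewrite /= ptE.
  have sE' : s = pt r.+1 by apply: val_inj; rewrite /= ptE // -sE.
  exists 1, r.*2.+1; split; [exact: oner_neq0|by lia|].
  rewrite gen_odd fixed // -rE -sE'; exact: join_same (part_NC a) rs.
Qed.

End Generators.

Lemma compatible_free k (x : 'rV[F]_#|NC k|) :
  (forall w : nat -> X,
     \sum_a x 0 a * (compatible (enum_val a) w)%:R = 0) -> x = 0.
Proof.
case: k x => [|k] x xr; first by apply: supported0 xr _ => a _ [].
apply: relation_eq0 (leqnn _) xr _ => a _ i ki.
by have := ltn_ord i; lia.
Qed.

End LinearIndependence.

(** * Gram matrix and planar functions *)

Section WordSums.
Variables (X : finType) (x0 : X) (V : nmodType).
Implicit Types (F : (nat -> X) -> V) (w : nat -> X).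

(** A finite word is extended by the letter [x0], the default value of [nth]. *)
Definition wsum k F := \sum_(t : k.-tuple X) F (nth x0 t).

Definition insw r x w : nat -> X :=
  fun i => if (i < r)%N then w i else if i == r then x else w i.-1.

Definition catw i w w' : nat -> X :=
  fun m => if (m < i)%N then w m else w' (m - i)%N.

Definition revw k w : nat -> X :=
  fun m => if (m < k)%N then w (k - m.+1)%N else x0.

Lemma eq_wsum k F G : F =1 G -> wsum k F = wsum k G.
Proof. by move=> FG; apply: eq_bigr => t _; exact: FG. Qed.

Lemma wsum_sum k (I : finType) (H : I -> (nat -> X) -> V) :
  wsum k (fun w => \sum_i H i w) = \sum_i wsum k (H i).
Proof. exact: exchange_big. Qed.

Lemma wsum0 F : wsum 0 F = F (fun=> x0).
Proof.
rewrite /wsum (big_pred1 [tuple]) => [|t]; last exact/esym/eqP/tuple0.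
by congr F; apply/funext => i; rewrite nth_nil.
Qed.

Lemma wsumS k F : wsum k.+1 F = \sum_x wsum k (fun w => F (insw 0 x w)).
Proof.
rewrite /wsum pair_big /=.
rewrite (reindex (fun p : X * k.-tuple X => [tuple of p.1 :: p.2])) /=; last first.
  exists (fun t => (thead t, [tuple of behead t])) => [[x t] _|t _].
    by congr pair; apply: val_inj.
  by rewrite -tuple_eta.
apply: eq_bigr => -[x t] _; congr F; apply/funext => -[|i] //.
Qed.

Lemma wsum_ins k r F : (r <= k)%N ->
  wsum k.+1 F = \sum_x wsum k (fun w => F (insw r x w)).
Proof.
elim: r k F => [|r IH] k F rk; first exact: wsumS.
case: k rk => // k rk; rewrite wsumS.
under eq_bigr => y _ do rewrite (IH k) //.
rewrite exchange_big; apply: eq_bigr => x _ /=; rewrite wsumS.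
apply: eq_bigr => y _; apply: eq_wsum => w; congr F; apply/funext => -[|i] //.
by rewrite /insw /= ltnS eqSS; case: ltngtP => // h; case: i h.
Qed.

Lemma wsum_cat i k F :
  wsum (i + k) F = wsum i (fun w => wsum k (fun w' => F (catw i w w'))).
Proof.
elim: i F => [|i IH] F.
  rewrite wsum0; apply: eq_wsum => w; congr F; apply/funext => m.
  by rewrite /catw subn0.
rewrite addSn wsumS [RHS]wsumS; apply: eq_bigr => x _; rewrite IH.
apply: eq_wsum => w; apply: eq_wsum => w'; congr F; apply/funext => -[|m] //.
Qed.

Lemma wsum_rev k F : wsum k (fun w => F (revw k w)) = wsum k F.
Proof.
have rK : involutive (fun t : k.-tuple X => [tuple of rev t]).
  by move=> t; apply: val_inj; rewrite /= revK.
rewrite /wsum [RHS](reindex_inj (inv_inj rK)) /=.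
apply: eq_bigr => t _; congr F; apply/funext => m; rewrite /revw.
case: ltnP => mk; first by rewrite nth_rev ?size_tuple.
by rewrite nth_default // size_rev size_tuple.
Qed.

End WordSums.

Section WordSumsRing.
Variables (X : finType) (x0 : X) (C : pzRingType).

Lemma wsumZ k (c : C) (F : (nat -> X) -> C) :
  wsum x0 k (fun w => c * F w) = c * wsum x0 k F.
Proof. by rewrite /wsum mulr_sumr. Qed.

Lemma wsumZr k (c : C) (F : (nat -> X) -> C) :
  wsum x0 k (fun w => F w * c) = wsum x0 k F * c.
Proof. by rewrite /wsum mulr_suml. Qed.

End WordSumsRing.

Section Gram.
Variables (X : finType) (x0 : X).

Lemma wsum_compatible k (p q : {set {set 'I_k}}) :
  wsum x0 k (fun w => (compatible p w && compatible q w : nat)) =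
  (#|X| ^ #|pjoin p q|)%N.
Proof.
set J := pjoin p q; have Jp : partition J [set: 'I_k] := pjoin_partition p q.
have inJ i : pblock J i \in J by rewrite pblock_mem // (cover_partition Jp) inE.
have blockP i j : (j \in pblock J i) = connect (same_block p q) i j.
  exact: (pblock_equivalence_partition (@same_block_eqv k p q)).
have compP (t : k.-tuple X) : compatible p (nth x0 t) && compatible q (nth x0 t) <->
    forall i j, connect (same_block p q) i j -> tnth t i = tnth t j.
  split=> [/andP[/compatibleP cp /compatibleP cq] i j /connectP[s]|h].
    elim: s i => [i _ -> //|l s IH i /= /andP[il ls] jE].
    rewrite -(IH l ls jE) !(tnth_nth x0); case/orP: il => il; [exact: cp|exact: cq].
  by apply/andP; split; apply/compatibleP => i j ij; rewrite -!tnth_nth; apply: h;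
    apply: connect1; apply/orP; [left|right].
pose mk (g : {ffun {set 'I_k} -> X}) : k.-tuple X := [tuple g (pblock J i) | i < k].
(* Functions on all subsets are normalised to [x0] off the blocks of the join: this makes [mk]
   injective on [D] and leaves #|X| choices per block. *)
pose D := pffun_on x0 (mem J) (predT : {pred X}).
transitivity #|[set t : k.-tuple X |
    compatible p (nth x0 t) && compatible q (nth x0 t)]|.
  rewrite -sum1_card big_mkcond; apply: eq_bigr => t _; rewrite inE.
  by case: (_ && _).
rewrite -(card_pffun_on x0 (mem J) (predT : {pred X})) -(card_in_imset (f := mk) (D := D)).
  apply: eq_card => t; rewrite [in LHS]inE; apply/idP/imsetP => [/compP h|[g _ ->]].
    pose g := [ffun B : {set 'I_k} => if B \in J then
      if [pick i in B] is Some i then tnth t i else x0 else x0].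
    exists g; last first.
      apply: eq_from_tnth => i; rewrite tnth_mktuple ffunE inJ.
      case: pickP => [j|/(_ i)]; last by rewrite blockP connect0.
      by rewrite blockP => /h.
    apply/pffun_onP; split=> [|x _]; last by [].
    apply/subsetP => B; rewrite inE ffunE /=.
    by case: (B \in J) => //; rewrite eqxx.
  apply/compP => i j ij; rewrite !tnth_mktuple; congr (g _).
  apply/eqP; rewrite eq_pblock ?blockP ?(partition_trivIset Jp) //.
  by rewrite (cover_partition Jp) inE.
move=> g g' /pffun_onP[gJ _] /pffun_onP[g'J _] E; apply/ffunP => B.
have [BJ|BJ] := boolP (B \in J).
  have /set0Pn[i iB] : B != set0.
    by apply: contraTneq BJ => ->; case/and3P: Jp.
  have := congr1 (fun t => tnth t i) E; rewrite !tnth_mktuple.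
  by rewrite (def_pblock (partition_trivIset Jp) BJ iB).
have out (g1 : {ffun {set 'I_k} -> X}) : x0.-support g1 \subset J -> g1 B = x0.
  by move=> /subsetP/(_ B) h; apply/eqP; apply: contraNT BJ => /h.
by rewrite !out.
Qed.

Lemma gramE (F : nzRingType) k a b :
  gram F k #|X| a b = wsum x0 k (fun w =>
    (compatible (enum_val a) w)%:R * (compatible (enum_val b) w)%:R).
Proof.
rewrite mxE -wsum_compatible /wsum natr_sum; apply: eq_bigr => t _.
by rewrite -natrM mulnb.
Qed.

Lemma gram_sym (F : nzRingType) k : (gram F k #|X|)^T = gram F k #|X|.
Proof.
apply/matrixP => a b; rewrite mxE !gramE; apply: eq_wsum => w.
by rewrite -!natrM mulnC.
Qed.

(** If v G = 0, then v G v^T = 0 is the sum over words of the squares of the function with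
    coefficients v. In an ordered field this function vanishes, and independence gives v = 0. *)
Lemma gram_real_unit (F : realFieldType) k : (4 <= #|X|)%N ->
  gram F k #|X| \in unitmx.
Proof.
move=> X4; rewrite -row_free_unit; apply/inj_row_free => v vG.
pose f (w : nat -> X) := \sum_a v 0 a * (compatible (enum_val a) w)%:R.
have sq : wsum x0 k (fun w => f w ^+ 2) = 0.
  transitivity ((v *m gram F k #|X| *m v^T) 0 0); last by rewrite vG mul0mx mxE.
  rewrite -mulmxA mxE /f; under eq_wsum => w do rewrite expr2 mulr_suml.
  rewrite wsum_sum; apply: eq_bigr => a _.
  rewrite mxE mulr_sumr; under eq_wsum => w do rewrite mulr_sumr.
  rewrite wsum_sum; apply: eq_bigr => b _; rewrite [v^T b 0]mxE gramE -wsumZr -wsumZ.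
  by apply: eq_wsum => w; ring.
apply: (compatible_free X4) => w.
have fE : f w = f (nth x0 (mkseq w k)).
  apply: eq_bigr => a _; congr (_ * (nat_of_bool _)%:R).
  by apply: eq_compatible => i ik; rewrite nth_mkseq.
have nn (t : k.-tuple X) : true -> 0 <= f (nth x0 t) ^+ 2 by rewrite sqr_ge0.
have sz : size (mkseq w k) == k by rewrite size_mkseq.
have /eqP := psumr_eq0P nn sq (i := Tuple sz) isT.
by rewrite sqrf_eq0 -fE => /eqP.
Qed.

(** Descent to the rationals serves twice: invertibility is inherited from an ordered field, and the
    inverse has rational entries, so that the projection kernel is real. *)
Lemma gram_ratr (C : numFieldType) k m : gram C k m = map_mx ratr (gram rat k m).
Proof. by apply/matrixP => a b; rewrite !mxE ratr_nat. Qed.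

Lemma gram_unit (C : numFieldType) k : (4 <= #|X|)%N ->
  gram C k #|X| \in unitmx.
Proof. by move=> X4; rewrite gram_ratr map_unitmx gram_real_unit. Qed.

End Gram.

(** * The kernel of the projection onto the span of the noncrossing partitions *)

Section FixedKernel.
Variables (C : numClosedFieldType) (X : finType) (x0 : X).
Hypothesis card_X : (4 <= #|X|)%N.
Implicit Types (I J w : nat -> X).

Local Notation xi a w := ((compatible (enum_val a) w)%:R : C).
Local Notation wsum := (wsum x0).

(* The matrix of the orthogonal projection of the functions on words of length
   [k] onto the span of the noncrossing partitions. *)
Definition fixed_proj k I J : C :=
  \sum_a \sum_b invmx (gram C k #|X|) a b * (xi a I * xi b J).

Definition nc_span k (f : (nat -> X) -> C) :=
  exists c : 'I_#|NC k| -> C, forall w, f w = \sum_a c a * xi a w.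

Lemma fixed_proj_sym k I J : fixed_proj k I J = fixed_proj k J I.
Proof.
rewrite /fixed_proj exchange_big; apply: eq_bigr => a _; apply: eq_bigr => b _.
congr (_ * _); last exact: mulrC.
by rewrite -[in LHS](gram_sym x0) -trmx_inv mxE.
Qed.

Lemma conj_fixed_proj k I J : Num.conj (fixed_proj k I J) = fixed_proj k I J.
Proof.
rewrite /fixed_proj rmorph_sum; apply: eq_bigr => a _.
rewrite rmorph_sum; apply: eq_bigr => b _; rewrite !rmorphM /= !rmorph_nat.
by congr (_ * _); rewrite gram_ratr -map_invmx mxE fmorph_rat.
Qed.

Lemma fixed_proj_span k J : nc_span k (fun I => fixed_proj k I J).
Proof.
exists (fun a => \sum_b invmx (gram C k #|X|) a b * xi b J) => w.
apply: eq_bigr => a _; rewrite mulr_suml; apply: eq_bigr => b _.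
by rewrite -mulrA [xi b J * _]mulrC.
Qed.

Lemma fixed_proj_reproduce k f I : nc_span k f ->
  wsum k (fun J => fixed_proj k I J * f J) = f I.
Proof.
move=> [c fE]; rewrite fE.
transitivity (\sum_a \sum_b \sum_d
    (invmx (gram C k #|X|) a b * xi a I) * (gram C k #|X| b d * c d)).
  rewrite /fixed_proj; under eq_wsum => J do rewrite mulr_suml.
  rewrite wsum_sum; apply: eq_bigr => a _.
  under eq_wsum => J do rewrite mulr_suml.
  rewrite wsum_sum; apply: eq_bigr => b _.
  under eq_wsum => J do rewrite fE mulr_sumr.
  rewrite wsum_sum; apply: eq_bigr => d _.
  rewrite (gramE x0) -wsumZr -wsumZ; apply: eq_wsum => J; ring.
apply: eq_bigr => a _; rewrite exchange_big /=.
transitivity (\sum_d (invmx (gram C k #|X|) *m gram C k #|X|) a d *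
    (xi a I * c d)).
  apply: eq_bigr => d _; rewrite mxE mulr_suml; apply: eq_bigr => b _.
  by ring.
rewrite mulVmx ?gram_unit // (bigD1 a) //= big1 ?addr0 => [|d da].
  by rewrite mxE eqxx mul1r mulrC.
by rewrite mxE eq_sym (negPf da) mul0r.
Qed.

End FixedKernel.

(** Composing a word with this index map doubles its letter at r, since r and r+1 are both sent to
    r. *)
Definition unbump_at r i := if (i <= r)%N then i else i.-1.

Section Planar.
Variables (C : numClosedFieldType) (X : finType) (x0 : X).
Implicit Types (f g : (nat -> X) -> C) (w : nat -> X).

(* [planar_ins] adds a singleton block at [r], [planar_dup] adds a point to the
   block of its left neighbour; every noncrossing partition arises this way. *)
Inductive planar : nat -> ((nat -> X) -> C) -> Prop :=
| planar1 : planar 0 (fun=> 1)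
| planar0 k : planar k (fun=> 0)
| planarD k c f g : planar k f -> planar k g ->
    planar k (fun w => c * f w + g w)
| planar_ins k r f : (r <= k)%N -> planar k f ->
    planar k.+1 (fun w => f (w \o bump r))
| planar_dup k r f : (r < k)%N -> planar k f ->
    planar k.+1 (fun w => (w r == w r.+1)%:R * f (w \o bump r.+1)).

Lemma planar_ext k f g : planar k f -> f =1 g -> planar k g.
Proof. by move=> kf /funext <-. Qed.

Lemma planarZ k c f : planar k f -> planar k (fun w => c * f w).
Proof.
move=> kf; apply: planar_ext (planarD c kf (planar0 k)) _ => w.
by rewrite addr0.
Qed.

Lemma planar_sum k (I : finType) (f : I -> (nat -> X) -> C) :
  (forall i, planar k (f i)) -> planar k (fun w => \sum_i f i w).
Proof.
move=> kf; elim: (index_enum I) => [|i s IH].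
  by apply: planar_ext (planar0 k) _ => w; rewrite big_nil.
apply: planar_ext (planarD 1 (kf i) IH) _ => w.
by rewrite big_cons mul1r.
Qed.

Lemma compatible_planar k (p : {set {set 'I_k}}) : p \in NC k ->
  planar k (fun w => (compatible p w)%:R).
Proof.
elim: k p => [p _|k IH p pN].
  by apply: planar_ext planar1 _ => w; rewrite (_ : compatible _ _) //; apply/compatibleP => -[].
have [q qN [r [[rk pE]|[rk pE]]]] := decompose_NC X pN.
  by apply: planar_ext (planar_ins rk (IH q qN)) _ => w; rewrite pE.
apply: planar_ext (planar_dup rk (IH q qN)) _ => w.
by rewrite pE -natrM mulnb.
Qed.

(** Both descriptions are needed: closure under diagram operations is an induction on [planar],
    while reproduction by the kernel uses coordinates in the span. *)
Lemma planar_nc_span k f : planar k f <-> nc_span k f.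
Proof.
split=> [|[c fE]]; last first.
  apply: (@planar_ext _ (fun w => \sum_a c a * (compatible (enum_val a) w)%:R)).
    by apply: planar_sum => a; apply/planarZ/compatible_planar/enum_valP.
  by move=> w; rewrite fE.
have nc1 l (p : {set {set 'I_l}}) : p \in NC l ->
    exists c : 'I_#|NC l| -> C, forall w, 
      (compatible p w)%:R = \sum_a c a * (compatible (enum_val a) w)%:R.
  move=> pN; exists (fun a => (a == enum_rank_in pN p)%:R) => w.
  rewrite (bigD1 (enum_rank_in pN p)) //= eqxx mul1r big1 ?addr0 => [|a /negPf ->].
    by rewrite enum_rankK_in.
  by rewrite mul0r.
have lin l l' (T : ((nat -> X) -> C) -> (nat -> X) -> C) g :
    (forall c : 'I_#|NC l| -> C, T (fun w => \sum_a c a * (compatible (enum_val a) w)%:R)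
      =1 fun w => \sum_a c a * T (fun w => (compatible (enum_val a) w)%:R) w) ->
    (forall p : {set {set 'I_l}}, p \in NC l -> exists2 p' : {set {set 'I_l'}}, p' \in NC l' &
      forall w, T (fun w => (compatible p w)%:R) w = (compatible p' w)%:R) ->
    nc_span l g -> nc_span l' (T g).
  move=> Tlin Tp [c /funext ->].
  have /boolp.choice[e eE] : forall a : 'I_#|NC l|, exists e : 'I_#|NC l'| -> C,
      forall w, T (fun w => (compatible (enum_val a) w)%:R) w =
        \sum_b e b * (compatible (enum_val b) w)%:R.
    move=> a; have [p' pN' pE] := Tp (enum_val a) (enum_valP a).
    have [e eE] := nc1 _ _ pN'; exists e => w; by rewrite pE eE.
  exists (fun b => \sum_a c a * e a b) => w; rewrite Tlin.
  under eq_bigr => a _ do rewrite eE mulr_sumr.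
  rewrite exchange_big; apply: eq_bigr => b _; rewrite mulr_suml.
  by apply: eq_bigr => a _; rewrite mulrA.
elim=> {k f} [|k|k c f g _ [cf fE] _ [cg gE]|k r f rk _|k r f rk _].
- have pN : classes_of (fun _ _ : 'I_0 => true) \in NC 0.
    by apply: classes_of_NC => [x|x]; case: x.
  have [c cE] := nc1 _ _ pN; exists c => w; rewrite -cE.
  by rewrite (_ : compatible _ _) //; apply/compatibleP => -[].
- by exists (fun=> 0) => w; rewrite big1 // => a _; rewrite mul0r.
- exists (fun a => c * cf a + cg a) => w; rewrite fE gE mulr_sumr -big_split.
  by apply: eq_bigr => a _; rewrite mulrDl mulrA.
- apply: (lin _ _ (fun f w => f (w \o bump r))) => // p pN.
  have [p' pN' pE] := insert_NC X pN rk; exists p' => // w.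
  by rewrite pE.
- apply: (lin _ _ (fun f w => (w r == w r.+1)%:R * f (w \o bump r.+1))).
    by move=> c w; rewrite mulr_sumr; apply: eq_bigr => a _; ring.
  move=> p pN; have [p' pN' pE] := duplicate_NC X pN rk; exists p' => // w.
  by rewrite pE -natrM mulnb.
Qed.

Lemma planar_local k f w w' : planar k f -> (forall i, (i < k)%N -> w i = w' i) ->
  f w = f w'.
Proof.
move=> /planar_nc_span[c fE] ww; rewrite !fE; apply: eq_bigr => a _.
by rewrite (eq_compatible _ ww).
Qed.

Ltac word_cases := rewrite /= /unbump_at /bump /insw /=;
  repeat (case: ifP => ?); try lia; try by []; try (congr (_ _); lia).

(** The outermost generator of f either touches the merged points and is absorbed, or lies elsewhere
    and moves past the merge with a shifted position. *)
Lemma planar_merge k r f : planar k.+1 f -> (r < k)%N ->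
  planar k (fun w => f (w \o unbump_at r)).
Proof.
move=> kf; move: {1 2}k.+1 kf (erefl k.+1) => l kf; elim: kf k r => {l f}.
- by [].
- by move=> l k r _ _; exact: planar0.
- move=> l c f g _ IHf _ IHg k r lk rk.
  exact: planarD (IHf k r lk rk) (IHg k r lk rk).
- move=> l s f sl lf IH k r [lk] rk; subst l.
  have [sr|sr] := boolP ((s == r) || (s == r.+1)).
    apply: planar_ext lf _ => w; congr f; apply/funext => i.
    by case/orP: sr => /eqP ->; word_cases.
  case: k sl lf IH rk => // k sl lf IH rk.
  have [sr'|sr'] := ltnP s r.
    have h1 : (s <= k)%N by lia.
    have h2 : (r.-1 < k)%N by lia.
    apply: planar_ext (planar_ins h1 (IH k _ erefl h2)) _ => w.
    by congr f; apply/funext => i; word_cases.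
  have h1 : (s.-1 <= k)%N by lia.
  have h2 : (r < k)%N by lia.
  apply: planar_ext (planar_ins h1 (IH k _ erefl h2)) _ => w.
  by congr f; apply/funext => i; word_cases.
move=> l s f sl lf IH k r [lk] rk; subst l.
have [sr|sr] := eqVneq s r.
  apply: planar_ext lf _ => w; rewrite sr /= /unbump_at leqnn ltnn eqxx mul1r.
  by congr f; apply/funext => i; word_cases.
case: k sl lf IH rk => // k sl lf IH rk.
have [sr'|sr'] := ltnP s r; last first.
  have h1 : (s.-1 < k)%N by lia.
  have h2 : (r < k)%N by lia.
  apply: planar_ext (planar_dup h1 (IH k _ erefl h2)) _ => w.
  congr ((nat_of_bool (w _ == w _))%:R * f _); try by word_cases.
  by apply/funext => i; word_cases.
have [sr2|sr2] := eqVneq s.+1 r.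
  have h1 : (s < k)%N by lia.
  have h2 : (s < k)%N by lia.
  apply: planar_ext (planar_dup h1 (IH k _ erefl h2)) _ => w.
  have us : unbump_at r s = s by rewrite /unbump_at; case: ifP; lia.
  have us1 : unbump_at r s.+1 = s.+1 by rewrite /unbump_at; case: ifP; lia.
  rewrite [in RHS]/= us us1.
  case: eqP => [ws|_]; last by rewrite !mul0r.
  congr (_ * f _); apply/funext => i.
  (* The two words differ only at s+1, where the Kronecker delta makes their letters equal. *)
  have [->|si] := eqVneq i s.+1; last by word_cases.
  rewrite /= (_ : bump _ _ = s); last by rewrite /unbump_at /bump; case: ifP; lia.
  by rewrite ws; congr w; rewrite /unbump_at /bump; case: ifP; lia.
have h1 : (s < k)%N by lia.
have h2 : (r.-1 < k)%N by lia.
apply: planar_ext (planar_dup h1 (IH k _ erefl h2)) _ => w.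
congr ((nat_of_bool (w _ == w _))%:R * f _); try by word_cases.
by apply/funext => i; word_cases.
Qed.

Lemma planar_contract k r f : planar k.+1 f -> (r <= k)%N ->
  planar k (fun w => \sum_x f (insw r x w)).
Proof.
move=> kf; move: {1 2}k.+1 kf (erefl k.+1) => l kf; elim: kf k r => {l f}.
- by [].
- move=> l k r _ _; apply: planar_ext (planar0 k) _ => w.
  by rewrite big1.
- move=> l c f g _ IHf _ IHg k r lk rk.
  apply: planar_ext (planarD c (IHf k r lk rk) (IHg k r lk rk)) _ => w.
  by rewrite big_split /= mulr_sumr.
- move=> l s f sl lf IH k r [lk] rk; subst l.
  have [sr|sr] := eqVneq s r.
    apply: planar_ext (planarZ #|X|%:R lf) _ => w.
    rewrite mulr_natl -sumr_const; apply: eq_bigr => x _; congr f.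
    by apply/funext => i; rewrite sr; word_cases.
  case: k sl lf IH rk => [|k] sl lf IH rk; first by lia.
  have [sr'|sr'] := ltnP s r.
    have h1 : (s <= k)%N by lia.
    have h2 : (r.-1 <= k)%N by lia.
    apply: planar_ext (planar_ins h1 (IH k _ erefl h2)) _ => w.
    apply: eq_bigr => x _; congr f.
    by apply/funext => i; word_cases.
  have h1 : (s.-1 <= k)%N by lia.
  have h2 : (r <= k)%N by lia.
  apply: planar_ext (planar_ins h1 (IH k _ erefl h2)) _ => w.
  apply: eq_bigr => x _; congr f.
  by apply/funext => i; word_cases.
move=> l s f sl lf IH k r [lk] rk; subst l.
have pick (a : C) y : \sum_(x : X) (x == y)%:R * a = a.
  by rewrite (bigD1 y) //= eqxx mul1r big1 ?addr0 // => x /negPf ->; rewrite mul0r.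
have [sr|sr] := eqVneq s r.
  apply: planar_ext lf _ => w; rewrite -[LHS](pick _ (w r)).
  apply: eq_bigr => x _; rewrite sr [in RHS]/insw ltnn eqxx ltnNge leqnSn /=.
  rewrite gtn_eqF //; case: eqP => [->|_]; last by rewrite !mul0r.
  congr (_ * f _); apply/funext => i.
  have [->|ir] := eqVneq i r; last by word_cases.
  by word_cases.
have [sr1|sr1] := eqVneq s.+1 r.
  apply: planar_ext lf _ => w; rewrite -[LHS](pick _ (w s)).
  apply: eq_bigr => x _.
  have -> : insw r x w s = w s by rewrite /insw ifT //; lia.
  have -> : insw r x w s.+1 = x by rewrite /insw ifF ?sr1 ?eqxx //; lia.
  rewrite eq_sym; congr (_ * f _); apply/funext => i; rewrite sr1.
  by word_cases.
case: k sl lf IH rk => [|k] sl lf IH rk; first by lia.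
have [sr'|sr'] := ltnP s r.
  have h1 : (s < k)%N by lia.
  have h2 : (r.-1 <= k)%N by lia.
  apply: planar_ext (planar_dup h1 (IH k _ erefl h2)) _ => w.
  rewrite mulr_sumr; apply: eq_bigr => x _.
  have -> : insw r x w s = w s by rewrite /insw ifT.
  have -> : insw r x w s.+1 = w s.+1 by rewrite /insw ifT //; lia.
  congr (_ * f _); apply/funext => i.
  by word_cases.
have h1 : (s.-1 < k)%N by lia.
have h2 : (r <= k)%N by lia.
apply: planar_ext (planar_dup h1 (IH k _ erefl h2)) _ => w.
rewrite mulr_sumr; apply: eq_bigr => x _.
have -> : insw r x w s = w s.-1 by rewrite /insw !ifF //; lia.
have -> : insw r x w s.+1 = w s.-1.+1.
  by rewrite /insw !ifF //; [congr w|..]; lia.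
congr (_ * f _); apply/funext => i.
by word_cases.
Qed.

Lemma planar_tensor i k f g : planar i f -> planar k g ->
  planar (i + k) (fun w => f w * g (fun m => w (i + m)%N)).
Proof.
move=> pf; have loc := planar_local pf.
elim=> {k g} [|k|k c g g' _ IH _ IH'|k s g sk _ IH|k s g sk _ IH].
- by rewrite addn0; apply: planar_ext pf _ => w; rewrite mulr1.
- by apply: planar_ext (planar0 _) _ => w; rewrite mulr0.
- by apply: planar_ext (planarD c IH IH') _ => w; ring.
- have h : (i + s <= i + k)%N by lia.
  rewrite addnS; apply: planar_ext (planar_ins h IH) _ => w.
  congr (_ * g _); last by apply/funext => m; rewrite /= /bump; congr w; lia.
  by apply: loc => m mi; rewrite /= /bump; congr w; lia.
have h : (i + s < i + k)%N by lia.
rewrite addnS; apply: planar_ext (planar_dup h IH) _ => w.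
rewrite addnS mulrCA; congr (_ * (_ * g _)).
  by apply: loc => m mi; rewrite /= /bump; congr w; lia.
by apply/funext => m; rewrite /= /bump; congr w; lia.
Qed.

Lemma planar_rev k f : planar k f -> planar k (fun w => f (revw x0 k w)).
Proof.
elim=> {k f} [|k|k c f g _ IHf _ IHg|k s f sk pf IH|k s f sk pf IH].
- exact: planar1.
- exact: planar0.
- exact: planarD IHf IHg.
- have h : (k - s <= k)%N by lia.
  apply: planar_ext (planar_ins h IH) _ => w; apply: (planar_local pf) => i ik.
  rewrite /revw /= ik (_ : (bump s i < k.+1)%N); last by rewrite /bump; lia.
  by rewrite /bump; congr w; lia.
have h : (k - s.+1 < k)%N by lia.
apply: planar_ext (planar_dup h IH) _ => w.
have -> : revw x0 k.+1 w s = w (k - s.+1).+1 by rewrite /revw ifT; [congr w|]; lia.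
have -> : revw x0 k.+1 w s.+1 = w (k - s.+1)%N.
  by rewrite /revw ifT; [congr w|]; lia.
rewrite eq_sym; case: eqP => [ws|_]; last by rewrite !mul0r.
congr (_ * _); apply: (planar_local pf) => i ik.
rewrite /revw /= ik (_ : (bump s.+1 i < k.+1)%N); last by rewrite /bump; lia.
have [->|si] := eqVneq i s.
  rewrite (_ : bump _ _ = k - s.+1)%N; last by rewrite /bump; lia.
  by rewrite -ws; congr w; rewrite /bump; lia.
by rewrite /bump; congr w; lia.
Qed.

Lemma planar_conj k f : planar k f -> planar k (fun w => Num.conj (f w)).
Proof.
elim=> {k f} [|k|k c f g _ IHf _ IHg|k s f sk _ IH|k s f sk _ IH].
- by apply: planar_ext planar1 _ => w; rewrite rmorph1.
- by apply: planar_ext (planar0 _) _ => w; rewrite rmorph0.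
- apply: planar_ext (planarD (Num.conj c) IHf IHg) _ => w.
  by rewrite rmorphD rmorphM.
- exact: planar_ins IH.
- apply: planar_ext (planar_dup sk IH) _ => w.
  by rewrite rmorphM rmorph_nat.
Qed.

(* Composition of morphisms, with the domain word of a morphism reversed. *)
Lemma planar_compose i j k f : planar (i + (j + (j + k))) f ->
  planar (i + k) (fun w => wsum x0 j (fun J =>
    f (catw i w (catw j J (catw j (revw x0 j J) (fun m => w (i + m)%N)))))).
Proof.
elim: j f => [|j IH] f pf.
  apply: planar_ext pf _ => w; rewrite wsum0; congr f; apply/funext => m.
  by rewrite /catw !subn0 /=; case: ltnP => // im; rewrite subnKC.
have e1 : (i + (j.+1 + (j.+1 + k)) = (i + (j + (j + k))).+2)%N by lia.
rewrite e1 in pf.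
have h1 : (i + j < (i + (j + (j + k))).+1)%N by lia.
have h2 : (i + j <= (i + (j + (j + k))))%N by lia.
(* The last letter of J and the first letter of its reversal sit next to each other at i+j and
   i+j+1. Merging and summing out this innermost pair shortens J by one. *)
have pf' := planar_contract (planar_merge pf h1) h2.
apply: planar_ext (IH _ pf') _ => w; rewrite (wsum_ins _ _ (leqnn j)) wsum_sum.
apply: eq_bigr => x _; apply: eq_wsum => J; congr f; apply/funext => m.
rewrite /= /unbump_at /catw /insw /revw.
case: (leqP m (i + j)) => ?; repeat (case: ifP => ?; try lia); try by [];
  first [congr w; lia | congr J; lia].
Qed.

End Planar.

(** * The projection onto the planar functions *)

Section FixedProjIntertwines.
Variables (C : numClosedFieldType) (X : finType) (x0 : X).
Hypothesis card_X : (4 <= #|X|)%N.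
Implicit Types (I J w : nat -> X).
Local Notation P := (fixed_proj C).
Local Notation wsum := (wsum x0).

Lemma planar_fixed_proj k J : planar k (P k ^~ J).
Proof. exact/planar_nc_span/fixed_proj_span. Qed.

Lemma planar_fixed_projr k I : planar k (P k I).
Proof.
by apply: planar_ext (planar_fixed_proj k I) _ => J; apply: fixed_proj_sym.
Qed.

Lemma planar_reproduce k f I : planar k f -> wsum k (fun J => P k I J * f J) = f I.
Proof. by move=> /planar_nc_span/(fixed_proj_reproduce x0 card_X). Qed.

Lemma fixed_proj0 I J : P 0 I J = 1.
Proof.
rewrite -[RHS](planar_reproduce I (planar1 _ _)) wsum0 mulr1.
by apply: planar_local (planar_fixed_projr 0 I) _.
Qed.

Lemma fixed_proj_local k I I' J J' : (forall i, (i < k)%N -> I i = I' i) ->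
  (forall i, (i < k)%N -> J i = J' i) -> P k I J = P k I' J'.
Proof.
move=> II JJ; rewrite (planar_local (planar_fixed_projr k I) JJ).
exact: (planar_local (planar_fixed_proj k J') II).
Qed.

(* [P] and each generator commute because both the generator and its adjoint
   preserve the planar functions; [wsum_ins] supplies the adjointness. *)
Lemma fixed_proj_merge k r I J : (r < k)%N ->
  P k.+1 (I \o unbump_at r) J = (J r == J r.+1)%:R * P k I (J \o bump r.+1).
Proof.
move=> rk.
(* The left side is planar in [I] and the right side in [J]; expanding each by reproduction gives
   two sums that [wsum_ins] matches term by term. *)
have pl := planar_merge (planar_fixed_proj k.+1 J) rk.
rewrite -(planar_reproduce I pl) -(planar_reproduce J (planar_dup rk (planar_fixed_projr k I))).
rewrite (wsum_ins _ _ (rk : (r.+1 <= k)%N)) -wsum_sum; apply: eq_wsum => I'.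
rewrite (bigD1 (I' r)) //= big1 ?addr0 => [|x xI]; last first.
  by rewrite /insw ltnSn ltnn eqxx eq_sym (negPf xI) mul0r mulr0.
rewrite [in X in _ * (X * _)]/insw ltnSn ltnn !eqxx mul1r [LHS]mulrC.
congr (_ * _).
  rewrite (fixed_proj_sym C x0 _ J); congr (fixed_proj _ _ _ _).
  apply/funext => i; rewrite /insw /unbump_at /= ltnS; case: leqP => // ri.
  by case: eqP => [->|].
congr (fixed_proj _ _ _ _); apply/funext => i; rewrite /insw /bump /=.
by repeat (case: ifP => ?; try lia); congr I'; lia.
Qed.

Lemma fixed_proj_contract k r I J : (r <= k)%N ->
  \sum_x P k.+1 (insw r x I) J = P k I (J \o bump r).
Proof.
move=> rk.
have pl := planar_contract (planar_fixed_proj k.+1 J) rk.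
rewrite -(planar_reproduce I pl) -(planar_reproduce J (planar_ins rk (planar_fixed_projr k I))).
rewrite (wsum_ins _ _ rk) -wsum_sum; apply: eq_wsum => I'.
rewrite mulr_sumr; apply: eq_bigr => x _.
rewrite [LHS]mulrC (fixed_proj_sym C x0 _ J); congr (_ * fixed_proj _ _ _ _).
apply/funext => i; rewrite /insw /bump /=.
by repeat (case: ifP => ?; try lia); congr I'; lia.
Qed.

End FixedProjIntertwines.

(** * Positivity of a Hermitian form tested on its range *)

Section HermitianRange.
Local Open Scope sesquilinear_scope.

(** A Hermitian form does not see the orthogonal complement of its range, so any vector may be
    replaced by its projection onto the row space of the matrix. *)
Lemma hermitian_ge0_of_range (C : numClosedFieldType) (T : finType)
    (A : T -> T -> C) :
  (forall s t, A s t = Num.conj (A t s)) ->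
  (forall d : T -> C, let y t := \sum_s d s * A s t in
     0 <= \sum_s \sum_t y s * A s t * Num.conj (y t)) ->
  forall c : T -> C, 0 <= \sum_s \sum_t c s * A s t * Num.conj (c t).
Proof.
move=> Aherm Arange c.
pose M : 'M[C]_#|T| := \matrix_(i, j) A (enum_val i) (enum_val j).
have formE (d : T -> C) : \sum_s \sum_t d s * A s t * Num.conj (d t) =
    ((\row_i d (enum_val i)) *m M *m (\row_i d (enum_val i))^t*) 0 0.
  rewrite mxE exchange_big (reindex _ (onW_bij _ (enum_val_bij T))) /=.
  apply: eq_bigr => j _; rewrite !mxE mulr_suml.
  rewrite (reindex _ (onW_bij _ (enum_val_bij T))) /=.
  by apply: eq_bigr => i _; rewrite !mxE.
have MH : M^t* = M by apply/matrixP => i j; rewrite !mxE -Aherm.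
rewrite formE; set v := \row_i _.
pose v1 := v *m proj_ortho M.
have vM : v *m M = v1 *m M.
  have /orthomx1P := proj_ortho_compl_sub M v.
  by rewrite MH mulmxBl => /eqP; rewrite subr_eq0 => /eqP.
have /submxP[D v1D] : (v1 <= M)%MS := proj_ortho_sub M v.
have Mv : M *m v^t* = M *m v1^t*.
  have := congr1 (fun B => B^t*) vM.
  by rewrite !trmx_mul !map_mxM /= MH.
rewrite vM -mulmxA Mv mulmxA.
pose d t := D 0 (enum_rank t).
suff <- : \row_i (\sum_s d s * A s (enum_val i)) = v1.
  by rewrite -(formE (fun t => \sum_s d s * A s t)); exact: Arange.
apply/rowP => i; rewrite v1D !mxE (reindex _ (onW_bij _ (enum_val_bij T))) /=.
by apply: eq_bigr => j _; rewrite /d enum_valK mxE.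
Qed.

End HermitianRange.

(* [Q] is the kernel of the orthogonal projection of the matrices onto a
   *-algebra [M]. The realignment of [Q] is positive because the projection is
   an [M]-bimodule map: on its range the quadratic form is a sum of squares. *)
Section Realignment.
Variables (C : numClosedFieldType) (S : finType).
Variables (Q : S -> S -> S -> S -> C) (M : (S -> S -> C) -> Prop).
Hypothesis Qherm : forall k i l j, Num.conj (Q k i l j) = Q l j k i.
Hypothesis MQ : forall l j, M (fun k i => Q k i l j).
Hypothesis Mrep : forall T, M T -> forall k i,
  \sum_l \sum_j Q k i l j * T l j = T k i.
Hypothesis Mmul : forall T T', M T -> M T' ->
  M (fun k i => \sum_j T k j * T' j i).
Hypothesis Madj : forall T, M T -> M (fun k i => Num.conj (T i k)).

(** Taking adjoints is an antiunitary involution that preserves the range, and hence commutes with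
    the orthogonal projection onto it. *)
Lemma proj_adjoint k i l j : Num.conj (Q k i l j) = Q i k j l.
Proof.
have e1 := Mrep (Madj (MQ l j)) i k.
have e2 := Mrep (Madj (MQ i k)) l j.
rewrite -e1 -(Qherm j l i k) -e2 exchange_big /=.
apply: eq_bigr => p _; apply: eq_bigr => q _.
by rewrite !Qherm mulrC.
Qed.

(** On kernels, this is E(X) T = E(X T) for the projection E. Right multiplication by T and its
    adjoint, right multiplication by T*, both preserve the range of E. *)
Lemma proj_modular T k i l j : M T ->
  \sum_m Q k m l j * T m i = \sum_m T j m * Q k i l m.
Proof.
move=> MT; rewrite -(Mrep (Mmul (MQ l j) MT) k i).
have e := Mrep (Mmul (MQ k i) (Madj MT)) l j.
transitivity (Num.conj (\sum_m Q l m k i * Num.conj (T j m))); last first.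
  rewrite rmorph_sum; apply: eq_bigr => m _.
  by rewrite rmorphM /= conjCK Qherm mulrC.
rewrite -e rmorph_sum; apply: eq_bigr => p _.
rewrite rmorph_sum /=; under eq_bigr => q _ do rewrite mulr_sumr.
rewrite exchange_big; apply: eq_bigr => m _ /=.
rewrite rmorphM rmorph_sum mulr_sumr; apply: eq_bigr => q _ /=.
by rewrite Qherm rmorphM /= conjCK Qherm; ring.
Qed.

Lemma realignment_ge0 (c : S -> S -> C) :
  0 <= \sum_i \sum_j \sum_k \sum_l Num.conj (c i j) * c k l * Q k i l j.
Proof.
pose A (s t : S * S) := Q s.1 t.1 s.2 t.2.
have Aherm s t : A s t = Num.conj (A t s) by rewrite proj_adjoint.
suff key (d : S * S -> C) : let y t := \sum_s d s * A s t in
    0 <= \sum_s \sum_t y s * A s t * Num.conj (y t).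
  have := hermitian_ge0_of_range Aherm key (fun s => c s.1 s.2).
  congr (0 <= _); rewrite exchange_big [RHS]pair_big /=; apply: eq_bigr => -[i j] _.
  by rewrite [RHS]pair_big; apply: eq_bigr => -[k l] _; rewrite /A /=; ring.
move=> y.
(* Read as a matrix, a vector y in the range of the realigned kernel commutes with the transpose of
   every T in the *-algebra. *)
have comm T i l : M T ->
    \sum_k T k i * y (k, l) = \sum_k y (i, k) * T l k.
  move=> MT; rewrite /y; under eq_bigr => k _ do rewrite mulr_sumr.
  under [RHS]eq_bigr => k _ do rewrite mulr_suml.
  rewrite exchange_big [RHS]exchange_big; apply: eq_bigr => -[p q] _.
  rewrite /A /=; transitivity (d (p, q) * \sum_k Q p k q l * T k i).
    by rewrite mulr_sumr; apply: eq_bigr => k _; ring.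
  by rewrite proj_modular // mulr_sumr; apply: eq_bigr => k _; ring.
(* By [comm], the sum over k of y(k, l) Q(k, i; l, j) becomes the sum over m of y(i, m) Q(l, m; l,
   j). Splitting this Q as a product of two, by idempotence of the projection, exhibits the
   squares. *)
have -> : \sum_s \sum_t y s * A s t * Num.conj (y t) =
    \sum_i \sum_l \sum_p \sum_q (\sum_m y (i, m) * Num.conj (Q p q l m)) *
      Num.conj (\sum_m y (i, m) * Num.conj (Q p q l m)).
  rewrite exchange_big.
  transitivity (\sum_i \sum_j \sum_l (\sum_m y (i, m) * Q l m l j) *
      Num.conj (y (i, j))).
    rewrite [RHS]pair_big; apply: eq_bigr => -[i j] _ /=.
    transitivity (\sum_k \sum_l y (k, l) * A (k, l) (i, j) * Num.conj (y (i, j))).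
      by rewrite [RHS]pair_big; apply: eq_bigr => -[k l].
    rewrite exchange_big; apply: eq_bigr => l _ /=.
    rewrite -mulr_suml; congr (_ * _); rewrite -(comm _ _ _ (MQ l j)).
    by apply: eq_bigr => k _; rewrite mulrC.
  apply: eq_bigr => i _; rewrite exchange_big; apply: eq_bigr => l _ /=.
  transitivity (\sum_j \sum_m \sum_p \sum_q y (i, m) *
      Num.conj (Q p q l m) * Q p q l j * Num.conj (y (i, j))).
    apply: eq_bigr => j _; rewrite mulr_suml; apply: eq_bigr => m _.
    rewrite -(Mrep (MQ l j) l m) !(mulr_sumr, mulr_suml); apply: eq_bigr => p _.
    rewrite !(mulr_sumr, mulr_suml); apply: eq_bigr => q _.
    by rewrite Qherm; ring.
  rewrite pair_big exchange_big; apply: eq_bigr => p _.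
  rewrite exchange_big; apply: eq_bigr => q _.
  rewrite rmorph_sum mulr_suml; under [RHS]eq_bigr => m _ do rewrite mulr_sumr.
  rewrite [RHS]exchange_big [RHS]pair_big; apply: eq_bigr => -[j m] _ /=.
  by rewrite rmorphM /= conjCK; ring.
by do 4!(apply: sumr_ge0 => ? _); exact: mul_conjC_ge0.
Qed.

End Realignment.

(** * The Haar functional on words *)

Section HaarWords.
Variables (C : numClosedFieldType) (X : finType) (x0 : X).
Hypothesis card_X : (4 <= #|X|)%N.
Implicit Types (a b : seq (X * X)) (s t : seq X).
Local Notation P := (fixed_proj C).
Local Notation wsum := (wsum x0).

Lemma nth_cat_catw s t : nth x0 (s ++ t) = catw (size s) (nth x0 s) (nth x0 t).
Proof. by apply/funext => i; rewrite nth_cat. Qed.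

Lemma nth_rev_revw s : nth x0 (rev s) = revw x0 (size s) (nth x0 s).
Proof.
apply/funext => i; rewrite /revw; case: ltnP => h; first by rewrite nth_rev.
by rewrite nth_default // size_rev.
Qed.

Lemma nth_bump s x t : nth x0 (s ++ x :: t) \o bump (size s) = nth x0 (s ++ t).
Proof.
apply/funext => i; rewrite /= !nth_cat /bump.
case: (leqP (size s) i) => h; last by rewrite add0n h.
have [d ->] : exists d, i = (size s + d)%N by exists (i - size s)%N; lia.
case: ifP => [|_]; first by lia.
by rewrite addKn (_ : true + (size s + d) - size s = d.+1)%N //; lia.
Qed.

Lemma nth_unbump s x t :
  nth x0 (s ++ x :: t) \o unbump_at (size s) = nth x0 (s ++ x :: x :: t).
Proof.
apply/funext => i; rewrite /= !nth_cat /unbump_at; case: (leqP i (size s)) => h.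
  by case: ltnP => // h'; rewrite (_ : i = size s) ?subnn //; lia.
have [d ->] : exists d, i = (size s + d).+1 by exists (i - (size s).+1)%N; lia.
case: ifP => [|_]; first by lia.
case: ifP => [|_]; first by lia.
by rewrite [_.+1.-1]/= -addnS !addKn.
Qed.

Lemma nth_insw s x t : insw (size s) x (nth x0 (s ++ t)) = nth x0 (s ++ x :: t).
Proof.
apply/funext => i; rewrite /insw !nth_cat; case: (ltngtP i (size s)) => h //; last first.
  by rewrite h subnn.
have [d ->] : exists d, i = (size s + d).+1 by exists (i - (size s).+1)%N; lia.
case: ifP => [|_]; first by lia.
by rewrite [_.+1.-1]/= -addnS !addKn.
Qed.

(* The letter [(i, j)] stands for the generator [u_ij]. *)
Definition haar_word a : C :=
  P (size a) (nth x0 (unzip1 a)) (nth x0 (unzip2 a)).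

Lemma haar_word_nil : haar_word [::] = 1.
Proof. exact: (fixed_proj0 C x0 card_X). Qed.

Lemma haar_word_row a b i j j' :
  haar_word (a ++ (i, j) :: (i, j') :: b) =
  (j == j')%:R * haar_word (a ++ (i, j) :: b).
Proof.
rewrite /haar_word !size_cat /= !addnS /unzip1 /unzip2 !map_cat /=.
rewrite -[X in P _ X](nth_unbump (unzip1 a) i) size_map.
rewrite (fixed_proj_merge C x0 card_X); last by rewrite ltnS leq_addr.
congr (_ * _).
  rewrite nth_cat size_map ltnn subnn nth_cat size_map ltnNge leqnSn /=.
  by rewrite subSnn.
have := nth_bump ([seq p.2 | p <- a] ++ [:: j]) j' [seq p.2 | p <- b].
by rewrite -!catA /= size_cat size_map addn1 => ->.
Qed.

(** The symmetry of the projection kernel exchanges rows and columns, which halves the relations to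
    be checked. *)
Lemma haar_word_tr a : haar_word [seq (p.2, p.1) | p <- a] = haar_word a.
Proof.
rewrite /haar_word size_map (fixed_proj_sym C x0) /unzip1 /unzip2 -!map_comp.
by [].
Qed.

Lemma haar_word_col a b i i' j :
  haar_word (a ++ (i, j) :: (i', j) :: b) =
  (i == i')%:R * haar_word (a ++ (i, j) :: b).
Proof.
by rewrite -[in LHS]haar_word_tr map_cat /= haar_word_row -[in RHS]haar_word_tr map_cat.
Qed.

Lemma haar_word_sum_row a b j :
  \sum_i haar_word (a ++ (i, j) :: b) = haar_word (a ++ b).
Proof.
rewrite /haar_word; under eq_bigr => i _.
  rewrite size_cat /= addnS /unzip1 /unzip2 !map_cat /=.
  rewrite -nth_insw size_map; over.
rewrite (fixed_proj_contract C x0 card_X) ?leq_addr // size_cat.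
rewrite /unzip1 /unzip2 !map_cat.
have := nth_bump [seq p.2 | p <- a] j [seq p.2 | p <- b].
by rewrite size_map => ->.
Qed.

Lemma haar_word_sum_col a b i :
  \sum_j haar_word (a ++ (i, j) :: b) = haar_word (a ++ b).
Proof.
rewrite -[RHS]haar_word_tr map_cat -(haar_word_sum_row _ _ i).
by apply: eq_bigr => j _; rewrite -[LHS]haar_word_tr map_cat.
Qed.

Section Positivity.
Variable K : nat.
Local Notation S := (K.-bseq X).

Lemma sum_bseq (V : nmodType) m (F : (nat -> X) -> V) : (m <= K)%N ->
  \sum_(s : S | size s == m) F (nth x0 s) = wsum m F.
Proof.
move=> mK.
have szK (t : m.-tuple X) : (size t <= K)%N by rewrite size_tuple.
have h (t : m.-tuple X) : insub_bseq K t = t :> seq X.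
  by apply: insubdK; rewrite unfold_in; exact: szK.
rewrite (reindex_onto (fun t : m.-tuple X => insub_bseq K t)
  (fun s : S => insubd (nseq_tuple m x0) (s : seq X))) /=; last first.
  by move=> s sm; apply: val_inj; rewrite /= h insubdK // unfold_in.
apply: eq_big => t /=; last by rewrite h.
have -> : size (insub_bseq K t) = m by rewrite h size_tuple.
rewrite eqxx /=; apply/eqP/val_inj; rewrite insubdK /= ?h //.
by rewrite unfold_in size_tuple.
Qed.

(* Indexed by words of length at most [K], the planar matrices form a *-algebra,
   and [word_kernel] is the kernel of the projection onto it. *)
Definition word_kernel (k i l j : S) : C :=
  if (size i == size j) && (size k == size l)
  then P (size i + size k) (nth x0 (rev i ++ k)) (nth x0 (rev j ++ l)) else 0.

(** A matrix entry is read along the boundary of a diagram from the word i to the word k, which is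
    why i appears reversed. Each pair of lengths has its own planar function, so blocks between
    different lengths are allowed. *)
Definition planar_matrix (T : S -> S -> C) := forall i0 k0,
  (i0 <= K)%N -> (k0 <= K)%N -> exists2 f, planar (i0 + k0) f &
    forall k i : S, size i = i0 -> size k = k0 -> T k i = f (nth x0 (rev i ++ k)).

Lemma word_kernel_herm k i l j : Num.conj (word_kernel k i l j) = word_kernel l j k i.
Proof.
rewrite /word_kernel (eq_sym (size j)) (eq_sym (size l)).
case: ifP => [/andP[/eqP ij /eqP kl]|_]; last exact: rmorph0.
by rewrite conj_fixed_proj (fixed_proj_sym C x0) ij kl.
Qed.

Lemma planar_matrix_kernel l j : planar_matrix (fun k i => word_kernel k i l j).
Proof.
move=> i0 k0 _ _; have [/andP[/eqP ij /eqP kl]|n] := boolP ((i0 == size j) && (k0 == size l)).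
  exists (P (i0 + k0) ^~ (nth x0 (rev j ++ l))); first exact: planar_fixed_proj.
  by move=> k i si sk; rewrite /word_kernel si sk ij kl !eqxx.
exists (fun=> 0); first exact: planar0.
by move=> k i si sk; rewrite /word_kernel si sk (negPf n).
Qed.

Lemma planar_matrix_reproduce T : planar_matrix T -> forall k i,
  \sum_l \sum_j word_kernel k i l j * T l j = T k i.
Proof.
move=> MT k i.
have [f pf fE] := MT (size i) (size k) (size_bseq i) (size_bseq k).
rewrite (fE k i) // -(planar_reproduce x0 card_X _ pf) wsum_cat.
transitivity (\sum_(j : S | size j == size i) \sum_(l : S | size l == size k)
   P (size i + size k) (nth x0 (rev i ++ k)) (nth x0 (rev j ++ l)) *
   f (nth x0 (rev j ++ l))).
  rewrite exchange_big [RHS]big_mkcond; apply: eq_bigr => j _.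
  case: eqP => ji; last first.
    by apply: big1 => l _; rewrite /word_kernel ifF ?mul0r //; apply/negP => /andP[/eqP/esym].
  rewrite [RHS]big_mkcond; apply: eq_bigr => l _.
  case: eqP => lk; last first.
    by rewrite /word_kernel ifF ?mul0r //; apply/negP => /andP[_ /eqP/esym].
  by rewrite /word_kernel ji lk !eqxx (fE l j).
rewrite -wsum_rev -sum_bseq ?size_bseq //; apply: eq_bigr => j /eqP ji.
rewrite -sum_bseq ?size_bseq //; apply: eq_bigr => l /eqP lk.
suff -> : nth x0 (rev j ++ l) =
    catw (size i) (revw x0 (size i) (nth x0 j)) (nth x0 l) by [].
by rewrite nth_cat_catw size_rev nth_rev_revw ji.
Qed.

Lemma planar_matrix_mul T T' : planar_matrix T -> planar_matrix T' ->
  planar_matrix (fun k i => \sum_j T k j * T' j i).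
Proof.
move=> MT MT' i0 k0 iK kK.
have /boolp.choice[f fP] : forall m : 'I_K.+1, exists f, planar (m + k0) f /\
    forall k i : S, size i = m -> size k = k0 -> T k i = f (nth x0 (rev i ++ k)).
  by move=> m; have [|f pf fE] := MT m k0 _ kK; [rewrite -ltnS|exists f].
have /boolp.choice[g gP] : forall m : 'I_K.+1, exists g, planar (i0 + m) g /\
    forall k i : S, size i = i0 -> size k = m -> T' k i = g (nth x0 (rev i ++ k)).
  by move=> m; have [|g pg gE] := MT' i0 m iK; [rewrite -ltnS|exists g].
(* Side by side, the two factors read the word rev i ++ j ++ rev j ++ k, whose middle
   [planar_compose] sums out. The length m of j is arbitrary up to [K]. *)
pose F m w := g m w * f m (fun r => w (i0 + m + r)%N).
have pF (m : 'I_K.+1) : planar (i0 + (m + (m + k0))) (F m).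
  by rewrite addnA; apply: planar_tensor; [exact: (gP m).1|exact: (fP m).1].
exists (fun w => \sum_(m < K.+1) wsum m (fun J => F m
  (catw i0 w (catw m J (catw m (revw x0 m J) (fun r => w (i0 + r)%N)))))).
  by apply: planar_sum => m; exact: planar_compose.
move=> k i si sk.
rewrite (partition_big (fun j : S => inord (size j) : 'I_K.+1) xpredT) //=.
apply: eq_bigr => m _; have mK : (m <= K)%N by rewrite -ltnS.
rewrite -sum_bseq //; apply: eq_big => j.
  rewrite -val_eqE /= inordK // ltnS; exact: size_bseq.
move=> /eqP jm; have {}jm : size j = m by rewrite -jm inordK // ltnS size_bseq.
rewrite (fP m).2 // (gP m).2 // mulrC /F; congr (_ * f m _).
  apply: planar_local (gP m).1 _ => r rm; rewrite nth_cat_catw size_rev si.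
  rewrite /catw; case: ifP => h; last by rewrite ifT //; lia.
  by rewrite nth_cat size_rev si h.
apply/funext => r; rewrite !nth_cat_catw !size_rev si /catw nth_rev_revw jm.
have e1 : (i0 + m + r < i0)%N = false by lia.
have e2 : (i0 + m + r - i0 < m)%N = false by lia.
have e3 : (i0 + m + r - i0 - m = r)%N by lia.
rewrite e1 e2 e3; case: ifP => // rm.
have e4 : (i0 + (r - m) < i0)%N = false by lia.
by rewrite e4 addKn.
Qed.

Lemma planar_matrix_adj T : planar_matrix T ->
  planar_matrix (fun k i => Num.conj (T i k)).
Proof.
move=> MT i0 k0 iK kK; have [f pf fE] := MT k0 i0 kK iK.
exists (fun w => Num.conj (f (revw x0 (i0 + k0) w))).
  by apply/planar_conj/planar_rev; rewrite addnC.
move=> k i si sk; rewrite (fE i k) //; congr (Num.conj (f _)).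
have -> : (i0 + k0 = size (rev i ++ k))%N by rewrite size_cat size_rev si sk.
by rewrite -nth_rev_revw rev_cat revK.
Qed.

(** With i, j the row and column words of a, and k, l those of b, the word rev a ++ b has row word
    rev i ++ k and column word rev j ++ l. The sum is therefore the realigned form of the
    coefficients collected by row and column words. *)
Lemma haar_word_ge0_bounded (r : seq (seq (X * X))) (c : seq (X * X) -> C) :
  all (fun a => (size a <= K)%N) r ->
  0 <= \sum_(a <- r) \sum_(b <- r) Num.conj (c a) * c b * haar_word (rev a ++ b).
Proof.
move=> /allP rK.
pose row a : S := insub_bseq K (unzip1 a).
pose col a : S := insub_bseq K (unzip2 a).
have rowE a : a \in r -> row a = unzip1 a :> seq X.
  by move=> /rK ar; apply: insubdK; rewrite unfold_in size_map.
have colE a : a \in r -> col a = unzip2 a :> seq X.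
  by move=> /rK ar; apply: insubdK; rewrite unfold_in size_map.
pose d (i j : S) := \sum_(a <- r) c a * ((row a == i) && (col a == j))%:R.
have collapse (e : seq (X * X) -> C) (G : S -> S -> C) :
    \sum_i \sum_j (\sum_(a <- r) e a * ((row a == i) && (col a == j))%:R) * G i j
    = \sum_(a <- r) e a * G (row a) (col a).
  under eq_bigr => i _ do under eq_bigr => j _ do rewrite mulr_suml.
  under eq_bigr => i _ do rewrite exchange_big.
  rewrite exchange_big; apply: eq_bigr => a _ /=.
  rewrite (bigD1 (row a)) //= (bigD1 (col a)) //= !eqxx mulr1.
  rewrite big1 ?addr0 => [|j /negPf ja]; last by rewrite eq_sym ja mulr0 mul0r.
  rewrite big1 ?addr0 // => i /negPf ia; apply: big1 => j _.
  by rewrite eq_sym ia mulr0 mul0r.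
have := realignment_ge0 word_kernel_herm planar_matrix_kernel planar_matrix_reproduce
  planar_matrix_mul planar_matrix_adj d.
congr (0 <= _).
transitivity (\sum_i \sum_j (\sum_(a <- r)
    Num.conj (c a) * ((row a == i) && (col a == j))%:R) *
    \sum_(b <- r) c b * word_kernel (row b) i (col b) j).
  apply: eq_bigr => i _; apply: eq_bigr => j _.
  rewrite -(collapse c (fun k l => word_kernel k i l j)) mulr_sumr.
  apply: eq_bigr => k _; rewrite mulr_sumr; apply: eq_bigr => l _.
  rewrite -/(d k l) mulrA; congr (_ * _ * _); rewrite /d rmorph_sum.
  by apply: eq_bigr => a _; rewrite rmorphM /= rmorph_nat.
rewrite (collapse _ (fun i j => \sum_(b <- r) c b * word_kernel (row b) i (col b) j)).
rewrite big_seq [RHS]big_seq; apply: eq_bigr => a ar; rewrite mulr_sumr.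
rewrite big_seq [RHS]big_seq; apply: eq_bigr => b br; rewrite mulrA; congr (_ * _).
rewrite /word_kernel !rowE // !colE // !size_map !eqxx /= /haar_word size_cat size_rev.
by rewrite /unzip1 /unzip2 !map_cat !map_rev.
Qed.

End Positivity.

Lemma haar_word_ge0 (r : seq (seq (X * X))) (c : seq (X * X) -> C) :
  0 <= \sum_(a <- r) \sum_(b <- r) Num.conj (c a) * c b * haar_word (rev a ++ b).
Proof.
apply: (@haar_word_ge0_bounded (\max_(a <- r) size a)).
by apply/allP => a ar; exact: leq_bigmax_seq.
Qed.

End HaarWords.

(** * A magic unitary realizing the Haar functional *)

Lemma malg_scaleAr (C : comNzRingType) (K : monomType) c (a b : {malg C[K]}) :
  c *: (a * b) = a * (c *: b).
Proof.
rewrite -!mul_malgC !mulrA; congr (_ * _).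
rewrite !malgM_def fgmulUg fgmulgU; apply: eq_bigr => k _.
by rewrite mul1m mulm1 mulrC.
Qed.

Section FreeAlgebra.
Variables (C : comNzRingType) (L : choiceType).

Definition free_algebra := {malg C[{fmonom L}]}.
HB.instance Definition _ := GRing.Lalgebra.on free_algebra.

Lemma free_algebra_scaleAr c (a b : free_algebra) : c *: (a * b) = a * (c *: b).
Proof. exact: malg_scaleAr. Qed.

HB.instance Definition _ :=
  GRing.Lalgebra_isAlgebra.Build C free_algebra free_algebra_scaleAr.

Definition free_word (u : seq L) : free_algebra := << FMonom u >>.

Lemma free_wordM u v : free_word u * free_word v = free_word (u ++ v).
Proof.
rewrite /free_word malgM_def fgmulUU mulr1; congr << _ >>.
by apply/eqP; rewrite fmP fmM.
Qed.

Lemma free_algebra_span (a : free_algebra) :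
  exists (r : seq (seq L)) c, a = \sum_(u <- r) c u *: free_word u.
Proof.
exists [seq val k | k : {fmonom L} <- msupp a], (fun u => a@_(FMonom u)).
rewrite big_map {1}[a]monalgE; apply: eq_bigr => -[k] _.
by rewrite -mul_malgC malgM_def fgmulUU mulr1 mul1m.
Qed.

(** The map [sigma] on scalars is left general because the involution is conjugate-linear while
    functionals are linear. *)
Lemma free_algebra_lift (S : nzRingType) (sigma : {additive C -> S})
    (h : seq L -> S) :
  exists phi : free_algebra -> S, {morph phi : a b / a + b} /\
    forall c u, phi (c *: free_word u) = sigma c * h u.
Proof.
exists (mmap sigma (fun k : {fmonom L} => h k)).
split=> [|c u]; first exact: mmapD.
by rewrite -mul_malgC malgM_def fgmulUU mulr1 mul1m mmapU.
Qed.

End FreeAlgebra.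

Lemma free_algebra_universal (C : comNzRingType) (L : choiceType) :
  exists (F : algType C) (x : seq L -> F),
  [/\ forall u v, x u * x v = x (u ++ v),
      forall a, exists (r : seq (seq L)) c, a = \sum_(u <- r) c u *: x u
    & forall (S : nzRingType) (sigma : {additive C -> S}) (h : seq L -> S),
        exists phi : F -> S, {morph phi : a b / a + b} /\
          forall c u, phi (c *: x u) = sigma c * h u].
Proof.
exists (free_algebra C L), (@free_word C L).
by split; [exact: free_wordM | exact: free_algebra_span | exact: free_algebra_lift].
Qed.

Lemma free_star_algebra (C : numClosedFieldType) (L : choiceType) :
  exists (F : algType C) (x : seq L -> F) (st : F -> F),
  [/\ [/\ x [::] = 1 & forall u v, x u * x v = x (u ++ v)],
      forall a, exists (r : seq (seq L)) c, a = \sum_(u <- r) c u *: x u,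
      forall h : seq L -> C, exists phi : {scalar F}, forall u, phi (x u) = h u
    & [/\ involutive st, {morph st : a b / a + b},
          forall c a, st (c *: a) = Num.conj c *: st a,
          forall a b, st (a * b) = st b * st a & forall u, st (x u) = x (rev u)]].
Proof.
have [F [x [xM span lift]]] := free_algebra_universal C L.
have ind (Pr : F -> Prop) : Pr 0 ->
    (forall c u a, Pr a -> Pr (c *: x u + a)) -> forall a, Pr a.
  move=> P0 PD a; have [r [c ->]] := span a.
  by elim: r => [|u r IH]; rewrite ?big_nil ?big_cons //; exact: PD.
have [st [stD stZx]] := lift F (in_alg F \o Num.conj) (fun u => x (rev u)).
have x1 : x [::] = 1.
  have xE a : x [::] * a = a.
    elim/ind: a => [|c u a IH]; first by rewrite mulr0.
    by rewrite mulrDr IH -scalerAr xM.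
  by rewrite -[LHS]mulr1 xE.
have st0 : st 0 = 0 by apply: (addIr (st 0)); rewrite -stD !add0r.
have stx u : st (x u) = x (rev u).
  by rewrite -[x u]scale1r stZx /= rmorph1 scale1r mul1r.
have stZ c a : st (c *: a) = Num.conj c *: st a.
  elim/ind: a => [|d u a IH]; first by rewrite st0 !scaler0 st0.
  rewrite scalerDr !stD scalerDr IH scalerA !stZx /= rmorphM /=.
  by rewrite !mulr_algl scalerA.
exists F, x, st; split => // [h|].
  have [phi [phiD phiZx]] := lift C idfun h.
  have phi0 : phi 0 = 0 by apply: (addIr (phi 0)); rewrite -phiD !add0r.
  have phiZ c a : phi (c *: a) = c * phi a.
    elim/ind: a => [|d u a IH]; first by rewrite scaler0 phi0 mulr0.
    by rewrite scalerDr !phiD IH scalerA !phiZx mulrDr mulrA.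
  have phi_lin : linear_for *%R phi by move=> c a b; rewrite phiD phiZ.
  pose phiL := GRing.isLinear.Build C F C *%R phi phi_lin.
  pose Phi : {scalar F} := HB.pack phi phiL.
  by exists Phi => u; rewrite /= -[x u]scale1r phiZx mul1r.
split=> //.
  elim/ind => [|c u a IH]; first by rewrite !st0.
  by rewrite !stD IH !stZ !stx conjCK revK.
elim/ind => [b|c u a IH b]; first by rewrite mul0r st0 mulr0.
rewrite mulrDl !stD IH mulrDr -scalerAl !stZ -scalerAr; congr (_ *: _ + _).
elim/ind: b => [|d v b IHb]; first by rewrite mulr0 st0 mul0r.
rewrite mulrDr !stD IHb mulrDl; congr (_ + _).
by rewrite -scalerAr !stZ -scalerAl xM !stx rev_cat xM.
Qed.

(** * The C*-algebra of a positive functional on words in projections *)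

Section WordState.
Variables (R : realType) (L : choiceType) (h : seq L -> R[i]).
Hypothesis h_nil : h [::] = 1.
Hypothesis h_ge0 : forall (r : seq (seq L)) (c : seq L -> R[i]),
  0 <= \sum_(a <- r) \sum_(b <- r) Num.conj (c a) * c b * h (rev a ++ b).
Hypothesis h_idem : forall a p b, h (a ++ p :: p :: b) = h (a ++ p :: b).

(** Relations that [h] satisfies in every context a, b become relations in [B]; conversely,
    relations in [B] are seen by [h]. Left multiplications are bounded because the letters act as
    projections. *)
Lemma word_state_gns : exists (B : cstarAlgType R) (v : L -> B),
  [/\ forall p, projection (v p),
      forall s : seq (R[i] * seq L),
        (forall a b, \sum_(p <- s) p.1 * h (a ++ p.2 ++ b) = 0) ->
        \sum_(p <- s) p.1 *: \prod_(q <- p.2) v q = 0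
    & forall s : seq (R[i] * seq L),
        \sum_(p <- s) p.1 *: \prod_(q <- p.2) v q = 0 ->
        \sum_(p <- s) p.1 * h p.2 = 0].
Proof.
have [F [x [st [[x1 xM] span lift [stK stD stZ stM stx]]]]] :=
  free_star_algebra R[i] L.
have [phi phix] := lift h.
have phiZ c a : phi (c *: a) = c * phi a by exact: linearZ.
have st0 : st 0 = 0 by apply: (addIr (st 0)); rewrite -stD !add0r.
have stS (I : Type) (r : seq I) (G : I -> F) :
    st (\sum_(i <- r) G i) = \sum_(i <- r) st (G i).
  by elim: r => [|i r IH]; rewrite ?big_nil ?big_cons ?stD ?IH.
have stB a b : st (a - b) = st a - st b.
  by rewrite stD -scaleN1r stZ rmorphN rmorph1 scaleN1r.
have phi_ge0 a : 0 <= phi (st a * a).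
  have [r [c ->]] := span a; rewrite stS mulr_suml raddf_sum /=.
  under eq_bigr => u _.
    rewrite mulr_sumr raddf_sum /=; under eq_bigr => v _.
      rewrite stZ stx -scalerAl -scalerAr scalerA xM phiZ phix.
      over.
    over.
  exact: h_ge0.
have phi1 : phi 1 = 1 by rewrite -x1 phix h_nil.
pose Bd a := exists2 M : R, 0 <= M &
  forall b, phi (st (a * b) * (a * b)) <= M%:C * phi (st b * b).
have Bd_gen p : Bd (x [:: p]).
  exists 1 => // b; rewrite mul1r.
  (* A letter is a contraction: by idempotence the squared length of pb is the inner product of b
     with pb, so the squared length of b - pb is the difference of those of b and pb. Hence the
     constant 1. *)
  have xx : forall b, phi (st (x [:: p] * b) * (x [:: p] * b)) =
      phi (st b * (x [:: p] * b)).
    move=> d; have [r [c ->]] := span d.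
    rewrite stM stS stx mulr_sumr !mulr_suml !raddf_sum /=.
    apply: eq_bigr => u _; rewrite !mulr_sumr !raddf_sum /=; apply: eq_bigr => v _.
    rewrite stZ stx -!(scalerAl, scalerAr) !phiZ !xM !phix /=.
    by rewrite -catA /= h_idem.
  have := phi_ge0 (b - x [:: p] * b); rewrite stB mulrBr !mulrBl !raddfB /= !xx.
  have -> : phi (st (x [:: p] * b) * b) = phi (st b * (x [:: p] * b)).
    by rewrite stM stx mulrA.
  by rewrite subrr addr0 subr_ge0.
have BdM a b : Bd a -> Bd b -> Bd (a * b).
  move=> [M M0 aM] [N N0 bN]; exists (M * N) => [|d]; first exact: mulr_ge0.
  rewrite -mulrA; apply: le_trans (aM _) _; rewrite rmorphM /= -mulrA.
  by apply: ler_wpM2l => //; rewrite lecR.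
have BdZ c a : Bd a -> Bd (c *: a).
  move=> [M M0 aM]; exists (normc c ^+ 2 * M) => [|b].
    by rewrite mulr_ge0 // sqr_ge0.
  rewrite -scalerAl stZ -scalerAl -scalerAr scalerA phiZ.
  have -> : Num.conj c * c = (normc c ^+ 2)%:C.
    by rewrite -normCKC normc_def rmorphXn; case: c.
  have -> : (normc c ^+ 2 * M)%:C = (normc c ^+ 2)%:C * M%:C by exact: rmorphM.
  by rewrite -[leRHS]mulrA; apply: ler_wpM2l; rewrite ?lecR ?sqr_ge0.
(* Dropping the second term bounds a sum of two bounded elements; this is the factor 2 in the
   constant for a + b. *)
have parallelogram p q : phi (st (p + q) * (p + q)) + phi (st (p - q) * (p - q)) =
    2 * (phi (st p * p) + phi (st q * q)).
  rewrite stB stD mulrDr mulrBr !mulrBl !(mulrDl (st p) (st q)).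
  by rewrite !(raddfD, raddfB) /=; ring.
have BdD a b : Bd a -> Bd b -> Bd (a + b).
  move=> [M M0 aM] [N N0 bN]; exists (2 * (M + N)) => [|d].
    by rewrite mulr_ge0 // addr_ge0.
  apply: (@le_trans _ _ (2 * (phi (st (a * d) * (a * d)) + phi (st (b * d) * (b * d))))).
    by rewrite -parallelogram mulrDl lerDl phi_ge0.
  have -> : (2 * (M + N))%:C = 2 * (M%:C + N%:C).
    by rewrite [LHS]rmorphM rmorph_nat [X in _ * X]rmorphD.
  rewrite -[leRHS]mulrA; apply: ler_wpM2l; first exact: ler0n.
  by rewrite [leRHS]mulrDl; apply: lerD.
have Bd1 : Bd 1 by exists 1 => // b; rewrite !mul1r.
have BdA a : Bd a.
  have [r [c ->]] := span a; elim: r => [|u r IH].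
    rewrite big_nil; exists 0 => // b.
    by rewrite mul0r st0 mul0r raddf0 mul0r.
  rewrite big_cons; apply: BdD => //; apply: BdZ.
  elim: u => [|p u IHu]; first by rewrite x1.
  by rewrite -cat1s -xM; apply: BdM.
have [|S [Sst S0 Snull]] := gns_seminorm stK stD stZ stM phi_ge0 phi1.
  by move=> a; have [M _ aM] := BdA a; exists M.
have [B [f [fst fn]]] := CStarCompletion.completion S.
have fx s : f (\sum_(p <- s) p.1 *: x p.2) =
    \sum_(p <- s) p.1 *: \prod_(q <- p.2) f (x [:: q]).
  rewrite raddf_sum /=; apply: eq_bigr => -[c u] _; rewrite linearZ /=; congr (_ *: _).
  elim: u => [|p u IH]; first by rewrite x1 rmorph1 big_nil.
  by rewrite big_cons -IH -rmorphM xM.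
have null s : (forall a b, \sum_(p <- s) p.1 * h (a ++ p.2 ++ b) = 0) ->
    \sum_(p <- s) p.1 *: \prod_(q <- p.2) f (x [:: q]) = 0.
  move=> hs; rewrite -fx; apply: cnorm_eq0; rewrite fn; apply: Snull => b.
  set z := \sum_(p <- s) _.
  have zz u v : phi (x u * (z * x v)) = 0.
    rewrite /z mulr_suml mulr_sumr raddf_sum /=; apply: etrans (hs u v); apply: eq_bigr => p _.
    by rewrite -scalerAl -scalerAr phiZ !xM phix.
  rewrite stM mulrA.
  have [r [c ->]] := span (st b * st z); have [r' [c' ->]] := span b.
  rewrite -mulrA mulr_suml raddf_sum /= big1 // => u _.
  rewrite !mulr_sumr raddf_sum /= big1 // => v _.
  by rewrite -!(scalerAl, scalerAr) !phiZ zz !mulr0.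
exists B, (fun p => f (x [:: p])); split => // [p|s].
  split; first by rewrite -fst Sst stx.
  apply/eqP; rewrite -subr_eq0; apply/eqP.
  have := null [:: (1, [:: p; p]); (- 1, [:: p])].
  rewrite !big_cons !big_nil /= scaleN1r scale1r addr0 !mulr1; apply=> a b.
  by rewrite !big_cons !big_nil /= h_idem mul1r mulN1r addr0 subrr.
rewrite -fx => fs0; have := S0 (\sum_(p <- s) p.1 *: x p.2).
rewrite -fn fs0 -(scale0r 0) cnormZ normc0 mul0r => /(_ erefl) z0.
by apply: etrans z0; rewrite raddf_sum /=; apply: eq_bigr => p _; rewrite phiZ phix.
Qed.

End WordState.

Lemma haar_word_gns (R : realType) (n : nat) (x0 : 'I_n) : (4 <= n)%N ->
  exists (B : cstarAlgType R) (v : 'M[B]_n), magic_unitary v /\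
    forall s : seq (R[i] * seq ('I_n * 'I_n)),
      \sum_(p <- s) p.1 *: \prod_(q <- p.2) v q.1 q.2 = 0 ->
      \sum_(p <- s) p.1 * haar_word R[i] x0 p.2 = 0.
Proof.
rewrite -[n in (4 <= n)%N]card_ord => card_X.
have [||a [i j] b|B [v [vp null inj]]] :=
  word_state_gns (h := haar_word R[i] x0).
- exact: haar_word_nil.
- exact: haar_word_ge0.
- by rewrite haar_word_row // eqxx mul1r.
exists B, (\matrix_(i, j) v (i, j)); split; last first.
  move=> s s0; apply: inj; rewrite -[RHS]s0; apply: eq_bigr => p _.
  by congr (_ *: _); apply: eq_bigr => -[i j] _; rewrite mxE.
have null0 p q : (forall a b, haar_word R[i] x0 (a ++ p :: q :: b) = 0) ->
    v p * v q = 0.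
  move=> pq0; have := null [:: (1, [:: p; q])].
  rewrite !big_cons !big_nil /= scale1r addr0 mulr1; apply=> a b.
  by rewrite !big_cons !big_nil /= mul1r addr0 pq0.
have null1 (f : 'I_n -> 'I_n * 'I_n) :
    (forall a b, \sum_i haar_word R[i] x0 (a ++ f i :: b) = haar_word R[i] x0 (a ++ b)) ->
    \sum_i v (f i) = 1.
  move=> f1; apply/eqP; rewrite -subr_eq0; apply/eqP.
  have := null ((- 1, [::]) :: [seq (1, [:: f i]) | i <- index_enum 'I_n]).
  rewrite big_cons big_nil /= scaleN1r addrC big_map.
  under eq_bigr => i _ do rewrite big_cons big_nil mulr1 scale1r.
  apply=> a b; rewrite big_cons /= mulN1r big_map -f1.
  under [X in _ + X]eq_bigr => i _ do rewrite mul1r.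
  exact: addNr.
split=> [i j|i j k jk|i j k ij|i|j].
- by rewrite mxE.
- rewrite !mxE; apply: null0 => a b; rewrite haar_word_row // (negPf jk).
  exact: mul0r.
- rewrite !mxE; apply: null0 => a b; rewrite haar_word_col // (negPf ij).
  exact: mul0r.
- under eq_bigr do rewrite mxE; apply: (null1 (pair i)) => a b.
  exact: haar_word_sum_col.
under eq_bigr do rewrite mxE; apply: (null1 (pair^~ j)) => a b.
exact: haar_word_sum_row.
Qed.

(** * The Haar state *)

Section MagicWords.
Variables (C : numClosedFieldType) (n : nat) (x0 : 'I_n).

Definition word_prod (A : pzRingType) (u : 'M[A]_n) k (I J : nat -> 'I_n) : A :=
  \prod_(0 <= i < k) u (I i) (J i).

Section Algebra.
Variables (A : algType C) (u : 'M[A]_n).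
Hypothesis u_idem : forall i j, u i j * u i j = u i j.
Hypothesis u_col : forall i i' j, i != i' -> u i j * u i' j = 0.
Hypothesis u_sum : forall i, \sum_j u i j = 1.
Implicit Types (I J w : nat -> 'I_n).

Lemma word_prod_ins k r I x w : (r <= k)%N ->
  word_prod u k.+1 I (insw r x w) =
  word_prod u r I w * u (I r) x * \prod_(r <= i < k) u (I i.+1) (w i).
Proof.
move=> rk; rewrite /word_prod (big_cat_nat (n := r)) //=; last exact: leqW.
rewrite -mulrA; congr (_ * _).
  by apply: eq_big_nat => i /andP[_ ir]; rewrite /insw ir.
rewrite big_ltn // big_add1 /=; congr (_ * _).
  by rewrite /insw ltnn eqxx.
apply: eq_big_nat => i /andP[ri _].
by rewrite /insw ltnNge leqW //= gtn_eqF // ltnS.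
Qed.

Lemma word_prod_bump k r I w : (r <= k)%N ->
  word_prod u k (I \o bump r) w =
  word_prod u r I w * \prod_(r <= i < k) u (I i.+1) (w i).
Proof.
move=> rk; rewrite /word_prod (big_cat_nat (n := r)) //=; congr (_ * _).
  by apply: eq_big_nat => i /andP[_ ir]; rewrite /bump leqNgt ir.
by apply: eq_big_nat => i /andP[ri _]; rewrite /bump ri.
Qed.

Lemma insw_bump r x w : insw r x w \o bump r = w.
Proof.
apply/funext => i; rewrite /insw /bump /=; case: (leqP r i) => ri.
  by rewrite add1n ltnNge leqW //= gtn_eqF // ltnS.
by rewrite add0n ri.
Qed.

(** Planar functions are fixed vectors of the tensor powers of u. An inserted singleton is absorbed
    by a row sum, a doubled letter by idempotence and by orthogonality within a column. *)
Lemma planar_word_prod k f I : planar k f ->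
  wsum x0 k (fun w => f w *: word_prod u k I w) = f I *: 1.
Proof.
move=> kf; elim: kf I => {k f} [|k|k c f g _ IHf _ IHg|k r f rk _ IH|k r f rk _ IH] I.
- by rewrite wsum0 /word_prod big_geq.
- by rewrite scale0r /wsum big1 // => t _; rewrite scale0r.
- rewrite scalerDl -scalerA -IHf -IHg /wsum scaler_sumr -big_split.
  by apply: eq_bigr => t _; rewrite scalerDl scalerA.
- rewrite (wsum_ins _ _ rk) -wsum_sum -[RHS]/(f (I \o bump r) *: 1) -IH.
  apply: eq_wsum => w; rewrite (word_prod_bump _ _ rk).
  have -> : word_prod u r I w = \sum_x word_prod u r I w * u (I r) x.
    by rewrite -mulr_sumr u_sum mulr1.
  rewrite mulr_suml scaler_sumr; apply: eq_bigr => x _.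
  by rewrite insw_bump word_prod_ins.
rewrite (wsum_ins _ _ rk) -wsum_sum -[f (I \o _)]/(f (I \o bump r.+1)) -scalerA -IH.
rewrite /wsum scaler_sumr; apply: eq_bigr => t _; set w := nth x0 t.
rewrite (bigD1 (w r)) //= big1 ?addr0 => [|x xr]; last first.
  have -> : insw r.+1 x w r = w r by rewrite /insw ltnSn.
  have -> : insw r.+1 x w r.+1 = x by rewrite /insw ltnn eqxx.
  by rewrite eq_sym (negPf xr) mul0r scale0r.
have -> : insw r.+1 (w r) w r = w r by rewrite /insw ltnSn.
have -> : insw r.+1 (w r) w r.+1 = w r by rewrite /insw ltnn eqxx.
rewrite insw_bump eqxx mul1r scalerA mulrC -scalerA; congr (_ *: _).
rewrite word_prod_ins // word_prod_bump //.
have wr : word_prod u r.+1 I w = word_prod u r I w * u (I r) (w r).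
  by rewrite /word_prod big_nat_recr.
rewrite wr -[_ * u (I r.+1) _]mulrA; have [<-|Ir] := eqVneq.
  by rewrite u_idem scale1r.
by rewrite u_col // mulr0 mul0r scale0r.
Qed.

End Algebra.

Lemma rmorph_word_prod (A B : pzRingType) (f : {rmorphism A -> B})
    (u : 'M[A]_n) (v : 'M[B]_n) k I J :
  (forall i j, f (u i j) = v i j) -> f (word_prod u k I J) = word_prod v k I J.
Proof.
by move=> fu; rewrite rmorph_prod; apply: eq_bigr => i _; rewrite fu.
Qed.

Lemma wsum_last (V : nmodType) k (F : (nat -> 'I_n) -> V) :
  wsum x0 k.+1 F = wsum x0 k (fun w => \sum_x F (insw k x w)).
Proof. by rewrite wsum_sum; apply: wsum_ins. Qed.

Lemma word_prodS (A : pzRingType) (u : 'M[A]_n) k I J :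
  word_prod u k.+1 I J = word_prod u k I J * u (I k) (J k).
Proof. by rewrite /word_prod big_nat_recr. Qed.

Lemma eq_word_prod (A : pzRingType) (u : 'M[A]_n) k I I' J J' :
  (forall i, (i < k)%N -> I i = I' i) -> (forall i, (i < k)%N -> J i = J' i) ->
  word_prod u k I J = word_prod u k I' J'.
Proof. by move=> II JJ; apply: eq_big_nat => i /andP[_ ik]; rewrite II ?JJ. Qed.

End MagicWords.

Section Haar.
Variables (R : realType) (n : nat) (x0 : 'I_n) (A T : cstarAlgType R).
Variables (u : 'M[A]_n) (t : A -> A -> T) (Delta : {lrmorphism A -> T}).
Hypothesis card_n : (4 <= n)%N.
Hypothesis u_universal : quantum_permutation_algebra u.
Hypothesis t_tensor : min_cstar_tensor t.
Hypothesis Delta_u : comultiplication u t Delta.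
Local Notation P := (fixed_proj R[i]).
Local Notation U := (word_prod u).

Lemma comultiplication_word_prod k I J :
  Delta (U k I J) = wsum x0 k (fun K => t (U k I K) (U k K J)).
Proof.
have [[tDl tDr t1 tM _ _ _] _] := t_tensor; have [_ Du] := Delta_u.
elim: k => [|k IH].
  by rewrite wsum0 /word_prod !big_geq // rmorph1 t1.
rewrite word_prodS rmorphM /= IH Du wsum_last /wsum mulr_suml.
apply: eq_bigr => K _; rewrite mulr_sumr; apply: eq_bigr => x _.
have Kk i : (i < k)%N -> nth x0 K i = insw k x (nth x0 K) i.
  by rewrite /insw => ->.
have xk : insw k x (nth x0 K) k = x by rewrite /insw ltnn eqxx.
rewrite !word_prodS xk tM; congr (t (_ * _) (_ * _)); exact: eq_word_prod.
Qed.

Lemma haar_state_word_prod (h : {scalar A}) k I J :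
  haar_state t Delta h -> h (U k I J) = P k I J.
Proof.
move=> [[_ h1] [S [_ St] SD] _].
have [magic_u univ] := u_universal.
have invariance : wsum x0 k (fun K => h (U k I K) *: U k K J) = h (U k I J) *: 1.
  rewrite -SD comultiplication_word_prod /wsum raddf_sum.
  by apply: eq_bigr => K _; rewrite /= St.
have card_X : (4 <= #|'I_n|)%N by rewrite card_ord.
have [B [v [magic_v inj]]] := haar_word_gns R x0 card_n.
have [f [_ fu _]] := univ B v magic_v.
have hP : h (U k I J) = wsum x0 k (fun K => h (U k I K) * P k K J).
  (* The image of the invariance relation under [f], written as a linear relation between words in
     [v]; the empty word carries the unit. *)
  pose s := (- h (U k I J), [::]) ::
    [seq (h (U k I (nth x0 K)), [seq (nth x0 K i, J i) | i <- iota 0 k])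
       | K : k.-tuple 'I_n <- index_enum _].
  have /inj : \sum_(p <- s) p.1 *: \prod_(q <- p.2) v q.1 q.2 = 0.
    rewrite big_cons big_nil big_map /= addrC; apply/eqP.
    rewrite scaleNr subr_eq0; apply/eqP.
    have := congr1 f invariance; rewrite linearZ /= rmorph1 => <-.
    rewrite /wsum raddf_sum; apply: eq_bigr => K _.
    rewrite /= linearZ /= (rmorph_word_prod _ _ _ fu) big_map.
    by rewrite /word_prod /index_iota subn0.
  rewrite big_cons haar_word_nil // mulr1 big_map addrC => /eqP.
  rewrite subr_eq0 => /eqP <-; apply: eq_bigr => K _; congr (_ * _).
  rewrite /haar_word /= size_map size_iota /unzip1 /unzip2 -!map_comp.
  by apply: (fixed_proj_local _ x0) => i ik;
    rewrite (nth_map 0%N) ?size_iota // nth_iota.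
have [u_proj _ u_col u_row _] := magic_u.
have /(congr1 h) := planar_word_prod x0 (fun i j => (u_proj i j).2) u_col u_row I
  (planar_fixed_proj R[i] k J).
rewrite linearZ /= h1 mulr1 => <-; rewrite hP /wsum raddf_sum.
by apply: eq_bigr => K _; rewrite /= linearZ /= mulrC.
Qed.

End Haar.

(** * Expansion of the power and the trace formula *)

Lemma compatible_comp (X Y : finType) (g : X -> Y) k (p : {set {set 'I_k}}) w :
  injective g -> compatible p (g \o w) = compatible p w.
Proof.
by move=> g_inj; apply/compatibleP/compatibleP => E i j /E /=; [move/g_inj | move->].
Qed.

Lemma sum_pow (A : pzRingType) (X : finType) (x0 : X) (F : X -> A) k :
  (\sum_x F x) ^+ k = wsum x0 k (fun w => \prod_(0 <= i < k) F (w i)).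
Proof.
elim: k => [|k IH]; first by rewrite wsum0 expr0 big_geq.
rewrite exprSr IH (wsum_ins _ _ (leqnn k)) -wsum_sum /wsum mulr_suml.
apply: eq_bigr => t _; rewrite mulr_sumr; apply: eq_bigr => x _.
rewrite big_nat_recr //= {2}/insw ltnn eqxx; congr (_ * _).
by apply: eq_big_nat => i /andP[_ ik]; rewrite /insw ik.
Qed.

Lemma mxtrace_mulE (F : comPzRingType) m (M N : 'M[F]_m) :
  \tr (M *m N) = \sum_i \sum_j M i j * N j i.
Proof. by apply: eq_bigr => i _; rewrite mxE. Qed.

Theorem theorem2p2 (R : realType) (n k s : nat) (hn : (4 <= n)%N)
    (hk : (1 <= k)%N) (hs1 : (1 <= s)%N) (hsn : (s <= n)%N)
    (A : cstarAlgType R) (u : 'M[A]_n)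
    (hA : quantum_permutation_algebra u)
    (T : cstarAlgType R) (t : A -> A -> T) (hT : min_cstar_tensor t)
    (Delta : {lrmorphism A -> T}) (hDelta : comultiplication u t Delta)
    (h : {scalar A}) (hh : haar_state t Delta h) :
  gram R[i] k n \in unitmx /\
  h ((\sum_(i < n | (i < s)%N) u i i) ^+ k)
    = \tr (invmx (gram R[i] k n) *m gram R[i] k s).
Proof.
have hX : (4 <= #|'I_n|)%N by rewrite card_ord.
pose y0 : 'I_s := Ordinal hs1; pose g := widen_ord hsn; pose x0 := g y0.
split; first by rewrite -{1}[n]card_ord (gram_unit x0).
have g_inj : injective g by move=> x y /(congr1 val) /= xy; apply: val_inj.
rewrite (big_ord_narrow hsn) (sum_pow y0) /wsum raddf_sum mxtrace_mulE.
transitivity (wsum y0 k (fun w => fixed_proj R[i] k (g \o w) (g \o w))).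
  apply: eq_bigr => w _ /=.
  exact: (haar_state_word_prod x0 hn hA hT hDelta k (g \o nth y0 w) (g \o nth y0 w) hh).
rewrite /fixed_proj wsum_sum; apply: eq_bigr => a _.
rewrite wsum_sum; apply: eq_bigr => b _.
rewrite wsumZ; congr (invmx (gram _ _ _) _ _ * _); first by rewrite card_ord.
rewrite -[s in RHS]card_ord (gramE y0).
by apply: eq_wsum => w; rewrite !(compatible_comp _ _ g_inj) mulrC.
Qed.
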